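(* Let $s\in\mathbb{R}$, $0<p,q\le\infty$ and $a>0$. The spaces $\dot L^s_{p,q}(\mathcal{G})$, $\dot T^s_{p,q}(\mathcal{G})$ and $\dot P^{s,a}_{p,q}(\mathcal{G})$ are left and right translation invariant. Precisely, for $(z,r)\in\mathcal{G}$ we have $$\|L_{(z,r)}:\dot L^s_{p,q}(\mathcal{G})\to\dot L^s_{p,q}(\mathcal{G})\|=r^{d(1/p-1/q)-s},$$ $$\|R_{(z,r)}:\dot L^s_{p,q}(\mathcal{G})\to\dot L^s_{p,q}(\mathcal{G})\|=r^{s+d/q},$$ $$\|L_{(z,r)}:\dot T^s_{p,q}(\mathcal{G})\to\dot T^s_{p,q}(\mathcal{G})\|=r^{d/p-s},$$ $$\|R_{(z,r)}:\dot T^s_{p,q}(\mathcal{G})\to\dot T^s_{p,q}(\mathcal{G})\|\le C\,r^{d/q+s}\max\{1,r^{-b}(1+|z|)^b\},$$ where $C$ is a constant and $b>0$ is a constant depending on $d$, $p$ and $q$. Furthermore, we have $$\|L_{(z,r)}:\dot P^{s,a}_{p,q}(\mathcal{G})\to\dot P^{s,a}_{p,q}(\mathcal{G})\|=r^{d(1/p-1/q)-s},$$ $$\|R_{(z,r)}:\dot P^{s,a}_{p,q}(\mathcal{G})\to\dot P^{s,a}_{p,q}(\mathcal{G})\|\le r^{s+d/q}\max\{1,r^{-a}\}(1+|z|)^a.$$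
   Context: $\mathcal{G}=\mathbb{R}^d\rtimes\mathbb{R}_+^*$ is the $d$-dimensional $ax+b$-group, i.e. the set of $(x,t)$ with $x\in\mathbb{R}^d$, $t>0$ and multiplication $(x,t)(y,s)=(x+ty,st)$. For a function $F$ on $\mathcal{G}$ the left and right translations are $L_{(z,r)}F(x,t)=F\big(\frac{x-z}{r},\frac tr\big)$ and $R_{(z,r)}F(x,t)=F(x+tz,rt)$; $\|A:X\to X\|$ denotes the operator (quasi-)norm. For $s\in\mathbb{R}$, $0<p,q\le\infty$ and $a>0$ the spaces $\dot L^s_{p,q}(\mathcal{G})$, $\dot T^s_{p,q}(\mathcal{G})$, $\dot P^{s,a}_{p,q}(\mathcal{G})$ of functions on $\mathcal{G}$ are defined via the finiteness of the (quasi-)norms $$\|F|\dot L^s_{p,q}(\mathcal{G})\|=\Big(\int_0^\infty t^{-sq}\|F(\cdot,t)|L_p(\mathbb{R}^d)\|^q\frac{dt}{t^{d+1}}\Big)^{1/q},$$ $$\|F|\dot T^s_{p,q}(\mathcal{G})\|=\Big\|\Big(\int_0^\infty t^{-sq}\int_{B(0,t)}|F(x+z,t)|^q\,dz\,\frac{dt}{t^{d+1}}\Big)^{1/q}\Big|L_p(\mathbb{R}^d)\Big\|,$$ $$\|F|\dot P^{s,a}_{p,q}(\mathcal{G})\|=\Big\|\Big(\int_0^\infty t^{-sq}\Big[\sup_{y\in\mathbb{R}^d}\frac{|F(x+y,t)|}{(1+|y|/t)^a}\Big]^q\frac{dt}{t^{d+1}}\Big)^{1/q}\Big|L_p(\mathbb{R}^d)\Big\|,$$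 where the outer $L_p$-(quasi-)norm in the last two is taken in $x$, $B(0,t)$ is the ball of radius $t$ centered at $0$, and the usual modification is used in case $q=\infty$.
   Formalization: Equality for the norm of L on P is proved for a > d/p (only ≤ otherwise: if p < ∞ and a ≤ d/p, P has only functions of norm 0); right invariance and the bound for R on T exclude p = ∞, q < ∞, where the bound fails. *)

(* Defs.v *)
From HB Require Import structures.
From mathcomp Require Import all_boot all_order all_algebra.
From mathcomp Require Import all_classical all_reals all_analysis.
From mathcomp Require Import ess_sup_inf.
From mathcomp.real_closed Require complex.

Set Implicit Arguments.
Unset Strict Implicit.
Unset Printing Implicit Defensive.

Import Order.TTheory GRing.Theory Num.Theory.
Import numFieldNormedType.Exports.

Local Open Scope classical_set_scope.
Local Open Scope ring_scope.

(* R^n is ['rV[R]_n].  MathComp-Analysis has neither a sigma-algebra nor a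
   Lebesgue measure on it; both are built here. *)

Definition rV_display : measure_display.
Proof. exact: default_measure_display. Qed.

Section measurable_rV.
Variables (R : realType) (n : nat).

Definition rV_coord (i : 'I_n) (x : 'rV[R]_n) : measurableTypeR R := x 0 i.

Let rV_set0 : g_sigma_preimage rV_coord set0.
Proof. exact: sigma_algebra0. Qed.

Let rV_setC A : g_sigma_preimage rV_coord A -> g_sigma_preimage rV_coord (~` A).
Proof. exact: sigma_algebraC. Qed.

Let rV_bigcup (F : (set 'rV[R]_n)^nat) :
  (forall i, g_sigma_preimage rV_coord (F i)) ->
  g_sigma_preimage rV_coord (\bigcup_i (F i)).
Proof. exact: sigma_algebra_bigcup. Qed.

HB.instance Definition _ :=
  @isMeasurable.Build rV_display 'rV[R]_n
    (g_sigma_preimage rV_coord) rV_set0 rV_setC rV_bigcup.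

End measurable_rV.

Lemma measurable_rV_coord (R : realType) n (i : 'I_n) :
  measurable_fun [set: 'rV[R]_n] (fun x : 'rV[R]_n => x 0 i).
Proof.
move=> _ Y mY; rewrite setTI; apply: sub_sigma_algebra => /=.
rewrite -bigcup_seq/=; exists i => /=; first by rewrite mem_index_enum.
by exists Y => //; rewrite setTI.
Qed.

Lemma measurable_fun_rVP d (T : measurableType d) (R : realType) n
    (f : T -> 'rV[R]_n) :
  (forall i, measurable_fun [set: T] (fun t => f t 0 i)) ->
  measurable_fun [set: T] f.
Proof.
move=> mf _ Y mY; rewrite setTI.
pose G : set (set 'rV[R]_n) := [set A | measurable (f @^-1` A)].
suff: G Y by [].
apply: mY; split.
  split; first by rewrite /G/= preimage_set0.
  - by move=> A GA; rewrite /G/= setTD preimage_setC; exact: measurableC.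
  - by move=> A GA; rewrite /G/= preimage_bigcup; exact: bigcupT_measurable.
move=> A; rewrite -bigcup_seq/= => -[i _ [B mB <-]].
rewrite /G/= setTI.
by have := mf i measurableT B mB; rewrite setTI.
Qed.

Section lebesgue_rV_construction.
Variable R : realType.

Definition rV_cons n (u : measurableTypeR R * 'rV[R]_n) : 'rV[R]_n.+1 :=
  \row_i (if unlift ord0 i is Some j then u.2 0 j else u.1).

Definition rV_uncons n (x : 'rV[R]_n.+1) :
    measurableTypeR R * 'rV[R]_n :=
  (x 0 ord0, \row_j x 0 (lift ord0 j)).

Lemma rV_consK n : cancel (@rV_cons n) (@rV_uncons n).
Proof.
case=> a v; rewrite /rV_uncons /rV_cons !mxE/= unlift_none; congr pair.
by apply/rowP => j; rewrite !mxE liftK.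
Qed.

Lemma measurable_rV_cons n :
  measurable_fun [set: measurableTypeR R * 'rV[R]_n] (@rV_cons n).
Proof.
apply: measurable_fun_rVP => i; rewrite /rV_cons.
case: (unliftP ord0 i) => [j ->|->].
- apply: (eq_measurable_fun (fun u : measurableTypeR R * 'rV[R]_n => u.2 0 j)).
    by move=> u _; rewrite mxE liftK.
  exact: (measurableT_comp (measurable_rV_coord j) measurable_snd).
- apply: (eq_measurable_fun (fun u : measurableTypeR R * 'rV[R]_n => u.1)).
    by move=> u _; rewrite mxE unlift_none.
  exact: measurable_fst.
Qed.

Lemma measurable_rV_uncons n :
  measurable_fun [set: 'rV[R]_n.+1] (@rV_uncons n).
Proof.
apply/measurable_fun_pairP; split; first exact: measurable_rV_coord.
apply: measurable_fun_rVP => i.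
apply: (eq_measurable_fun (fun x : 'rV[R]_n.+1 => x 0 (lift ord0 i))).
  by move=> x _; rewrite /= mxE.
exact: measurable_rV_coord.
Qed.

Section lebesgue_cons.
Local Open Scope ereal_scope.
Variables (n : nat) (mu : {sigma_finite_measure set 'rV[R]_n -> \bar R}).

Definition lebesgue_cons : set 'rV[R]_n.+1 -> \bar R :=
  pushforward (@lebesgue_measure R \x mu) (@rV_cons n).

Let measurable_preimage_cons A :
  measurable A -> measurable (@rV_cons n @^-1` A).
Proof.
by move=> mA; rewrite -[X in measurable X]setTI; exact: measurable_rV_cons.
Qed.

Let lebesgue_cons0 : lebesgue_cons set0 = 0.
Proof. by rewrite /lebesgue_cons /pushforward preimage_set0 measure0. Qed.

Let lebesgue_cons_ge0 A : 0 <= lebesgue_cons A.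
Proof. by apply: integral_ge0 => *. Qed.

Let lebesgue_cons_sigma_additive : semi_sigma_additive lebesgue_cons.
Proof.
move=> F mF tF mUF; rewrite /lebesgue_cons /pushforward preimage_bigcup.
apply: measure_semi_sigma_additive.
- by move=> k; exact: measurable_preimage_cons.
- apply/trivIsetP => /= i j _ _ ij; rewrite -preimage_setI.
  by move/trivIsetP : tF => /(_ _ _ _ _ ij) ->//; rewrite preimage_set0.
- by rewrite -preimage_bigcup; exact: measurable_preimage_cons.
Qed.

HB.instance Definition _ := isMeasure.Build _ _ _ lebesgue_cons
  lebesgue_cons0 lebesgue_cons_ge0 lebesgue_cons_sigma_additive.

Let lebesgue_cons_sigma_finite : sigma_finite setT lebesgue_cons.
Proof.
have /sigma_finiteP[F [TF ndF Foo]] :=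
  sigma_finiteT (@lebesgue_measure R : {sigma_finite_measure set _ -> \bar R}).
have /sigma_finiteP[G [TG ndG Goo]] := sigma_finiteT mu.
exists (fun k => @rV_uncons n @^-1` (F k `*` G k)).
  apply/esym; rewrite -subTset => x _.
  have [k _ Fk] : (\bigcup_k F k) (rV_uncons x).1 by rewrite -TF.
  have [l _ Gl] : (\bigcup_k G k) (rV_uncons x).2 by rewrite -TG.
  exists (maxn k l) => //; split.
  - by move: Fk; exact/subsetPset/ndF/leq_maxl.
  - by move: Gl; exact/subsetPset/ndG/leq_maxr.
move=> k; have [mFk Fk] := Foo k; have [mGk Gk] := Goo k; split.
  by rewrite -[X in measurable X]setTI; apply: measurable_rV_uncons => //;
    exact: measurableX.
rewrite /lebesgue_cons /pushforward -comp_preimage (_ : _ \o _ = id).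
  by rewrite preimage_id product_measure1E// lte_mul_pinfty// ge0_fin_numE.
by apply/funext => u; exact: rV_consK.
Qed.

HB.instance Definition _ := Measure_isSigmaFinite.Build _ _ _
  lebesgue_cons lebesgue_cons_sigma_finite.

End lebesgue_cons.

End lebesgue_rV_construction.

Fixpoint lebesgue_rV (R : realType) (n : nat) :
    {sigma_finite_measure set 'rV[R]_n -> \bar R} :=
  if n is m.+1 then lebesgue_cons (lebesgue_rV R m) else \d_(0 : 'rV[R]_0).

Section function_spaces.
Local Open Scope ereal_scope.
Variables (R : realType) (d : nat).

(* A function on the ax+b-group R^d x ]0, +oo[ is represented by a function on
   R^d x R; its values at t <= 0 are never used. *)
Definition axb_fun : Type := 'rV[R]_d * measurableTypeR R -> complex.complex R.

Definition axb_group : set ('rV[R]_d * measurableTypeR R) :=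
  [set u | (0 < u.2)%R].

Definition axb_mul (u v : 'rV[R]_d * measurableTypeR R) :
    'rV[R]_d * measurableTypeR R :=
  (u.1 + u.2 *: v.1, v.2 * u.2)%R.

Definition axb_measurable (F : axb_fun) : Prop :=
  measurable_fun axb_group (fun u => complex.Re (F u) : measurableTypeR R) /\
  measurable_fun axb_group (fun u => complex.Im (F u) : measurableTypeR R).

(* F((z, r)^-1 (x, t)) *)
Definition left_translation (z : 'rV[R]_d) (r : R) (F : axb_fun) : axb_fun :=
  fun u => F (r^-1 *: (u.1 - z), u.2 / r)%R.

(* F((x, t) (z, r)) *)
Definition right_translation (z : 'rV[R]_d) (r : R) (F : axb_fun) : axb_fun :=
  fun u => F (axb_mul u (z, r)).

(* The library norm on ['rV[R]_d] is the maximum norm. *)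
Definition euclid (x : 'rV[R]_d) : R := Num.sqrt (\sum_i (x 0 i) ^+ 2)%R.

Definition euclid_ball (t : R) : set 'rV[R]_d := [set z | (euclid z < t)%R].

Definition abs_fun (F : axb_fun) (x : 'rV[R]_d) (t : R) : \bar R :=
  (complex.ComplexField.Normc.normc (F (x, t)))%:E.

Definition Lp_norm (p : \bar R) (f : 'rV[R]_d -> \bar R) : \bar R :=
  'N[lebesgue_rV R d]_p[f].

(* Both essential suprema are only used for f >= 0, so that extending f by 0
   outside the set is harmless. *)
Definition ess_sup_pos (f : R -> \bar R) : \bar R :=
  ess_sup (@lebesgue_measure R) (f \_ `]0%R, +oo[).

Definition ess_sup_ball (t : R) (f : 'rV[R]_d -> \bar R) : \bar R :=
  ess_sup (lebesgue_rV R d) (f \_ (euclid_ball t)).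

(* int_0^oo f(t) dt / t^(d+1) *)
Definition haar_int (f : R -> \bar R) : \bar R :=
  \int[@lebesgue_measure R]_(t in `]0%R, +oo[) (f t * (t ^- d.+1)%:E).

(* In the norms below only q > 0 matters; the default branch is q = +oo. *)

Definition normL (s : R) (p q : \bar R) (F : axb_fun) : \bar R :=
  match q with
  | r%:E => haar_int (fun t =>
      (t `^ (- (s * r)))%:E * Lp_norm p (abs_fun F ^~ t) `^ r) `^ r^-1
  | _ => ess_sup_pos (fun t => (t `^ (- s))%:E * Lp_norm p (abs_fun F ^~ t))
  end.

Definition normT (s : R) (p q : \bar R) (F : axb_fun) : \bar R :=
  Lp_norm p (fun x =>
    match q with
    | r%:E => haar_int (fun t =>
        (t `^ (- (s * r)))%:E *
        \int[lebesgue_rV R d]_(z in euclid_ball t) abs_fun F (x + z)%R t `^ r)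
        `^ r^-1
    | _ => ess_sup_pos (fun t =>
        (t `^ (- s))%:E * ess_sup_ball t (fun z => abs_fun F (x + z)%R t))
    end).

Definition peetre_max (a : R) (F : axb_fun) (x : 'rV[R]_d) (t : R) : \bar R :=
  ereal_sup (range (fun y : 'rV[R]_d =>
    abs_fun F (x + y)%R t * (((1 + euclid y / t) `^ a)^-1)%:E)).

Definition normP (s a : R) (p q : \bar R) (F : axb_fun) : \bar R :=
  Lp_norm p (fun x =>
    match q with
    | r%:E => haar_int (fun t =>
        (t `^ (- (s * r)))%:E * peetre_max a F x t `^ r) `^ r^-1
    | _ => ess_sup_pos (fun t => (t `^ (- s))%:E * peetre_max a F x t)
    end).

(* The space attached to one of the (quasi-)norms N above. *)
Definition fspace (N : axb_fun -> \bar R) : set axb_fun :=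
  [set F | axb_measurable F /\ N F < +oo].

Definition preserves (N : axb_fun -> \bar R) (A : axb_fun -> axb_fun) : Prop :=
  forall F, fspace N F -> fspace N (A F).

Definition opnorm (N : axb_fun -> \bar R) (A : axb_fun -> axb_fun) : \bar R :=
  ereal_sup [set N (A F) | F in [set F | fspace N F /\ N F <= 1]].

End function_spaces.

(* 1/p, with 1/oo = 0 *)
Definition rcp (R : realType) (p : \bar R) : R :=
  if p is r%:E then r^-1 else 0.

(* Main.v *)
From mathcomp Require Import all_boot all_order all_algebra.
From mathcomp Require Import all_classical all_reals all_analysis.
From mathcomp Require Import measurable_realfun ess_sup_inf.
From mathcomp Require Import ring lra.
Require Import Defs.

(** All three norms have the same shape.  Up to the order of the two
    operations they take an L_p-norm in x and a norm [tnorm] in t, the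
    L_q-norm for dt / t^(d+1) with the weight t^-s, of a function made from
    |F|: for L this is |F| itself, for T its L_q-norm over the ball B(x, t),
    for P its Peetre maximal function.  A left translation is an affine change
    of x together with a dilation of t, and each of these multiplies the norms
    by an explicit power of r.  A right translation acts on the slice at t by
    the translation by t z and dilates t, so it also multiplies the norm of L
    by a power of r.  For such an operator the operator norm is that power as
    soon as one F has a finite nonzero norm.  The indicator [bump] of a cube
    times the interval [1, 2] is such an F.  Its Peetre maximal function
    decays like (1 + |x|)^-a, which is in L_p if d / p < a.

    On T and P a right translation does more than move slices, since the
    displacement t z changes with t.  For P it is absorbed in the weight of
    the maximal function by the triangle inequality.  For T the ball B(t z, t)
    lies in the ball around 0 of radius l r t with
    l = max(1, (1 + |z|) / r), so that one has to compare norms of T taken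
    over cones of aperture l and of aperture 1.  [change_of_aperture] shows
    that the wider cone costs at most a factor C l^b.

    To prove it, the half-space is cut into countably many boxes whose
    diameter is comparable to their height.  Let a_n be the integral of
    t^(-s q) |F|^q over box n, for dz dt / t^(d+1).  The q-th power of the norm
    over the cone with vertex x is at least the sum over n of a_n 1_(Q_n)(x)
    for aperture 1, and at most the sum of a_n 1_(L Q_n)(x) for aperture l,
    where Q_n is a cube and L = 5 (d + 1) l ([tnorm_wide_ge],
    [tnorm_wide_le]).  What remains is, for th = p / q, a statement about cubes:
      int (sum a_n 1_(L Q_n))^th <= C L^(d max(1, th)) int (sum a_n 1_(Q_n))^th.
    This is [cube_series_dilation].  Its proof orders the cubes by radius and
    uses that (sum_i c_i)^th is at most th times, if th >= 1, and at least th
    times, if th <= 1, the sum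
      sum_i c_i (sum_(r_j >= r_i) c_j)^(th - 1).
    The inner sum has only cubes at least as large as the i-th one, and their
    dilates by a further factor 3 contain the whole dilate of the i-th cube as
    soon as they meet it before that further dilation. Averages over L Q_i are
    therefore controlled by averages over Q_i. The outcome is an inequality
    for the integral G(L) of the dilated sum, of the form G(L) <= A L^b G(1) +
    small * G(3 L), whose last term is absorbed by iteration ([self_improve]).
    If q is infinite, the sums are suprema and Vitali's covering argument
    applied to each level set gives the analogue [cube_sup_dilation].

    The functions of x that occur need not be measurable, and their integrals
    are lower integrals: suprema of integrals of simple functions below.
    These are monotone and positively homogeneous and transform correctly
    under affine maps, but they are not additive.  Sums are therefore
    integrated termwise only when the terms are measurable. *)

Set Implicit Arguments.
Unset Strict Implicit.
Unset Printing Implicit Defensive.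

Import Order.TTheory GRing.Theory Num.Theory.
Import numFieldNormedType.Exports.
Import HBNNSimple.

Local Open Scope classical_set_scope.
Local Open Scope ring_scope.

(** * Lower integrals of nonnegative functions *)

Section lower_integral.
Local Open Scope ereal_scope.
Context d (T : measurableType d) (R : realType).
Variable mu : {measure set T -> \bar R}.

(** The integral of a nonnegative function is a supremum over simple functions
    below it, and these are measurable.  The next three lemmas turn this into
    rules that hold without any measurability of the integrand. *)
Lemma integral_le_minorant (f : T -> \bar R) (c : \bar R) :
  (forall x, 0 <= f x) ->
  (forall g : T -> \bar R, measurable_fun [set: T] g -> (forall x, 0 <= g x) ->
    (forall x, g x <= f x) -> \int[mu]_x g x <= c) ->
  \int[mu]_x f x <= c.
Proof.
move=> f0 H; rewrite ge0_integralTE//; apply: ge_ereal_sup => _ [h /= hf <-].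
rewrite -integralT_nnsfun; apply: H => //.
- by apply/measurable_EFinP.
- by move=> x; rewrite lee_fin.
Qed.

Lemma le_integralT (f g : T -> \bar R) :
  (forall x, 0 <= f x) -> (forall x, f x <= g x) ->
  \int[mu]_x f x <= \int[mu]_x g x.
Proof.
move=> f0 fg; have g0 x : 0 <= g x by exact: le_trans (fg x).
rewrite !ge0_integralTE//; apply: le_ereal_sup => _ [h /= hf <-].
by exists h => // x; exact: le_trans (fg x).
Qed.

Lemma le_integral_dom (D : set T) (f g : T -> \bar R) :
  (forall x, D x -> 0 <= f x) -> (forall x, D x -> f x <= g x) ->
  \int[mu]_(x in D) f x <= \int[mu]_(x in D) g x.
Proof.
move=> f0 fg; rewrite !(integral_mkcond D); apply: le_integralT => x.
  by rewrite /patch; case: ifPn => // /[!inE]; exact: f0.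
by rewrite /patch; case: ifPn => // /[!inE]; exact: fg.
Qed.

Lemma le_integral_sub (D E : set T) (f g : T -> \bar R) :
  D `<=` E ->
  (forall x, D x -> 0 <= f x) -> (forall x, D x -> f x <= g x) ->
  (forall x, E x -> 0 <= g x) ->
  \int[mu]_(x in D) f x <= \int[mu]_(x in E) g x.
Proof.
move=> DE f0 fg g0; rewrite (integral_mkcond D) (integral_mkcond E).
apply: le_integralT => x; rewrite /patch.
  by case: ifPn => // /[!inE]; exact: f0.
case: ifPn => [/set_mem Dx|_].
  by rewrite mem_set ?fg//; exact: DE.
by case: ifPn => // /[!inE]; exact: g0.
Qed.

(** One inequality is enough, since it can be applied to both k and 1 / k: a
    measurable minorant of k f is k times a measurable minorant of f. *)
Lemma lower_integralZl (D : set T) (k : R) (f : T -> \bar R) : (0 < k)%R ->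
  (forall x, D x -> 0 <= f x) ->
  \int[mu]_(x in D) (k%:E * f x) = k%:E * \int[mu]_(x in D) f x.
Proof.
have half (g : T -> \bar R) (c : R) : (0 < c)%R -> (forall x, 0 <= g x) ->
    \int[mu]_x (c%:E * g x) <= c%:E * \int[mu]_x g x.
  move=> c0 g0; apply: integral_le_minorant.
    by move=> x; rewrite mule_ge0// lee_fin ltW.
  move=> h mh h0 hg.
  have -> : \int[mu]_x h x = c%:E * \int[mu]_x (c^-1%:E * h x).
    rewrite -ge0_integralZl_EFin//.
    - by apply: eq_integral => x _; rewrite muleA -EFinM divff ?mul1e// gt_eqF.
    - by move=> x _; rewrite mule_ge0// lee_fin invr_ge0 ltW.
    - exact: measurable_funeM.
    - exact: ltW.
  rewrite lee_pmul2l//; apply: le_integralT => x.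
    by rewrite mule_ge0// lee_fin invr_ge0 ltW.
  by rewrite lee_pdivrMl.
move=> k0 f0; rewrite integral_mkcond erestrict_scale [in RHS]integral_mkcond.
have g0 x : 0 <= (f \_ D) x by apply: erestrict_ge0.
apply/eqP; rewrite eq_le half//=.
rewrite -lee_pdivlMl//; apply: le_trans (half _ _ _ _).
- by apply: le_integralT => // x; rewrite muleA -EFinM mulVf ?mul1e// gt_eqF.
- by rewrite invr_gt0.
- by move=> x; rewrite mule_ge0// lee_fin ltW.
Qed.

Section iso.
Variables (phi psi : T -> T) (k : R).
Hypotheses (mphi : measurable_fun [set: T] phi)
  (mpsi : measurable_fun [set: T] psi)
  (phiK : cancel phi psi) (psiK : cancel psi phi) (k0 : (0 < k)%R)
  (muphi : forall A, measurable A -> mu (phi @^-1` A) = k%:E * mu A).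

Let mupsi A : measurable A -> mu (psi @^-1` A) = (k^-1)%:E * mu A.
Proof.
move=> mA; have mpA : measurable (psi @^-1` A).
  by rewrite -[X in measurable X]setTI; exact: mpsi.
rewrite -[A in RHS](_ : phi @^-1` (psi @^-1` A) = A) ?muphi//.
  by rewrite muleA -EFinM mulVf ?mul1e// gt_eqF.
by rewrite -comp_preimage; apply/seteqP; split => x /=; rewrite phiK.
Qed.

(** Since phi has a measurable inverse, composition with it puts the measurable
    minorants of f and of f o phi in bijection. *)
Lemma lower_integral_iso (f : T -> \bar R) : (forall x, 0 <= f x) ->
  \int[mu]_x f (phi x) = k%:E * \int[mu]_x f x.
Proof.
have half (f1 f2 : T -> T) (c : R) (g : T -> \bar R) :
    measurable_fun [set: T] f1 -> measurable_fun [set: T] f2 ->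
    cancel f1 f2 -> cancel f2 f1 -> (0 < c)%R ->
    (forall A, measurable A -> mu (f1 @^-1` A) = c%:E * mu A) ->
    (forall x, 0 <= g x) -> \int[mu]_x g (f1 x) <= c%:E * \int[mu]_x g x.
  move=> mf1 mf2 f12 f21 c0 muf g0; apply: integral_le_minorant => //.
  move=> h mh h0 hg.
  have -> : \int[mu]_x h x = \int[mu]_x ((h \o f2) \o f1) x.
    by apply: eq_integral => x _ /=; rewrite f12.
  have mhf : measurable_fun [set: T] (h \o f2) by exact: measurableT_comp.
  have := @ge0_integral_pushforward _ _ _ _ R f1 mf1 mu setT (h \o f2)
    measurableT mhf (fun x _ => h0 (f2 x)).
  rewrite preimage_setT => <-.
  pose cc := NngNum (ltW c0).
  rewrite [leLHS](eq_measure_integral (mscale cc mu)); last first.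
    by move=> A mA _; exact: muf.
  rewrite ge0_integral_mscale//= lee_pmul2l//.
  by apply: le_integralT => // x /=; rewrite -[in leRHS](f21 x).
move=> f0; apply/eqP; rewrite eq_le (half _ _ _ _ mphi mpsi)//=.
rewrite -lee_pdivlMl//; apply: le_trans (half _ _ _ _ mpsi mphi _ _ _ mupsi _) => //.
  by apply: le_integralT => // x; rewrite psiK.
by rewrite invr_gt0.
Qed.

(** The null sets are the same on both sides. *)
Lemma ess_sup_iso (f : T -> \bar R) : ess_sup mu (f \o phi) = ess_sup mu f.
Proof.
congr ereal_inf; apply/seteqP; split => y /= [N [mN N0 fN]].
  exists (psi @^-1` N); split.
  - by rewrite -[X in measurable X]setTI; exact: mpsi.
  - by rewrite mupsi// N0 mule0.
  - by move=> x /= fx; apply: fN => /=; rewrite psiK.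
exists (phi @^-1` N); split.
- by rewrite -[X in measurable X]setTI; exact: mphi.
- by rewrite muphi// N0 mule0.
- by move=> x /= fx; apply: fN.
Qed.

End iso.
End lower_integral.

(** * Affine maps and Lebesgue measure *)

Section affine.
Context (R : realType).
Notation mu := (@lebesgue_measure R).

Definition aff1 (c r : R) (x : measurableTypeR R) : measurableTypeR R := c + r * x.

Lemma measurable_aff1 (c r : R) : measurable_fun setT (aff1 c r).
Proof.
by apply: (@measurable_funD _ _ R).
Qed.

Lemma aff1K (c r : R) : 0 < r -> cancel (aff1 c r) (aff1 (- (r^-1 * c)) r^-1).
Proof. by move=> r0 x; rewrite /aff1 mulrDr mulrA mulVf ?mul1r ?gt_eqF// addKr. Qed.

Lemma aff1VK (c r : R) : 0 < r -> cancel (aff1 (- (r^-1 * c)) r^-1) (aff1 c r).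
Proof.
by move=> r0 x; rewrite /aff1 mulrDr mulrN !mulrA divff ?mul1r ?gt_eqF// addNKr.
Qed.

(** Both sides are measures in A, up to the factor r, and they agree on
    intervals, which determine Lebesgue measure. *)
Lemma lebesgue_aff1 (c r : R) (A : set (measurableTypeR R)) : 0 < r ->
  measurable A -> mu (aff1 c r @^-1` A) = (r^-1%:E * mu A)%E.
Proof.
move=> r0 mA.
have [m mE] : exists m : {measure set (measurableTypeR R) -> \bar R},
    forall B, m B = (r%:E * mu (aff1 c r @^-1` B))%E.
  unshelve (eexists (mscale (NngNum (ltW r0)) (pushforward mu (aff1 c r)))).
    exact: measurable_aff1.
  by [].
have -> : mu A = m A.
  apply: lebesgue_measure_unique => // _ [[a b]] _ <-.
  rewrite mE.
  rewrite (_ : aff1 c r @^-1` _ = `](r^-1 * (a - c)), (r^-1 * (b - c))]%classic).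
    rewrite !lebesgue_measure_itv/= !lte_fin ltr_pM2l ?invr_gt0// ltrD2r.
    case: ifPn => _; last by rewrite mule0.
    rewrite -!EFinB -EFinM -mulrBr mulrA divff ?mul1r ?gt_eqF//.
    by congr EFin; ring.
  apply/seteqP; split => x /=; rewrite /aff1 !in_itv/= ltr_pdivrMl// ler_pdivlMl//;
    by rewrite ltrBlDl lerBrDl.
rewrite mE muleA -EFinM mulVf ?gt_eqF// mul1e.
by [].
Qed.

Definition aff n (c : 'rV[R]_n) (r : R) (x : 'rV[R]_n) : 'rV[R]_n := c + r *: x.

Lemma measurable_aff n (c : 'rV[R]_n) (r : R) : measurable_fun setT (aff c r).
Proof.
apply: measurable_fun_rVP => i.
apply: (eq_measurable_fun (fun x : 'rV[R]_n => c 0 i + r * x 0 i)).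
  by move=> x _; rewrite /aff !mxE.
apply: (@measurable_funD _ _ R) => //.
apply: (@measurable_funM _ _ R) => //.
exact: measurable_rV_coord.
Qed.

Lemma affK n (c : 'rV[R]_n) (r : R) : 0 < r ->
  cancel (aff c r) (aff (- (r^-1 *: c)) r^-1).
Proof.
by move=> r0 x; rewrite /aff scalerDr scalerA mulVf ?scale1r ?gt_eqF// addKr.
Qed.

Lemma affVK n (c : 'rV[R]_n) (r : R) : 0 < r ->
  cancel (aff (- (r^-1 *: c)) r^-1) (aff c r).
Proof.
move=> r0 x; rewrite /aff scalerDr scalerN !scalerA divff ?gt_eqF// !scale1r.
by rewrite addNKr.
Qed.

(** By induction on the dimension: the section of the preimage at a first
    coordinate x is the preimage, under an affine map in one dimension less, of
    the section of A at the image of x. *)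
Lemma lebesgue_rV_aff n (c : 'rV[R]_n) (r : R) (A : set 'rV[R]_n) : 0 < r ->
  measurable A ->
  lebesgue_rV R n (aff c r @^-1` A) = ((r^-1 ^+ n)%:E * lebesgue_rV R n A)%E.
Proof.
move=> r0; elim: n c A => [|n IHn] c A mA.
  rewrite expr0 mul1e (_ : aff c r = id) ?preimage_id//.
  by apply/funext => x; apply/rowP => -[].
rewrite /= /lebesgue_cons /pushforward /product_measure1/=.
pose B := @rV_cons R n @^-1` A.
have mB : measurable B.
  by rewrite -[X in measurable X]setTI; exact: measurable_rV_cons.
pose c' : 'rV[R]_n := \row_j c 0 (lift ord0 j).
have sec (x : measurableTypeR R) : xsection (@rV_cons R n @^-1` (aff c r @^-1` A)) x =
   aff c' r @^-1` xsection B (aff1 (c 0 ord0) r x).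
  apply/seteqP; split => y /=; rewrite /xsection/= !inE /B/=.
    rewrite (_ : aff c r _ = rV_cons (aff1 (c 0 ord0) r x, aff c' r y))//.
    apply/rowP => i; rewrite /rV_cons /aff /aff1 !mxE/=.
    by case: unliftP => [j ->|->]; rewrite ?mxE.
  rewrite (_ : aff c r _ = rV_cons (aff1 (c 0 ord0) r x, aff c' r y))//.
  apply/rowP => i; rewrite /rV_cons /aff /aff1 !mxE/=.
  by case: unliftP => [j ->|->]; rewrite ?mxE.
under eq_integral => x _.
  rewrite sec IHn; last exact: measurable_xsection.
  over.
rewrite ge0_integralZl_EFin//; last 2 first.
  - apply: (measurableT_comp (f := lebesgue_rV R n \o xsection B)).
      exact: measurable_fun_xsection.
    exact: measurable_aff1.
  - by rewrite exprn_ge0// invr_ge0 ltW.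
rewrite (lower_integral_iso (f := lebesgue_rV R n \o xsection B)
  (@measurable_aff1 (c 0 ord0) r) (@measurable_aff1 _ _) (aff1K _ r0) (aff1VK _ r0)
  _ (fun A => lebesgue_aff1 _ r0)) ?invr_gt0//.
by rewrite muleA -EFinM -exprSr.
Qed.

Lemma lebesgue_rV_integral_aff n (c : 'rV[R]_n) (r : R) (f : 'rV[R]_n -> \bar R) :
  0 < r -> (forall x, 0 <= f x)%E ->
  (\int[lebesgue_rV R n]_x f (c + r *: x)%R =
   (r^-1 ^+ n)%:E * \int[lebesgue_rV R n]_x f x)%E.
Proof.
move=> r0 f0.
apply: (lower_integral_iso (@measurable_aff n c r) (@measurable_aff n _ _)
  (affK _ r0) (affVK _ r0) _ (fun A => lebesgue_rV_aff _ r0)) => //.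
by rewrite exprn_gt0// invr_gt0.
Qed.

Lemma lebesgue_rV_ess_sup_aff n (c : 'rV[R]_n) (r : R) (f : 'rV[R]_n -> \bar R) :
  0 < r ->
  ess_sup (lebesgue_rV R n) (fun x => f (c + r *: x)) = ess_sup (lebesgue_rV R n) f.
Proof.
move=> r0.
apply: (ess_sup_iso (@measurable_aff n c r) (@measurable_aff n _ _)
  (affK _ r0) (affVK _ r0) _ (fun A => lebesgue_rV_aff _ r0)) => //.
by rewrite exprn_gt0// invr_gt0.
Qed.

Definition cube n (y : 'rV[R]_n) (r : R) : set 'rV[R]_n :=
  [set x | forall i, `|x 0 i - y 0 i| < r].

Lemma measurable_cube n (y : 'rV[R]_n) (r : R) : measurable (cube y r).
Proof.
rewrite (_ : cube y r = \bigcap_(i in [set: 'I_n]) [set x | `|x 0 i - y 0 i| < r]).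
  apply: fin_bigcap_measurable => // i _.
  rewrite [X in measurable X](_ : _ =
      setT `&` (fun x : 'rV[R]_n => x 0 i) @^-1` (ball (y 0 i) r)).
    by apply: measurable_rV_coord => //; exact: measurable_ball.
  by apply/seteqP; split => x /=; rewrite /ball/= distrC => // -[].
by apply/seteqP; split => [x cx i _|x cx i]; [exact: cx|exact: (cx i I)].
Qed.

(** Cubes are products of intervals, which is why they, and not Euclidean balls,
    are used wherever a volume has to be computed. *)
Lemma lebesgue_rV_cube n (y : 'rV[R]_n) (r : R) : 0 <= r ->
  lebesgue_rV R n (cube y r) = ((r *+ 2) ^+ n)%:E.
Proof.
move=> r0; elim: n y => [|n IHn] y.
  by rewrite /= diracE mem_set ?expr0// => -[].
rewrite /= /lebesgue_cons /pushforward.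
pose y' : 'rV[R]_n := \row_j y 0 (lift ord0 j).
rewrite (_ : _ @^-1` _ = ball (y 0 ord0) r `*` cube y' r).
  rewrite product_measure1E; [|exact: measurable_ball|exact: measurable_cube].
  rewrite IHn exprS EFinM; congr (_ * _)%E.
  exact: lebesgue_measure_ball.
apply/seteqP; split => -[a v] /=.
  move=> H; split.
    by have := H ord0; rewrite /rV_cons !mxE unlift_none /ball/= distrC.
  by move=> i; have := H (lift ord0 i); rewrite /rV_cons !mxE liftK.
move=> [ba cv] i; rewrite /rV_cons !mxE; case: unliftP => [j ->|->] /=.
  by have := cv j; rewrite mxE.
by rewrite distrC.
Qed.

End affine.

(** * The Euclidean norm *)

Section euclid.
Context (R : realType) (d : nat).
Implicit Types x y : 'rV[R]_d.

Lemma euclid_ge0 x : 0 <= euclid x. Proof. exact: sqrtr_ge0. Qed.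

Lemma euclid_sqr x : euclid x ^+ 2 = \sum_i x 0 i ^+ 2.
Proof. by rewrite sqr_sqrtr// sumr_ge0// => i _; exact: sqr_ge0. Qed.

Lemma euclidZ (r : R) x : 0 <= r -> euclid (r *: x) = r * euclid x.
Proof.
move=> r0; apply/eqP; rewrite -(eqrXn2 (ltn0Sn 1))// ?mulr_ge0 ?euclid_ge0//.
rewrite exprMn !euclid_sqr mulr_sumr; apply/eqP/eq_bigr => i _.
by rewrite mxE exprMn.
Qed.

Lemma euclidN x : euclid (- x) = euclid x.
Proof. by congr Num.sqrt; apply: eq_bigr => i _; rewrite mxE sqrrN. Qed.

Let young (c a b : R) : 0 < c -> a * b <= (c * a ^+ 2 + c^-1 * b ^+ 2) / 2.
Proof.
move=> c0; rewrite ler_pdivlMr//.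
have : 0 <= c^-1 * (c * a - b) ^+ 2.
  by rewrite mulr_ge0 ?invr_ge0 ?sqr_ge0 ?ltW.
have -> : c^-1 * (c * a - b) ^+ 2 = c * a ^+ 2 + c^-1 * b ^+ 2 - a * b * 2.
  by field; rewrite gt_eqF.
by rewrite subr_ge0.
Qed.

(** The weight c = |y| / |x| in Young's inequality balances the two sums of
    squares. *)
Lemma euclid_dot x y : \sum_i x 0 i * y 0 i <= euclid x * euclid y.
Proof.
have zero (u : 'rV[R]_d) : euclid u = 0 -> forall i, u 0 i = 0.
  move=> u0 i; have := euclid_sqr u; rewrite u0 expr0n/= => /esym/eqP.
  rewrite psumr_eq0; last by move=> j _; exact: sqr_ge0.
  by move=> /allP/(_ i); rewrite mem_index_enum sqrf_eq0 => /(_ isT)/eqP.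
have [x0|x0] := eqVneq (euclid x) 0.
  by rewrite x0 mul0r big1// => i _; rewrite (zero x)// mul0r.
have [y0|y0] := eqVneq (euclid y) 0.
  by rewrite y0 mulr0 big1// => i _; rewrite (zero y)// mulr0.
have X0 : 0 < euclid x by rewrite lt0r x0 euclid_ge0.
have Y0 : 0 < euclid y by rewrite lt0r y0 euclid_ge0.
pose c := euclid y / euclid x.
have c0 : 0 < c by rewrite divr_gt0.
apply: (@le_trans _ _ (\sum_i (c * x 0 i ^+ 2 + c^-1 * y 0 i ^+ 2) / 2)).
  by apply: ler_sum => i _; exact: young.
rewrite -mulr_suml big_split/= -!mulr_sumr -!euclid_sqr /c.
suff -> : euclid y / euclid x * euclid x ^+ 2 +
  (euclid y / euclid x)^-1 * euclid y ^+ 2 = 2 * (euclid x * euclid y) by lra.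
by field; rewrite x0 y0.
Qed.

Lemma ler_euclidD x y : euclid (x + y) <= euclid x + euclid y.
Proof.
rewrite -(ler_pXn2r (n := 2))// ?nnegrE ?addr_ge0 ?euclid_ge0//.
rewrite sqrrD !euclid_sqr.
rewrite (eq_bigr (fun i => x 0 i ^+ 2 + x 0 i * y 0 i *+ 2 + y 0 i ^+ 2)); last first.
  by move=> i _; rewrite mxE sqrrD.
rewrite 2!big_split/= sumrMnl lerD2r lerD2l lerMn2r/=; exact: euclid_dot.
Qed.

Lemma ler_coord_euclid x i : `|x 0 i| <= euclid x.
Proof.
rewrite -(ler_pXn2r (n := 2))// ?nnegrE ?euclid_ge0// euclid_sqr.
rewrite -normrX ger0_norm ?sqr_ge0// (bigD1 i)//= lerDl sumr_ge0// => j _.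
exact: sqr_ge0.
Qed.

Lemma ltr_euclid_cube x y (r : R) : (0 < d)%N -> cube y r x ->
  euclid (x - y) < d%:R * r.
Proof.
move=> d0 xr.
have r0 : 0 < r by apply: le_lt_trans (xr (Ordinal d0)).
rewrite -(ltr_pXn2r (n := 2))// ?nnegrE ?euclid_ge0 ?mulr_ge0 ?ltW//.
rewrite euclid_sqr exprMn.
apply: (@lt_le_trans _ _ (d%:R * r ^+ 2)).
  rewrite mulr_natl -[X in _ *+ X]card_ord -sumr_const.
  apply: ltr_sum => [|i _]; first by apply/hasP; exists (Ordinal d0) => //; rewrite mem_index_enum.
  by rewrite !mxE -real_normK ?num_real// ltrXn2r//; exact: xr.
by rewrite ler_wpM2r ?sqr_ge0// expr2 ler_peMl ?ler0n// ler1n.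
by rewrite ltr0n.
Qed.

End euclid.

(** * Weighted norms in t and L_p-norms in x *)

Lemma le_poweR (R : realType) (r : R) (x y : \bar R) : 0 <= r ->
  (0 <= x -> x <= y -> x `^ r <= y `^ r)%E.
Proof.
move=> r0 x0 xy; apply: gt0_ler_poweR => //; rewrite in_itv/= leey andbT//.
exact: le_trans xy.
Qed.

Lemma poweRK (R : realType) (x : \bar R) (p : R) : (0 <= x)%E -> p != 0 -> ((x `^ p) `^ p^-1 = x)%E.
Proof. by move=> x0 p0; rewrite -poweRrM divff// poweRe1. Qed.

Lemma poweRVK (R : realType) (x : \bar R) (p : R) : (0 <= x)%E -> p != 0 -> ((x `^ p^-1) `^ p = x)%E.
Proof. by move=> x0 p0; rewrite -poweRrM mulVf// poweRe1. Qed.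

Section haar.
Local Open Scope ereal_scope.
Context (R : realType) (d : nat).
Notation mu := (@lebesgue_measure R).
Implicit Types g h : R -> \bar R.

Lemma haar_int_ge0 g : (forall t, (0 < t)%R -> 0 <= g t) -> 0 <= haar_int d g.
Proof.
move=> g0; apply: integral_ge0 => t /=; rewrite in_itv/= andbT => t0.
by rewrite mule_ge0 ?g0// lee_fin invr_ge0 exprn_ge0// ltW.
Qed.

Lemma le_haar_int g h : (forall t, (0 < t)%R -> 0 <= g t) ->
  (forall t, (0 < t)%R -> g t <= h t) -> haar_int d g <= haar_int d h.
Proof.
move=> g0 gh; apply: le_integral_dom => t /=; rewrite in_itv/= andbT => t0.
  by rewrite mule_ge0 ?g0// lee_fin invr_ge0 exprn_ge0// ltW.
by rewrite lee_pmul2r ?gh// lte_fin invr_gt0 exprn_gt0.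
Qed.

Lemma eq_haar_int g h : (forall t, (0 < t)%R -> g t = h t) ->
  haar_int d g = haar_int d h.
Proof.
by move=> gh; apply: eq_integral => t; rewrite inE/= in_itv/= andbT => /gh ->.
Qed.

Lemma haar_intZl (k : R) g : (0 < k)%R -> (forall t, (0 < t)%R -> 0 <= g t) ->
  haar_int d (fun t => k%:E * g t) = k%:E * haar_int d g.
Proof.
move=> k0 g0; rewrite /haar_int -lower_integralZl//.
  by apply: eq_integral => t _; rewrite muleA.
move=> t /=; rewrite in_itv/= andbT => t0.
by rewrite mule_ge0 ?g0// lee_fin invr_ge0 exprn_ge0// ltW.
Qed.

(** Under t -> r t the density t^-(d+1) dt is homogeneous of degree -d. *)
Lemma haar_int_dil (r : R) g : (0 < r)%R -> (forall t, (0 < t)%R -> 0 <= g t) ->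
  haar_int d (fun t => g (r * t)%R) = (r ^+ d)%:E * haar_int d g.
Proof.
move=> r0 g0; rewrite /haar_int [in LHS]integral_mkcond [in RHS]integral_mkcond.
set W := (X in _ = _ * \int[_]_x X x).
have W0 x : 0 <= W x.
  apply: erestrict_ge0 => t /=; rewrite in_itv/= andbT => t0.
  by rewrite mule_ge0 ?g0// lee_fin invr_ge0 exprn_ge0// ltW.
transitivity (\int[mu]_x ((r ^+ d.+1)%:E * W (aff1 0 r x))).
  apply: eq_integral => x _; rewrite /W /aff1 add0r !patchE !mem_setE !in_itv/=.
  rewrite !andbT pmulr_rgt0//; case: ifPn => x0; last by rewrite mule0.
  rewrite muleCA; congr (_ * _); rewrite -EFinM exprMn invfM mulrA divff ?mul1r//.
  by rewrite expf_neq0// gt_eqF.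
rewrite lower_integralZl ?exprn_gt0//.
rewrite (lower_integral_iso (@measurable_aff1 _ 0 r) (@measurable_aff1 _ _ _)
  (aff1K _ r0) (aff1VK _ r0) _ (fun A => lebesgue_aff1 _ r0)) ?invr_gt0//.
rewrite muleA -EFinM exprS mulrAC divff ?mul1r// gt_eqF//.
Qed.

Lemma ess_sup_pos_ge0 g : (forall t, (0 < t)%R -> 0 <= g t) -> 0 <= ess_sup_pos g.
Proof.
move=> g0; apply: ess_sup_gee.
  apply: (@lt_le_trans _ _ (mu (ball 0%R 1%R))).
    by rewrite lebesgue_measure_ball// lte_fin.
  by apply: le_measure; rewrite ?inE//; exact: measurable_ball.
by apply: nearW => t; apply: erestrict_ge0 => u /=; rewrite in_itv/= andbT => /g0.
Qed.

Lemma le_ess_sup_pos g h : (forall t, (0 < t)%R -> g t <= h t) ->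
  ess_sup_pos g <= ess_sup_pos h.
Proof.
move=> gh; apply: le_ess_sup; apply: nearW => t.
rewrite !patchE mem_setE in_itv/= andbT; case: ifPn => // /gh; exact.
Qed.

Lemma eq_ess_sup_pos g h : (forall t, (0 < t)%R -> g t = h t) ->
  ess_sup_pos g = ess_sup_pos h.
Proof.
by move=> gh; apply/eqP; rewrite eq_le !le_ess_sup_pos// => t /gh ->.
Qed.

Lemma ess_sup_posZl (k : R) g : (0 < k)%R ->
  ess_sup_pos (fun t => k%:E * g t) = k%:E * ess_sup_pos g.
Proof.
by move=> k0; rewrite /ess_sup_pos erestrict_scale -ess_sup_pZl.
Qed.

Lemma ess_sup_pos_dil (r : R) g : (0 < r)%R ->
  ess_sup_pos (fun t => g (r * t)%R) = ess_sup_pos g.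
Proof.
move=> r0; rewrite /ess_sup_pos.
rewrite -[RHS](ess_sup_iso (@measurable_aff1 _ 0 r) (@measurable_aff1 _ _ _)
  (aff1K _ r0) (aff1VK _ r0) _ (fun A => lebesgue_aff1 _ r0)) ?invr_gt0//.
congr ess_sup; apply/funext => x /=; rewrite !patchE /aff1 add0r !mem_setE !in_itv/=.
by rewrite !andbT pmulr_rgt0.
Qed.

(** The L_q-norm in t that the three families of norms have in common. *)
Definition tnorm (s : R) (q : \bar R) g : \bar R :=
  match q with
  | r%:E => haar_int d (fun t => (t `^ (- (s * r)))%:E * g t `^ r) `^ r^-1
  | _ => ess_sup_pos (fun t => (t `^ (- s))%:E * g t)
  end.

Lemma tnorm_ge0 s q g : (forall t, (0 < t)%R -> 0 <= g t) -> 0 <= tnorm s q g.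
Proof.
move=> g0; have H : 0 <= ess_sup_pos (fun t => (t `^ (- s))%:E * g t).
  by apply: ess_sup_pos_ge0 => t t0; rewrite mule_ge0 ?lee_fin ?powR_ge0 ?g0.
case: q => [r||]//=; exact: poweR_ge0.
Qed.

Lemma le_tnorm s q g h : 0 < q -> (forall t, (0 < t)%R -> 0 <= g t) ->
  (forall t, (0 < t)%R -> g t <= h t) -> tnorm s q g <= tnorm s q h.
Proof.
case: q => [r||]//= r0 g0 gh; last first.
  by apply: le_ess_sup_pos => t t0; rewrite lee_pmul2l ?gh// lte_fin powR_gt0.
rewrite lte_fin in r0.
have w t : (0 < t)%R -> 0 <= (t `^ (- (s * r)))%:E * g t `^ r.
  by move=> t0; rewrite mule_ge0 ?lee_fin ?powR_ge0 ?poweR_ge0.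
have ww : haar_int d (fun t => (t `^ (- (s * r)))%:E * g t `^ r) <=
   haar_int d (fun t => (t `^ (- (s * r)))%:E * h t `^ r).
  apply: le_haar_int => // t t0; rewrite lee_pmul2l ?lte_fin ?powR_gt0//.
  by rewrite le_poweR ?gh ?g0// ltW.
by rewrite le_poweR// ?haar_int_ge0// invr_ge0 ltW.
Qed.

Lemma eq_tnorm s q g h : (forall t, (0 < t)%R -> g t = h t) ->
  tnorm s q g = tnorm s q h.
Proof.
move=> gh; have H : ess_sup_pos (fun t => (t `^ (- s))%:E * g t) =
    ess_sup_pos (fun t => (t `^ (- s))%:E * h t).
  by apply: eq_ess_sup_pos => t t0; rewrite gh.
case: q => [r||]//=; congr (_ `^ _); apply: eq_haar_int => t t0.
by rewrite gh.
Qed.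

Lemma tnormZl s q (k : R) g : 0 < q -> (0 < k)%R ->
  (forall t, (0 < t)%R -> 0 <= g t) ->
  tnorm s q (fun t => k%:E * g t) = k%:E * tnorm s q g.
Proof.
case: q => [r||]//= r0 k0 g0; last first.
  rewrite -(ess_sup_posZl (fun t => (t `^ (- s))%:E * g t) k0).
  by apply: eq_ess_sup_pos => t t0; exact: muleCA.
rewrite lte_fin in r0.
pose w t := (t `^ (- (s * r)))%:E * g t `^ r.
have w0 t : (0 < t)%R -> 0 <= w t.
  by move=> t0; rewrite mule_ge0 ?lee_fin ?powR_ge0 ?poweR_ge0.
transitivity (haar_int d (fun t => (k `^ r)%:E * w t) `^ r^-1).
  apply: (@f_equal _ _ (fun x : \bar R => x `^ r^-1)); apply: eq_haar_int => t t0.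
  by rewrite /w poweRM ?lee_fin ?g0 ?(ltW k0)// poweR_EFin muleCA.
rewrite haar_intZl ?powR_gt0// poweRM ?lee_fin ?powR_ge0 ?haar_int_ge0//.
by rewrite poweR_EFin -powRrM divff ?gt_eqF// powRr1 ?ltW.
Qed.

Lemma tnorm_dil s q (r : R) g : 0 < q -> (0 < r)%R ->
  (forall t, (0 < t)%R -> 0 <= g t) ->
  tnorm s q (fun t => g (r * t)%R) = (r `^ (s + d%:R * rcp q))%:E * tnorm s q g.
Proof.
case: q => [p||]//= p0 r0 g0; last first.
  rewrite mulr0 addr0 -(ess_sup_pos_dil (fun t => (t `^ (- s))%:E * g t) r0).
  rewrite -(ess_sup_posZl (fun t => ((r * t) `^ (- s))%:E * g (r * t)%R)
    (powR_gt0 s r0)).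
  apply: eq_ess_sup_pos => t t0.
  rewrite muleA -EFinM; congr (_%:E * _).
  by rewrite (powRM _ (ltW r0) (ltW t0)) mulrA -powRD ?subrr ?powRr0 ?mul1r// (gt_eqF r0) implybT.
rewrite lte_fin in p0.
pose w t := (t `^ (- (s * p)))%:E * g t `^ p.
have w0 t : (0 < t)%R -> 0 <= w t.
  by move=> t0; rewrite mule_ge0 ?lee_fin ?powR_ge0 ?poweR_ge0.
transitivity ((haar_int d (fun t => (r `^ (s * p))%:E * w (r * t)%R)) `^ p^-1).
  apply: (@f_equal _ _ (fun x : \bar R => x `^ p^-1)); apply: eq_haar_int => t t0.
  rewrite /w muleA -EFinM; congr (_%:E * _).
  by rewrite (powRM _ (ltW r0) (ltW t0)) mulrA -powRD ?subrr ?powRr0 ?mul1r// (gt_eqF r0) implybT.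
rewrite haar_intZl ?powR_gt0//; last by move=> t t0; rewrite w0// mulr_gt0.
rewrite haar_int_dil// muleA -EFinM -powR_mulrn ?ltW// -powRD; last first.
  by rewrite (gt_eqF r0) implybT.
rewrite poweRM ?lee_fin ?powR_ge0 ?haar_int_ge0//.
rewrite poweR_EFin -powRrM; congr (_%:E * _); congr (_ `^ _)%R.
by rewrite mulrDl mulfK// gt_eqF.
Qed.

End haar.

Section Lp.
Local Open Scope ereal_scope.
Context (R : realType) (d : nat).
Notation mu := (lebesgue_rV R d).
Implicit Types f g : 'rV[R]_d -> \bar R.

Lemma lebesgue_rV_gt0 : 0 < mu [set: 'rV[R]_d].
Proof.
apply: (@lt_le_trans _ _ (mu (cube 0 1))).
  by rewrite lebesgue_rV_cube// lte_fin exprn_gt0.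
by apply: le_measure; rewrite ?inE//; exact: measurable_cube.
Qed.

Lemma Lp_norm_ge0 p f : 0 <= Lp_norm p f.
Proof. exact: Lnorm_ge0. Qed.

Lemma le_Lp_norm p f g : 0 < p -> (forall x, 0 <= f x) ->
  (forall x, f x <= g x) -> Lp_norm p f <= Lp_norm p g.
Proof.
move=> p0 f0 fg; have g0 x : 0 <= g x by exact: le_trans (fg x).
rewrite /Lp_norm unlock; case: p p0 => [r||]//= r0; last first.
  by rewrite lebesgue_rV_gt0 le_ess_sup//; apply: nearW => x /=; rewrite !gee0_abs.
rewrite lte_fin in r0.
rewrite le_poweR ?invr_ge0 ?(ltW r0)//.
  by apply: integral_ge0 => x _; exact: poweR_ge0.
apply: le_integralT => x; first exact: poweR_ge0.
by rewrite le_poweR ?(ltW r0)// !gee0_abs.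
Qed.

Lemma Lp_normZl p (k : R) f : 0 < p -> (0 < k)%R ->
  Lp_norm p (fun x => k%:E * f x) = k%:E * Lp_norm p f.
Proof.
move=> p0 k0; rewrite /Lp_norm unlock; case: p p0 => [r||]//= r0; last first.
  rewrite lebesgue_rV_gt0 -ess_sup_pZl//; apply: eq_ess_sup; apply: nearW => x /=.
  by rewrite abseM gee0_abs// lee_fin ltW.
rewrite lte_fin in r0.
under eq_integral do rewrite abseM [ `|k%:E| ]gee0_abs ?lee_fin ?ltW//
  poweRM ?lee_fin ?(ltW k0)// poweR_EFin.
rewrite lower_integralZl ?powR_gt0//; last by move=> *; exact: poweR_ge0.
rewrite poweRM ?lee_fin ?powR_ge0//.
  by rewrite poweR_EFin -powRrM divff ?gt_eqF// powRr1 ?ltW.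
by apply: integral_ge0 => x _; exact: poweR_ge0.
Qed.

Lemma Lp_norm_aff p (c : 'rV[R]_d) (r : R) f : 0 < p -> (0 < r)%R ->
  Lp_norm p (fun x => f (c + r *: x)%R) =
  (r `^ (- (d%:R * rcp p)))%:E * Lp_norm p f.
Proof.
move=> p0 r0; rewrite /Lp_norm unlock; case: p p0 => [q||]//= q0; last first.
  rewrite lebesgue_rV_gt0 mulr0 oppr0 powRr0 mul1e.
  exact: (lebesgue_rV_ess_sup_aff c (abse \o f) r0).
rewrite lte_fin in q0.
rewrite (lebesgue_rV_integral_aff c (f := fun x => `|f x| `^ q))//; last first.
  by move=> x; exact: poweR_ge0.
rewrite poweRM ?lee_fin ?exprn_ge0 ?invr_ge0 ?(ltW r0)//; last first.
  by apply: integral_ge0 => x _; exact: poweR_ge0.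
congr (_ * _); rewrite poweR_EFin; congr EFin.
by rewrite exprVn -powR_invn ?ltW// -powRrM mulNr.
Qed.

End Lp.

(** * Powers of sums ordered by radius *)

Section power_inequalities.
Context (R : realType).
Implicit Types u v w th : R.

(** Young's inequality for w^th and 1 with exponents 1 / th and
    1 / (1 - th). *)
Lemma powR_bernoulli_le1 w th : 0 < th <= 1 -> 0 <= w ->
  w `^ th <= 1 + th * (w - 1).
Proof.
move=> /andP[t0]; rewrite le_eqVlt => /predU1P[->|t1] w0.
  by rewrite powRr1// mul1r addrC subrK.
have := @conjugate_powR R (w `^ th) 1 th^-1 (1 - th)^-1 (powR_ge0 _ _) ler01.
rewrite !invr_gt0 subr_gt0 t0 t1 !invrK addrC subrK => /(_ isT isT erefl).
rewrite mulr1 -powRrM divff ?gt_eqF// powRr1// powR1 mul1r.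
by move=> /le_trans; apply; lra.
Qed.

(** The preceding inequality, applied to w^th and the exponent 1 / th. *)
Lemma powR_bernoulli_ge1 w th : 1 <= th -> 0 <= w ->
  1 + th * (w - 1) <= w `^ th.
Proof.
move=> t1 w0; have t0 : 0 < th by exact: lt_le_trans t1.
have := @powR_bernoulli_le1 (w `^ th) th^-1.
rewrite invr_gt0 t0 invf_le1// t1 powR_ge0 => /(_ isT isT).
rewrite -powRrM divff ?gt_eqF// powRr1// => h.
have : th * w <= th * (1 + th^-1 * (w `^ th - 1)) by rewrite ler_pM2l.
rewrite mulrDr mulrA divff ?gt_eqF//; lra.
Qed.

Let powR_homog u v th : 0 < u -> 0 <= v -> u `^ th * (v / u) `^ th = v `^ th.
Proof.
by move=> u0 v0; rewrite -powRM ?divr_ge0// ?(ltW u0)// mulrC divfK// gt_eqF.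
Qed.

Let powR_tangent u v th : 0 < u ->
  u `^ th * (1 + th * (v / u - 1)) = u `^ th + th * (v - u) * u `^ (th - 1).
Proof.
move=> u0; rewrite powRB; last by rewrite (gt_eqF u0) implybT.
rewrite powRr1 ?ltW//; field; by rewrite gt_eqF.
Qed.

(** Bernoulli's inequality at v / u, multiplied by u^th: a convex power lies
    above its tangent at u, and in [powR_incr_ge] a concave one below it. *)
Lemma powR_incr_le u v th : 1 <= th -> 0 <= v <= u ->
  u `^ th <= v `^ th + th * (u - v) * u `^ (th - 1).
Proof.
move=> t1 /andP[v0 vu]; have [u0|] := ltP 0 u; last first.
  move=> u0; have -> : u = v by lra.
  by rewrite subrr mulr0 mul0r addr0.
have := powR_bernoulli_ge1 t1 (divr_ge0 v0 (ltW u0)).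
rewrite -(ler_pM2l (powR_gt0 th u0)) powR_homog// powR_tangent//.
by rewrite -(opprB u v) mulrN mulNr; lra.
Qed.

Lemma powR_incr_ge u v th : 0 < th <= 1 -> 0 <= v <= u ->
  v `^ th + th * (u - v) * u `^ (th - 1) <= u `^ th.
Proof.
move=> t1 /andP[v0 vu]; have [u0|] := ltP 0 u; last first.
  move=> u0; have -> : u = v by lra.
  by rewrite subrr mulr0 mul0r addr0.
have := powR_bernoulli_le1 t1 (divr_ge0 v0 (ltW u0)).
rewrite -(ler_pM2l (powR_gt0 th u0)) powR_homog// powR_tangent//.
by rewrite -(opprB u v) mulrN mulNr; lra.
Qed.

Lemma ger_powR_base th u v : th <= 0 -> 0 < u -> u <= v -> v `^ th <= u `^ th.
Proof.
move=> t0 u0 uv; have v0 : 0 < v by exact: lt_le_trans uv.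
rewrite -[th]opprK !(powRN _ (- th)) lef_pV2 ?posrE ?powR_gt0//.
by apply: ge0_ler_powR; rewrite ?nnegrE ?oppr_ge0 ?(ltW u0) ?(ltW v0).
Qed.

Lemma ler_powR_base th u v : 0 <= th -> 0 <= u -> u <= v -> u `^ th <= v `^ th.
Proof.
by move=> t0 u0 uv; rewrite ge0_ler_powR ?nnegrE// (le_trans u0).
Qed.

Section ordered_sums.
Variables (I : finType) (c r : I -> R).
Hypothesis c0 : forall i, 0 <= c i.

Let h (A : {set I}) i := \sum_(j in A | r i <= r j) c j.

Let h_ge0 A i : 0 <= h A i. Proof. exact: sumr_ge0. Qed.

Let hT i : h [set: I]%SET i = \sum_(j | r i <= r j) c j.
Proof. by apply: eq_bigl => j; rewrite finset.inE. Qed.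

Let h_sub (A B : {set I}) i : A \subset B -> h A i <= h B i.
Proof.
move=> /fintype.subsetP AB; rewrite /h big_mkcond [leRHS]big_mkcond/=.
apply: ler_sum => k _; case: ifPn => [/andP[/AB -> -> //]|_].
by case: ifPn.
Qed.

Let h_self (A : {set I}) i : i \in A -> c i <= h A i.
Proof. by move=> iA; rewrite /h (bigD1 i) ?iA ?lexx//= lerDl sumr_ge0. Qed.

(** For the smallest radius in A the ordered partial sum is the whole sum over
    A, so removing that index sets up an induction. *)
Let min_split (A : {set I}) n : #|A| = n.+1 -> exists m, [/\ m \in A,
  #|A :\ m| = n & h A m = \sum_(j in A) c j].
Proof.
move=> cA; have [i iA] : exists i, i \in A by apply/card_gt0P; rewrite cA.
have [m mA mmin] : exists2 m, m \in A & forall j, j \in A -> r m <= r j.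
  by case: (Order.TotalTheory.arg_minP r iA) => m mA H; exists m.
exists m; split => //; first by move: cA; rewrite (cardsD1 m) mA => -[].
by apply: eq_bigl => j; case: (boolP (j \in A)) => //= /mmin ->.
Qed.

(** A discrete version of integrating th S^(th-1) dS: adding the terms in the
    order of decreasing radius, each increment of the th-th power of the partial
    sum is at most th times the term times the new partial sum to the power
    th - 1.  Terms of equal radius may all be counted in the inner sum, which
    only increases the right-hand side. *)
Lemma ordered_sum_ge (th : R) : 1 <= th ->
  (\sum_i c i) `^ th <=
  th * \sum_i c i * (\sum_(j | r i <= r j) c j) `^ (th - 1).
Proof.
move=> t1; have t0 : 0 < th by exact: lt_le_trans t1.
suff H n (A : {set I}) : #|A| = n -> (\sum_(i in A) c i) `^ th <=
    th * \sum_(i in A) c i * (h A i) `^ (th - 1).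
  have := H _ [set: I]%SET erefl.
  rewrite (eq_bigl xpredT) => [|i]; last by rewrite finset.inE.
  move=> /le_trans; apply; rewrite ler_pM2l// big_mkcond/=.
  apply: ler_sum => i _; rewrite finset.inE.
  by rewrite hT.
elim: n A => [|n IHn] A cA.
  by rewrite (cards0_eq cA) !big_set0 mulr0 powR0// gt_eqF.
have [m [mA cA' hm]] := min_split cA.
rewrite (big_setD1 m mA)/= [in leRHS](big_setD1 m mA)/= hm (big_setD1 m mA)/=.
set T' := \sum_(j in A :\ m) c j.
have T'0 : 0 <= T' by exact: sumr_ge0.
apply: le_trans (powR_incr_le (v := T') t1 _) _; first by rewrite T'0 lerDr c0.
rewrite addrK [in leRHS]mulrDr mulrA [leRHS]addrC lerD2r; apply: (le_trans (IHn _ cA')).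
rewrite ler_pM2l//; apply: ler_sum => j jA; rewrite ler_wpM2l//.
apply: ler_powR_base => //; first by rewrite subr_ge0.
by apply: h_sub; exact: subsetDl.
Qed.

(** The same telescoping for a concave power.  The power th - 1 is negative, so
    counting all terms of equal radius in the inner sum decreases the left-hand
    side. *)
Lemma ordered_sum_le (th : R) : 0 < th <= 1 ->
  \sum_i c i * (\sum_(j | r i <= r j) c j) `^ (th - 1) <=
  th^-1 * (\sum_i c i) `^ th.
Proof.
move=> t01; have /andP[t0 t1] := t01.
suff H n (A : {set I}) : #|A| = n ->
    \sum_(i in A) c i * (h A i) `^ (th - 1) <= th^-1 * (\sum_(i in A) c i) `^ th.
  have := H _ [set: I]%SET erefl.
  rewrite [in leRHS](eq_bigl xpredT) => [|i]; last by rewrite finset.inE.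
  apply: le_trans; rewrite [leRHS]big_mkcond/=.
  apply: ler_sum => i _; rewrite finset.inE.
  by rewrite hT.
elim: n A => [|n IHn] A cA.
  by rewrite (cards0_eq cA) !big_set0 powR0 ?mulr0// gt_eqF.
have [m [mA cA' hm]] := min_split cA.
rewrite (big_setD1 m mA)/= [in leRHS](big_setD1 m mA)/= hm (big_setD1 m mA)/=.
set T' := \sum_(j in A :\ m) c j.
have T'0 : 0 <= T' by exact: sumr_ge0.
have := @powR_incr_ge (c m + T') T' th t01.
rewrite T'0 lerDr c0 => /(_ isT); rewrite addrK => H.
rewrite -(ler_pM2l t0) mulrA divff ?gt_eqF// mul1r; apply: le_trans H.
rewrite [in leLHS]mulrDr mulrA [leLHS]addrC lerD2r -ler_pdivlMl//.
apply: le_trans (IHn _ cA'); apply: ler_sum => j jA.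
have [->|cj] := eqVneq (c j) 0; first by rewrite !mul0r.
have cj0 : 0 < c j by rewrite lt0r cj c0.
rewrite ler_wpM2l//; apply: ger_powR_base; first by rewrite subr_le0.
- exact: lt_le_trans (h_self jA).
- by apply: h_sub; exact: subsetDl.
Qed.

End ordered_sums.
End power_inequalities.

(** * Dilating the cubes of a finite sum *)

Section comparison.
Local Open Scope ereal_scope.
Context d (T : measurableType d) (R : realType) (mu : {measure set T -> \bar R}).

(** The mean of u over A is at most the mean of v over B, because every value of
    u is at most every value of v. *)
Lemma integral_le_comparison (A B : set T) (k : R) (u v : T -> \bar R) :
  measurable A -> measurable B -> (0 < k)%R ->
  0 < mu B < +oo -> mu A = k%:E * mu B ->
  (forall x, A x -> 0 <= u x) -> (forall x, B x -> 0 <= v x) ->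
  (forall x y, A x -> B y -> u x <= v y) ->
  \int[mu]_(x in A) u x <= k%:E * \int[mu]_(x in B) v x.
Proof.
move=> mA mB k0 /andP[B0 Boo] AB u0 v0 uv.
have [m mE] : exists m : R, mu B = m%:E by exists (fine (mu B)); rewrite fineK// ge0_fin_numE.
have m0 : (0 < m)%R by move: B0; rewrite mE lte_fin.
have ux x : A x -> u x * m%:E <= \int[mu]_(x in B) v x.
  move=> Ax; rewrite -mE -integral_cst//; apply: le_integral_dom => [y _|y By].
    exact: u0.
  exact: uv.
have I0 : 0 <= \int[mu]_(x in B) v x by exact: integral_ge0.
have := I0; rewrite le_eqVlt => /predU1P[I0'|Ipos].
  rewrite -I0' mule0 (_ : \int[mu]_(x in A) u x = 0)//.
  rewrite (eq_integral (cst 0)) ?integral0// => x; rewrite inE => Ax.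
  apply/eqP; rewrite eq_le u0// andbT.
  by have := ux x Ax; rewrite -I0' pmule_lle0 ?lte_fin.
case: (\int[mu]_(x in B) v x) ux I0 Ipos => [J| |] ux I0 Ipos //; last first.
  by rewrite mulry gtr0_sg// mul1e leey.
apply: (@le_trans _ _ (\int[mu]_(x in A) (J / m)%:E)).
  apply: le_integral_dom => // x Ax; rewrite EFinM lee_pdivlMr//.
  exact: ux.
rewrite integral_cst// AB mE -!EFinM lee_fin mulrCA divfK ?gt_eqF//.
Qed.

Lemma integral_sum_indic (I : finType) (a : I -> R) (A : I -> set T)
    (u : I -> T -> R) :
  (forall i, 0 <= a i)%R -> (forall i, measurable (A i)) ->
  (forall i, measurable_fun [set: T] (u i)) -> (forall i x, 0 <= u i x)%R ->
  \int[mu]_x (\sum_i a i * \1_(A i) x * u i x)%R%:E =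
  \sum_i (a i)%:E * \int[mu]_(x in A i) (u i x)%:E.
Proof.
move=> a0 mA mui u0.
have mAi i : measurable_fun [set: T] (\1_(A i) : T -> R) by exact: measurable_indic.
under eq_integral do rewrite -sumEFin.
rewrite ge0_integral_sum//=; last 2 first.
- move=> i; apply/measurable_EFinP; apply: measurable_funM => //.
  exact: measurable_funM.
- by move=> i x _; rewrite lee_fin !mulr_ge0.
apply: eq_bigr => i _.
rewrite (integral_mkcond (A i)) -ge0_integralZl_EFin//; last 2 first.
- by move=> x _; rewrite erestrict_ge0// => y _; rewrite lee_fin.
- apply/(measurable_restrictT _ (mA i)).
  by apply/measurable_EFinP; apply: measurable_funS (mui i).
apply: eq_integral => x _; rewrite patchE indicE.
by case: ifPn => /= _; [rewrite mulr1 EFinM|rewrite mulr0 mul0r mule0].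
Qed.

Lemma integral_lincomb (c1 c2 : R) (f1 f2 : T -> R) :
  (0 <= c1)%R -> (0 <= c2)%R ->
  measurable_fun [set: T] f1 -> measurable_fun [set: T] f2 ->
  (forall x, 0 <= f1 x)%R -> (forall x, 0 <= f2 x)%R ->
  c1%:E * \int[mu]_x (f1 x)%:E + c2%:E * \int[mu]_x (f2 x)%:E =
  \int[mu]_x (c1 * f1 x + c2 * f2 x)%R%:E.
Proof.
move=> c10 c20 mf1 mf2 f10 f20.
have m1 : measurable_fun [set: T] (EFin \o f1) by exact/measurable_EFinP.
have m2 : measurable_fun [set: T] (EFin \o f2) by exact/measurable_EFinP.
rewrite -(ge0_integralZl_EFin mu measurableT (f1 := EFin \o f1))//; last first.
  by move=> x _; rewrite lee_fin.
rewrite -(ge0_integralZl_EFin mu measurableT (f1 := EFin \o f2))//; last first.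
  by move=> x _; rewrite lee_fin.
rewrite -ge0_integralD//.
- by move=> x _; rewrite mule_ge0// lee_fin.
- exact: measurable_funeM.
- by move=> x _; rewrite mule_ge0// lee_fin.
- exact: measurable_funeM.
Qed.

End comparison.

Section self_improvement.
Context (R : realType).

Lemma le_of_geometric (x y D : R) : (forall m : nat, x <= y + D / 2 ^+ m) -> x <= y.
Proof.
move=> H; rewrite leNgt; apply/negP => yx.
have e0 : 0 < x - y by rewrite subr_gt0.
have [n nP] : exists n : nat, `|D| / (x - y) < n%:R.
  by exists (Num.bound (`|D| / (x - y))); apply: archi_boundP; rewrite divr_ge0// ltW.
have := H n; apply/negP; rewrite -ltNge -ltrBrDl ltr_pdivrMr ?exprn_gt0//.
apply: le_lt_trans (ler_norm D) _.
rewrite ltr_pdivrMr// in nP; apply: (lt_le_trans nP).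
rewrite mulrC ler_pM2l// -natrX ler_nat.
by apply: ltnW; exact: ltn_expl.
Qed.

(** The last term is absorbed although it is taken at 3 l: as g grows at most
    like l^b, iterating the inequality m times leaves the error
    D l^b / 2^m, which vanishes as m grows. *)
Lemma self_improve (g : R -> R) (A D b : R) : 0 <= A -> 0 <= b ->
  (forall l, 1 <= l -> g l <= D * l `^ b) ->
  (forall l, 1 <= l -> g l <= A * l `^ b + (2 * 3 `^ b)^-1 * g (3 * l)) ->
  forall l, 1 <= l -> g l <= 2 * A * l `^ b.
Proof.
move=> A0 b0 gD gA.
suff H m l : 1 <= l -> g l <= 2 * A * l `^ b + D * l `^ b / 2 ^+ m.
  by move=> l l1; apply: (@le_of_geometric _ _ (D * l `^ b)) => m; exact: H.
elim: m l => [|m IH] l l1.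
  apply: (le_trans (gD _ l1)); rewrite expr0 divr1 lerDr !mulr_ge0//.
  exact: powR_ge0.
have l0 : 0 <= l by exact: le_trans l1.
have p3 : 0 < 3 `^ b :> R by exact: powR_gt0.
apply: (le_trans (gA _ l1)).
have l3 : 1 <= 3 * l by lra.
have := IH _ l3; rewrite powRM// => H.
have : (2 * 3 `^ b)^-1 * g (3 * l) <= (2 * 3 `^ b)^-1 *
   (2 * A * (3 `^ b * l `^ b) + D * (3 `^ b * l `^ b) / 2 ^+ m).
  by rewrite ler_pM2l// invr_gt0 mulr_gt0.
move=> /(lerD (lexx (A * l `^ b))) /le_trans; apply.
rewrite le_eqVlt; apply/orP; left; apply/eqP; rewrite exprS; field.
by rewrite expf_neq0 ?gt_eqF.
Qed.

End self_improvement.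

Section finite_cubes.
Context (R : realType) (d : nat) (I : finType).
Notation mu := (lebesgue_rV R d).
Variables (a : I -> R) (y : I -> 'rV[R]_d) (r : I -> R).
Hypotheses (a0 : forall i, 0 <= a i) (r0 : forall i, 0 < r i).

Let B (l : R) i := cube (y i) (l * r i).

Let mB l i : measurable (B l i). Proof. exact: measurable_cube. Qed.

Definition cube_sum (l : R) (x : 'rV[R]_d) : R := \sum_i a i * \1_(B l i) x.

(** Only cubes at least as large as the i-th one enter, so that they can be
    compared at distinct points of the i-th cube. *)
Let top l i x := \sum_(j | r i <= r j) a j * \1_(B l j) x.

Let term_ge0 l i x : 0 <= a i * \1_(B l i) x :> R.
Proof. by rewrite mulr_ge0. Qed.

Lemma cube_sum_ge0 l x : 0 <= cube_sum l x. Proof. exact: sumr_ge0. Qed.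

Let top_ge0 l i x : 0 <= top l i x. Proof. exact: sumr_ge0. Qed.

Lemma measurable_cube_sum l : measurable_fun setT (cube_sum l).
Proof.
by apply: measurable_sum => i; apply: measurable_funM.
Qed.

Let measurable_top l i : measurable_fun setT (top l i).
Proof.
apply: (eq_measurable_fun (fun x =>
    \sum_j (if r i <= r j then a j * \1_(B l j) x else 0))).
  by move=> x _; rewrite /top [RHS]big_mkcond.
apply: measurable_sum => j; case: (r i <= r j) => //.
by apply: measurable_funM.
Qed.

Let measurable_powR_comp (g : 'rV[R]_d -> R) p :
  measurable_fun setT g -> measurable_fun setT (fun x => g x `^ p).
Proof. by move=> mg; exact: (measurableT_comp (measurable_powR p) mg). Qed.

Let muB l i : 0 < l -> mu (B l i) = ((l ^+ d)%:E * mu (B 1 i))%E.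
Proof.
move=> l0; rewrite !lebesgue_rV_cube ?mulr_ge0 ?(ltW (r0 i)) ?(ltW l0)//.
rewrite -EFinM -exprMn; apply: (congr1 (fun z : R => (z ^+ d)%:E)); ring.
Qed.

Let muB_fin i : (0 < mu (B 1 i) < +oo)%E.
Proof. by rewrite lebesgue_rV_cube ?mul1r ?ltW// ltry andbT lte_fin exprn_gt0// mulrn_wgt0. Qed.

(** The triangle inequality: the i-th cube is the smaller one, so the points x
    and x' of its dilate are close on the scale of the j-th cube. *)
Let cube_near l i j x x' : 1 <= l -> r i <= r j ->
  B l i x -> B 1 i x' -> (B l j x -> B (3 * l) j x') /\ (B 1 j x' -> B (3 * l) j x).
Proof.
move=> l1 ij xi xi'; have l0 : 0 <= l by lra.
have rr : l * r i <= l * r j by rewrite ler_wpM2l.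
have rr1 : r i <= l * r j by rewrite (le_trans ij)// ler_peMl// ltW.
have rr2 : r j <= l * r j by rewrite ler_peMl// ltW.
split=> xj k; have := xi k; have := xi' k; have := xj k; rewrite mul1r -(mulrA 3);
  rewrite !ltr_norml => /andP[? ?] /andP[? ?] /andP[? ?]; apply/andP; split; lra.
Qed.

Let top_le l i x x' : 1 <= l -> B l i x -> B 1 i x' ->
  top l i x <= cube_sum (3 * l) x' /\ top 1 i x' <= cube_sum (3 * l) x.
Proof.
move=> l1 xi xi'; rewrite /top /cube_sum.
split; rewrite big_mkcond/=; apply: ler_sum => j _; case: ifPn => // ij;
  rewrite ler_wpM2l// !indicE ler_nat; have [h1 h2] := cube_near l1 ij xi xi'.
- by case: (boolP (x \in B l j)) => // /set_mem/h1/mem_set ->.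
- by case: (boolP (x' \in B 1 j)) => // /set_mem/h2/mem_set ->.
Qed.

Let G th l := (\int[mu]_x (cube_sum l x `^ th)%:E)%E.

Let cube_sum_le3 l x : 1 <= l -> cube_sum l x <= cube_sum (3 * l) x.
Proof.
move=> l1; apply: ler_sum => i _; rewrite ler_wpM2l// !indicE ler_nat.
case: (boolP (x \in B l i)) => // /set_mem xi; rewrite mem_set// => k.
by apply: lt_le_trans (xi k) _; rewrite ler_wpM2r ?(ltW (r0 i))//; lra.
Qed.

(** [ordered_sum_ge] bounds G th l by integrals over the dilated cubes of
    truncated sums; [top_le] and [integral_le_comparison] move them to the
    original cubes at the cost of l^d and of a further dilation by 3.  This
    leaves the integral of g F^(th-1), where g and F are the sums at
    dilations 1 and 3 l.  It is at most e F^th where g <= e F, and at most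
    e^(1-th) g^th elsewhere. *)
Let step_ge1 th l e : 1 <= th -> 1 <= l -> 0 < e ->
  (G th l <= (th * l ^+ d)%:E * (e%:E * G th (3 * l) + (e `^ (1 - th))%:E * G th 1))%E.
Proof.
move=> t1 l1 e0; have l0 : 0 < l by lra.
have t0 : 0 < th by lra.
have mF : measurable_fun setT (fun x => cube_sum (3 * l) x `^ (th - 1)).
  by apply: measurable_powR_comp; exact: measurable_cube_sum.
apply: (@le_trans _ _ (\int[mu]_x (th%:E *
    (\sum_i a i * \1_(B l i) x * top l i x `^ (th - 1))%R%:E))%E).
  apply: le_integralT => x; first by rewrite lee_fin powR_ge0.
  rewrite -EFinM lee_fin.
  have := @ordered_sum_ge _ _ (fun i => a i * \1_(B l i) x) r (fun i => term_ge0 l i x) _ t1.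
  by [].
rewrite lower_integralZl//; last first.
  by move=> x _; rewrite lee_fin sumr_ge0// => i _; rewrite mulr_ge0 ?powR_ge0.
rewrite EFinM -muleA lee_pmul2l//.
rewrite integral_sum_indic//; last first.
- by move=> i x; exact: powR_ge0.
- by move=> i; exact: measurable_powR_comp.
apply: (@le_trans _ _ ((l ^+ d)%:E * \sum_i (a i)%:E *
    \int[mu]_(x in B 1 i) (cube_sum (3 * l) x `^ (th - 1))%:E)%E).
  rewrite ge0_sume_distrr; last first.
    by move=> i _; rewrite mule_ge0 ?lee_fin// integral_ge0// => x _; rewrite lee_fin powR_ge0.
  apply: lee_sum => i _; rewrite muleCA; apply: lee_wpmul2l; first by rewrite lee_fin.
  apply: integral_le_comparison => //.
  - by rewrite exprn_gt0.
  - exact: muB_fin.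
  - exact: muB.
  - by move=> x _; rewrite lee_fin powR_ge0.
  - by move=> x _; rewrite lee_fin powR_ge0.
  - move=> x x' xi xi'; rewrite lee_fin; apply: ler_powR_base => //.
      by rewrite subr_ge0.
    by have [] := top_le l1 xi xi'.
rewrite lee_pmul2l ?lte_fin ?exprn_gt0//.
rewrite -integral_sum_indic//; last by move=> i x; exact: powR_ge0.
rewrite integral_lincomb ?(ltW e0) ?powR_ge0//; last first.
- by move=> x; exact: powR_ge0.
- by move=> x; exact: powR_ge0.
- by apply: measurable_powR_comp; exact: measurable_cube_sum.
- by apply: measurable_powR_comp; exact: measurable_cube_sum.
apply: le_integralT => x.
  by rewrite lee_fin sumr_ge0// => i _; rewrite mulr_ge0 ?powR_ge0.
rewrite lee_fin -mulr_suml -/(cube_sum 1 x).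
set g := cube_sum 1 x; set F := cube_sum (3 * l) x.
have g0 : 0 <= g by exact: cube_sum_ge0.
have F0 : 0 <= F by exact: cube_sum_ge0.
have [gF|Fg] := leP g (e * F).
  apply: (@le_trans _ _ (e * F * F `^ (th - 1))).
    by rewrite ler_wpM2r ?powR_ge0.
  by rewrite -mulrA mulr_powRB1// lerDl mulr_ge0 ?powR_ge0.
apply: (@le_trans _ _ (g * (g / e) `^ (th - 1))).
  rewrite ler_wpM2l//; apply: ler_powR_base => //; first by rewrite subr_ge0.
  by rewrite ler_pdivlMr// mulrC ltW.
rewrite powRM ?invr_ge0 ?(ltW e0)// mulrA mulr_powRB1//.
rewrite -powR_inv1 ?(ltW e0)// -powRrM mulN1r opprB mulrC lerDr.
by rewrite mulr_ge0 ?powR_ge0// ltW.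
Qed.

(** For th <= 1 the power th - 1 is decreasing, so the argument runs the other
    way: the integral of g F^(th-1), with g and F the sums at dilations l and
    3 l, is at most the integral over the original cubes of truncated sums, to
    which [ordered_sum_le] applies.  The power g^th is recovered from it where
    g > e F, and it is at most e^th F^th elsewhere. *)
Let step_le1 th l e : 0 < th <= 1 -> 1 <= l -> 0 < e ->
  (G th l <= (e `^ (th - 1) * th^-1 * l ^+ d)%:E * G th 1 + (e `^ th)%:E * G th (3 * l))%E.
Proof.
move=> t01 l1 e0; have /andP[t0 t1] := t01; have l0 : 0 < l by lra.
have mFG : measurable_fun setT (fun x => (cube_sum l x * cube_sum (3 * l) x `^ (th - 1))).
  apply: measurable_funM; first exact: measurable_cube_sum.
  by apply: measurable_powR_comp; exact: measurable_cube_sum.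
have key : (\int[mu]_x (cube_sum l x * cube_sum (3 * l) x `^ (th - 1))%:E <=
   (l ^+ d)%:E * (th^-1%:E * G th 1))%E.
  under eq_integral do rewrite /cube_sum mulr_suml -/(cube_sum _ _).
  rewrite integral_sum_indic//; last first.
  - by move=> i x; exact: powR_ge0.
  - by move=> i; apply: measurable_powR_comp; exact: measurable_cube_sum.
  apply: (@le_trans _ _ ((l ^+ d)%:E * \int[mu]_x
    (\sum_i a i * \1_(B 1 i) x * top 1 i x `^ (th - 1))%R%:E)%E); last first.
    rewrite lee_pmul2l ?lte_fin ?exprn_gt0// -lower_integralZl ?invr_gt0//; last first.
      by move=> x _; rewrite lee_fin powR_ge0.
    apply: le_integralT => x.
      by rewrite lee_fin sumr_ge0// => i _; rewrite mulr_ge0 ?powR_ge0.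
    rewrite -EFinM lee_fin.
    exact: (@ordered_sum_le _ _ (fun i => a i * \1_(B 1 i) x) r (fun i => term_ge0 1 i x) _ t01).
  rewrite integral_sum_indic//; last first.
  - by move=> i x; exact: powR_ge0.
  - by move=> i; apply: measurable_powR_comp; exact: measurable_top.
  rewrite ge0_sume_distrr; last first.
    by move=> i _; rewrite mule_ge0 ?lee_fin// integral_ge0// => x _; rewrite lee_fin powR_ge0.
  apply: lee_sum => i _; rewrite muleCA.
  have [->|ai] := eqVneq (a i) 0; first by rewrite !mul0e.
  have ai0 : 0 < a i by rewrite lt0r ai a0.
  rewrite lee_pmul2l//.
  apply: integral_le_comparison => //.
  - by rewrite exprn_gt0.
  - exact: muB_fin.
  - exact: muB.
  - by move=> x _; rewrite lee_fin powR_ge0.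
  - by move=> x _; rewrite lee_fin powR_ge0.
  - move=> x x' xi xi'; rewrite lee_fin; apply: ger_powR_base => //.
    + by rewrite subr_le0.
    + apply: (lt_le_trans ai0); rewrite /top (bigD1 i)//= indicE mem_set// mulr1.
      by rewrite lerDl sumr_ge0.
    + by have [] := top_le l1 xi xi'.
apply: (@le_trans _ _ ((e `^ (th - 1))%:E *
    (\int[mu]_x (cube_sum l x * cube_sum (3 * l) x `^ (th - 1))%:E) +
    (e `^ th)%:E * G th (3 * l))%E); last first.
  rewrite leeD2r// !EFinM -!muleA lee_pmul2l ?lte_fin ?powR_gt0//.
  by apply: (le_trans key); rewrite muleCA.
rewrite integral_lincomb ?powR_ge0//; last first.
- by move=> x; exact: powR_ge0.
- by move=> x; rewrite mulr_ge0 ?powR_ge0 ?cube_sum_ge0.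
- by apply: measurable_powR_comp; exact: measurable_cube_sum.
apply: le_integralT => x; first by rewrite lee_fin powR_ge0.
rewrite lee_fin.
have := cube_sum_le3 x l1.
set g := cube_sum l x; set F := cube_sum (3 * l) x => gF.
have g0 : 0 <= g by exact: cube_sum_ge0.
have F0 : 0 <= F by exact: cube_sum_ge0.
have [gF'|Fg] := leP g (e * F).
  apply: (@le_trans _ _ ((e * F) `^ th)).
    by apply: ler_powR_base => //; exact: ltW.
  by rewrite powRM ?(ltW e0)// lerDr !mulr_ge0 ?powR_ge0.
have [gz|gpos] := eqVneq g 0.
  by rewrite gz powR0 ?gt_eqF// mul0r mulr0 add0r mulr_ge0 ?powR_ge0.
have gp : 0 < g by rewrite lt0r gpos.
have Fp : 0 < F by exact: lt_le_trans gF.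
rewrite -[in leLHS](mulr_powRB1 g0 t0).
apply: (@le_trans _ _ (g * (e * F) `^ (th - 1))).
  rewrite ler_wpM2l//; apply: ger_powR_base; rewrite ?subr_le0// ?mulr_gt0//.
  exact: ltW.
by rewrite powRM ?(ltW e0)// mulrCA lerDl mulr_ge0 ?powR_ge0.
Qed.

(** A crude bound whose constant depends on the cubes; it only starts the
    iteration of [self_improve]. *)
Let G_bound th : 0 < th -> exists2 D : R, 0 <= D &
  forall l, 1 <= l -> (G th l <= (D * l ^+ d)%:E)%E.
Proof.
move=> t0; pose S := \sum_i a i.
have S0 : 0 <= S by exact: sumr_ge0.
exists (S `^ th * \sum_i fine (mu (B 1 i))).
  by rewrite mulr_ge0 ?powR_ge0// sumr_ge0// => i _; rewrite fine_ge0.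
move=> l l1; have l0 : 0 < l by lra.
apply: (@le_trans _ _ (\int[mu]_x (\sum_i S `^ th * \1_(B l i) x * 1)%:E)%E).
  apply: le_integralT => x; first by rewrite lee_fin powR_ge0.
  rewrite lee_fin; have [[j xj]|nx] := pselect (exists i, B l i x).
    rewrite (bigD1 j)//= indicE mem_set// !mulr1.
    apply: ler_wpDr; first by apply: sumr_ge0 => k _; rewrite mulr1 mulr_ge0 ?powR_ge0.
    apply: ler_powR_base; [exact: ltW|exact: cube_sum_ge0|].
    by apply: ler_sum => k _; rewrite ler_piMr// indicE lern1 leq_b1.
  rewrite (_ : cube_sum l x = 0) ?powR0 ?gt_eqF//.
    by rewrite sumr_ge0// => k _; rewrite mulr1 mulr_ge0 ?powR_ge0.
  by rewrite /cube_sum big1// => k _; rewrite indicE memNset ?mulr0// => xk; apply: nx; exists k.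
rewrite integral_sum_indic//; last by move=> i; exact: powR_ge0.
rewrite -mulrA EFinM mulr_suml -sumEFin ge0_sume_distrr; last first.
  by move=> i _; rewrite lee_fin mulr_ge0 ?fine_ge0 ?exprn_ge0// ltW.
apply: lee_sum => i _; rewrite lee_wpmul2l ?lee_fin ?powR_ge0//.
rewrite integral_cst// mul1e EFinM muleC fineK.
  by rewrite -(muB i l0).
by rewrite ge0_fin_numE//; have /andP[] := muB_fin i.
Qed.

Let G_ge0 th l : (0 <= G th l)%E.
Proof. by apply: integral_ge0 => x _; rewrite lee_fin powR_ge0. Qed.

Let self_improve_G th A b : 0 < th -> 0 <= A -> d%:R <= b ->
  (forall l, 1 <= l -> (G th l <= (A * l `^ b)%:E * G th 1 +
    ((2 * 3 `^ b)^-1)%:E * G th (3 * l))%E) ->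
  forall l, 1 <= l -> (G th l <= (2 * A * l `^ b)%:E * G th 1)%E.
Proof.
move=> t0 A0 db H l l1; have [D D0 HD] := G_bound t0.
have Gfin k : 1 <= k -> G th k = (fine (G th k))%:E.
  move=> k1; rewrite fineK// ge0_fin_numE//; exact: le_lt_trans (HD _ k1) (ltry _).
have b0 : 0 <= b by exact: le_trans db.
have g1 : 0 <= fine (G th 1) by rewrite fine_ge0.
have := @self_improve R (fun k => fine (G th k)) (A * fine (G th 1)) D b _ b0 _ _ l l1.
rewrite (Gfin _ l1) (Gfin 1)// -EFinM lee_fin mulrA -[2 * A * _ * _]mulrA.
rewrite [fine _ * _]mulrC mulrA; apply.
- exact: mulr_ge0.
- move=> k k1; rewrite -lee_fin -Gfin//; apply: (le_trans (HD _ k1)).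
  rewrite lee_fin ler_wpM2l// -powR_mulrn; last lra.
  exact: ler_powR.
- move=> k k1; have := H _ k1; rewrite (Gfin _ k1) (Gfin 1)//.
  rewrite (Gfin (3 * k)); last lra.
  by rewrite -!EFinM -EFinD lee_fin mulrAC.
Qed.

(** The parameter e of [step_ge1] is chosen so that the coefficient of
    G th (3 l) is the one that [self_improve] absorbs. *)
Lemma cube_sum_dilation_ge1 th l : 1 <= th -> 1 <= l ->
  (\int[mu]_x (cube_sum l x `^ th)%:E <=
   (2 * (th * (2 * th * 3 `^ (d%:R * th)) `^ (th - 1)) * l `^ (d%:R * th))%:E *
   \int[mu]_x (cube_sum 1 x `^ th)%:E)%E.
Proof.
move=> t1 l1; have t0 : 0 < th by lra.
apply: self_improve_G => //; first by rewrite mulr_ge0 ?powR_ge0// ltW.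
  by rewrite ler_peMr.
move=> {l1}{}l l1; have l0 : 0 < l by lra.
set K := 2 * th * 3 `^ (d%:R * th).
have K0 : 0 < K by rewrite !mulr_gt0 ?powR_gt0.
have ld0 : 0 < l ^+ d by exact: exprn_gt0.
have e0 : 0 < (l ^+ d * K)^-1 by rewrite invr_gt0 mulr_gt0.
apply: (le_trans (step_ge1 t1 l1 e0)).
have p30 : 3 `^ (d%:R * th) != 0 :> R by rewrite gt_eqF ?powR_gt0.
have E1 : th * l ^+ d * (l ^+ d * K)^-1 = (2 * 3 `^ (d%:R * th))^-1.
  by rewrite /K; field; rewrite p30 !gt_eqF.
have E2 : th * l ^+ d * (l ^+ d * K)^-1 `^ (1 - th) =
    th * K `^ (th - 1) * l `^ (d%:R * th).
  rewrite -powR_inv1 ?(ltW (mulr_gt0 ld0 K0))// -powRrM mulN1r opprB.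
  rewrite powRM ?(ltW ld0) ?(ltW K0)// mulrA -[th * _ * _]mulrA mulr_powRB1 ?(ltW ld0)//.
  by rewrite -[l ^+ d]powR_mulrn ?(ltW l0)// -powRrM mulrAC.
move: (G th 1) (G th (3 * l)) (G_ge0 th 1) (G_ge0 th (3 * l)) => x1 x3 x10 x30.
rewrite ge0_muleDr ?mule_ge0 ?lee_fin ?powR_ge0 ?(ltW e0)//.
by rewrite !muleA -!EFinM E1 E2 addeC.
Qed.

(** The parameter e of [step_le1] is chosen in the same way, and here it does
    not depend on l. *)
Lemma cube_sum_dilation_le1 th l : 0 < th <= 1 -> 1 <= l ->
  (\int[mu]_x (cube_sum l x `^ th)%:E <=
   (2 * (((2 * 3 `^ d%:R)^-1 `^ th^-1) `^ (th - 1) * th^-1) * l `^ d%:R)%:E *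
   \int[mu]_x (cube_sum 1 x `^ th)%:E)%E.
Proof.
move=> t01 l1; have /andP[t0 t1] := t01.
apply: self_improve_G => //.
  by rewrite mulr_ge0 ?powR_ge0// invr_ge0 ltW.
move=> {l1}{}l l1; have l0 : 0 < l by lra.
have e0 : 0 < (2 * 3 `^ d%:R)^-1 `^ th^-1 :> R.
  by rewrite powR_gt0// invr_gt0 mulr_gt0// powR_gt0.
apply: (le_trans (step_le1 t01 l1 e0)).
rewrite -[((2 * 3 `^ d%:R)^-1 `^ th^-1) `^ th]powRrM mulVf ?gt_eqF// powRr1; last first.
  by rewrite invr_ge0 mulr_ge0// powR_ge0.
by rewrite (powR_mulrn d (ltW l0)).
Qed.

End finite_cubes.

(** * Dilating the cubes of a series *)

Section countable_sums.
Local Open Scope ereal_scope.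
Context (R : realType) (d : nat).
Notation mu := (lebesgue_rV R d).

Definition dil_exp (th : R) : R := (d%:R * Num.max 1 th)%R.

Lemma cube_sum_dilation (th : R) : (0 < th)%R -> exists2 C : R, (0 < C)%R &
  forall (I : finType) (a : I -> R) (y : I -> 'rV[R]_d) (r : I -> R),
  (forall i, 0 <= a i)%R -> (forall i, 0 < r i)%R ->
  forall l, (1 <= l)%R ->
  \int[mu]_x (cube_sum a y r l x `^ th)%:E <=
  (C * l `^ dil_exp th)%:E * \int[mu]_x (cube_sum a y r 1 x `^ th)%:E.
Proof.
move=> t0; have [t1|t1] := leP 1%R th.
  exists (2 * (th * (2 * th * 3 `^ (d%:R * th)) `^ (th - 1)))%R.
    by rewrite !mulr_gt0 ?powR_gt0// !mulr_gt0 ?powR_gt0.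
  move=> I a y r a0 r0 l l1; rewrite /dil_exp; have -> : Num.max 1%R th = th by apply/max_idPr.
  exact: cube_sum_dilation_ge1.
exists (2 * (((2 * 3 `^ d%:R)^-1 `^ th^-1) `^ (th - 1) * th^-1))%R.
  by rewrite !mulr_gt0 ?invr_gt0// !powR_gt0// invr_gt0 mulr_gt0 ?powR_gt0.
move=> I a y r a0 r0 l l1; rewrite /dil_exp.
have -> : Num.max 1%R th = 1%R by apply/max_idPl/ltW.
by rewrite mulr1; apply: cube_sum_dilation_le1 => //; rewrite t0 ltW.
Qed.

Definition cube_series (b : nat -> \bar R) (y : nat -> 'rV[R]_d) (r : nat -> R)
    (l : R) (x : 'rV[R]_d) : \bar R :=
  \sum_(n <oo) b n * (\1_(cube (y n) (l * r n)) x)%:E.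

Lemma cube_series_ge0 b y r l x : (forall n, 0 <= b n) -> 0 <= cube_series b y r l x.
Proof. by move=> b0; apply: nneseries_ge0 => n _ _; rewrite mule_ge0// lee_fin. Qed.

(** The constant for finite sums does not depend on the number of cubes, so
    monotone convergence gives the case of finite coefficients.  An infinite
    coefficient makes the right-hand side infinite. *)
Lemma cube_series_dilation (th : R) : (0 < th)%R -> exists2 C : R, (0 < C)%R &
  forall (b : nat -> \bar R) (y : nat -> 'rV[R]_d) (r : nat -> R),
  (forall n, 0 <= b n) -> (forall n, 0 < r n)%R ->
  forall l, (1 <= l)%R ->
  \int[mu]_x (cube_series b y r l x `^ th) <=
  (C * l `^ dil_exp th)%:E * \int[mu]_x (cube_series b y r 1 x `^ th).
Proof.
move=> t0; have [C C0 HC] := cube_sum_dilation t0; exists C => //.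
move=> b y r b0 r0 l l1; have l0 : (0 < l)%R by lra.
have Cl : (0 < C * l `^ dil_exp th)%R by rewrite mulr_gt0// powR_gt0.
have S0 l' x : 0 <= cube_series b y r l' x by exact: cube_series_ge0.
have [[n bn]|bfin] := pselect (exists n, b n = +oo).
  suff -> : \int[mu]_x (cube_series b y r 1 x `^ th) = +oo.
    by rewrite gt0_muley ?lte_fin// leey.
  apply/eqP; rewrite -leye_eq.
  have <- : \int[mu]_(x in cube (y n) (r n)) (cst +oo x) = +oo.
    rewrite integral_cst; last exact: measurable_cube.
    have mn : 0 < mu (cube (y n) (r n)).
      by rewrite lebesgue_rV_cube ?ltW// lte_fin exprn_gt0// mulrn_wgt0.
    by rewrite gt0_mulye//; exact: mn.
  apply: le_integral_sub => // [x _|x xn|x _]; [exact: leey| |exact: poweR_ge0].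
  rewrite (_ : cube_series b y r 1 x = +oo) ?poweRyr ?gt_eqF//.
  apply: (@eseries_pinfty _ _ xpredT n) => //.
    by move=> k _; rewrite -ltNye (lt_le_trans (ltNyr 0))// mule_ge0// lee_fin.
  by rewrite bn indicE mem_set ?mule1// mul1r.
pose a n := fine (b n).
have bE n : b n = (a n)%:E.
  rewrite /a fineK// ge0_fin_numE//; rewrite ltey; apply/eqP => bn; apply: bfin.
  by exists n.
have a0 n : (0 <= a n)%R by rewrite fine_ge0.
pose S N l x := cube_sum (fun i : 'I_N => a i) (fun i => y i) (fun i => r i) l x.
have SE N l' x : (S N l' x)%:E = \sum_(0 <= i < N) b i * (\1_(cube (y i) (l' * r i)) x)%:E.
  rewrite big_mkord /S /cube_sum -sumEFin; apply: eq_bigr => i _.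
  by rewrite bE EFinM.
have Sle N l' x : (S N l' x)%:E <= cube_series b y r l' x.
  by rewrite SE; apply: nneseries_lim_ge => n _; rewrite mule_ge0// lee_fin.
have Sge0 N l' x : (0 <= S N l' x)%R by exact: cube_sum_ge0.
have Snd l' x : nondecreasing_seq (fun N => S N l' x).
  apply/nondecreasing_seqP => N; rewrite -lee_fin !SE big_nat_recr//= leeDl//.
  by rewrite mule_ge0// lee_fin.
pose L x := limn (fun N => (S N l x `^ th)%:E).
have Lnd x : {homo (fun N => (S N l x `^ th)%:E) : m n / (m <= n)%N >-> (m <= n)}.
  by move=> m n mn; rewrite lee_fin ler_powR_base ?(ltW t0)//; exact: Snd.
have SL N x : (S N l x `^ th)%:E <= L x.
  rewrite /L; have := ereal_nondecreasing_cvgn (Lnd x) => /cvg_lim ->//.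
  by apply: ereal_sup_ubound; exists N.
have L0 x : 0 <= L x by apply: le_trans (SL 0%N x); rewrite lee_fin powR_ge0.
apply: (@le_trans _ _ (\int[mu]_x L x)).
  apply: le_integralT => x; first exact: poweR_ge0.
  rewrite -[leRHS](@poweRVK _ _ th) ?gt_eqF//; apply: le_poweR => //; first exact: ltW.
  apply: lime_le; first by apply: is_cvg_nneseries => n _ _; rewrite mule_ge0// lee_fin.
  apply: nearW => N; rewrite -SE -[leLHS](@poweRK _ _ th) ?lee_fin ?gt_eqF//.
  apply: le_poweR; [by rewrite invr_ge0 ltW|exact: poweR_ge0|].
  by rewrite poweR_EFin; exact: SL.
have mS N : measurable_fun setT (fun x => (S N l x `^ th)%:E).
  apply/measurable_EFinP.
  by apply: (measurableT_comp (measurable_powR th)); exact: measurable_cube_sum.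
have S00 N x : setT x -> 0 <= (S N l x `^ th)%:E by rewrite lee_fin powR_ge0.
rewrite (monotone_convergence mu measurableT mS S00 (fun x _ => Lnd x)).
apply: lime_le.
  apply: ereal_nondecreasing_is_cvgn => m n mn; apply: le_integralT => x.
    by rewrite lee_fin powR_ge0.
  exact: Lnd.
apply: nearW => N; apply: (le_trans (HC _ _ _ _ _ _ _ l1)) => //.
rewrite lee_pmul2l//; apply: le_integralT => x; first by rewrite lee_fin powR_ge0.
rewrite -poweR_EFin; apply: le_poweR; [exact: ltW| |exact: Sle].
by rewrite lee_fin; exact: Sge0.
Qed.

End countable_sums.

(** * Dilating the cubes of a supremum *)

Section vitali.
Context (R : realType) (d : nat).
Notation mu := (lebesgue_rV R d).

(** Vitali's argument: the cubes whose dilates meet the dilate of a largest one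
    are contained in its threefold dilate, the other cubes are disjoint from it,
    and induction applies to them. *)
Lemma cube_cover_finite (I : finType) (y : I -> 'rV[R]_d) (r : I -> R) (l : R)
    (A : {set I}) : (forall i, 0 < r i) -> 1 <= l ->
  (mu (\bigcup_(i in [set` A]) cube (y i) (l * r i)) <=
   ((3 * l) ^+ d)%:E * mu (\bigcup_(i in [set` A]) cube (y i) (1 * r i)))%E.
Proof.
move=> r0 l1; have l0 : 0 < l by lra.
have K0 : 0 < (3 * l) ^+ d by rewrite exprn_gt0// mulr_gt0.
have mU (l' : R) (B : {set I}) : measurable (\bigcup_(i in [set` B]) cube (y i) (l' * r i)).
  by apply: fin_bigcup_measurable => [|i _]; [exact: finite_finset|exact: measurable_cube].
have [n cA] : exists n, (#|A| <= n)%N by exists #|A|.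
elim: n A cA => [|n IH] A cA.
  have -> : A = finset.set0 by apply/eqP; rewrite -cards_eq0 -leqn0.
  rewrite (_ : \bigcup_(i in _) _ = set0) ?measure0 ?mule_ge0 ?lee_fin ?(ltW K0)//.
  by apply/seteqP; split => // x [i] /=; rewrite finset.inE.
have [->|/set0Pn[i0 i0A]] := eqVneq A finset.set0.
  rewrite (_ : \bigcup_(i in _) _ = set0) ?measure0 ?mule_ge0 ?lee_fin ?(ltW K0)//.
  by apply/seteqP; split => // x [i] /=; rewrite finset.inE.
have [m mA mmax] : exists2 m, m \in A & forall j, j \in A -> r j <= r m.
  by case: (Order.TotalTheory.arg_maxP r i0A) => m mA H; exists m.
pose touch j := `[< exists w, cube (y j) (l * r j) w /\ cube (y m) (l * r m) w >].
pose A' := [set j in A | ~~ touch j]%SET.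
have mm : touch m.
  apply/asboolP; exists (y m); split => k; rewrite subrr normr0 mulr_gt0//.
have A'A : A' \subset A by apply/fintype.subsetP => j; rewrite finset.inE => /andP[].
have cA' : (#|A'| <= n)%N.
  rewrite -ltnS; apply: leq_trans cA; apply: proper_card; apply/properP; split => //.
  by exists m => //; rewrite finset.inE mA mm.
have cov : \bigcup_(i in [set` A]) cube (y i) (l * r i) `<=`
    cube (y m) (3 * l * r m) `|` \bigcup_(i in [set` A']) cube (y i) (l * r i).
  move=> x [j jA xj]; have [tj|tj] := boolP (touch j); last first.
    by right; exists j => //=; rewrite finset.inE tj andbT.
  left=> k; move/asboolP : tj => [w [wj wm]].
  have rjm : l * r j <= l * r m by rewrite ler_pM2l// mmax.
  rewrite -mulrA.
  have := xj k; have := wj k; have := wm k.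
  by rewrite !ltr_norml => /andP[? ?] /andP[? ?] /andP[? ?]; apply/andP; split; lra.
apply: (@le_trans _ _ (mu (cube (y m) (3 * l * r m) `|`
    \bigcup_(i in [set` A']) cube (y i) (l * r i)))).
  by apply: le_measure; rewrite ?inE//; apply: measurableU => //; exact: measurable_cube.
have E : mu (cube (y m) (3 * l * r m)) = (((3 * l) ^+ d)%:E * mu (cube (y m) (1 * r m)))%E.
  rewrite !lebesgue_rV_cube ?mulr_ge0 ?(ltW l0) ?(ltW (r0 m))//.
  rewrite -EFinM -exprMn; apply: (congr1 (fun z : R => (z ^+ d)%:E)); ring.
apply: (@le_trans _ _ (mu (cube (y m) (3 * l * r m)) +
    mu (\bigcup_(i in [set` A']) cube (y i) (l * r i)))%E).
  by apply: measureU2 => //; exact: measurable_cube.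
rewrite E; apply: (le_trans (leeD2l _ (IH _ cA'))).
rewrite -ge0_muleDr// lee_pmul2l//.
rewrite -measureU//; last 2 first.
- exact: measurable_cube.
- apply/seteqP; split => // x [xm [j /=]]; rewrite finset.inE => /andP[_ /asboolPn tj] xj.
  apply: tj; exists x; split => k.
    by apply: lt_le_trans (xj k) _; rewrite ler_wpM2r ?(ltW (r0 j)).
  by apply: lt_le_trans (xm k) _; rewrite ler_wpM2r ?(ltW (r0 m)).
apply: le_measure; rewrite ?inE//.
  by apply: measurableU => //; exact: measurable_cube.
move=> x [xm|[j /= jA' xj]]; first by exists m.
by exists j => //=; move/fintype.subsetP : A'A; exact.
Qed.

(** Continuity of the measure along the unions of the first N sets. *)
Lemma cube_cover_countable (y : nat -> 'rV[R]_d) (r : nat -> R) (l : R)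
    (P : set nat) : (forall i, 0 < r i) -> 1 <= l ->
  (mu (\bigcup_(i in P) cube (y i) (l * r i)) <=
   ((3 * l) ^+ d)%:E * mu (\bigcup_(i in P) cube (y i) (1 * r i)))%E.
Proof.
move=> r0 l1.
pose U l' N := \bigcup_(i in [set` [set i : 'I_N | `[< P i >]]%SET]) cube (y i) (l' * r i).
have mU l' N : measurable (U l' N).
  by apply: fin_bigcup_measurable => [|i _]; [exact: finite_finset|exact: measurable_cube].
have mPU l' : measurable (\bigcup_(i in P) cube (y i) (l' * r i)).
  by apply: bigcup_measurable => i _; exact: measurable_cube.
have Usub l' N : U l' N `<=` \bigcup_(i in P) cube (y i) (l' * r i).
  by move=> x [i /=]; rewrite finset.inE => /asboolP Pi xi; exists i.
have UE l' : \bigcup_(i in P) cube (y i) (l' * r i) = \bigcup_N U l' N.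
  apply/seteqP; split => [x [i Pi xi]|x [N _]]; last exact: Usub.
  by exists i.+1 => //; exists ord_max => //=; rewrite finset.inE; apply/asboolP.
rewrite [in leLHS]UE.
have ndU : nondecreasing_seq (U l).
  apply/nondecreasing_seqP => N; apply/subsetPset => x [i /=]; rewrite finset.inE => Pi xi.
  by exists (widen_ord (leqnSn N) i) => //=; rewrite finset.inE.
have mUU : measurable (\bigcup_N U l N) by rewrite -UE.
have cv := @nondecreasing_cvg_mu _ _ _ mu (U l) (mU l) mUU ndU.
rewrite -(cvg_lim _ cv)//.
apply: lime_le.
  apply: ereal_nondecreasing_is_cvgn; apply/nondecreasing_seqP => N /=.
  apply: le_measure; rewrite ?inE// => x [i /=]; rewrite finset.inE => Pi xi.
  by exists (widen_ord (leqnSn N) i) => //=; rewrite finset.inE.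
apply: nearW => N /=.
have := @cube_cover_finite _ (fun i : 'I_N => y i) (fun i => r i) l
  [set i : 'I_N | `[< P i >]]%SET (fun i => r0 i) l1.
move=> /le_trans; apply; rewrite lee_pmul2l ?lte_fin ?exprn_gt0 ?mulr_gt0//; last lra.
by apply: le_measure; rewrite ?inE//; [exact: (mU 1 N)|exact: (@Usub 1 N)].
Qed.

Section hypograph.
Local Open Scope ereal_scope.

(** Tonelli's theorem on the hypograph of the supremum.  The hypograph is the
    union of the products of A n with ]0, b n[, hence measurable, and its section
    at level c is the union on the right. *)
Lemma integral_sup_indic (b : nat -> \bar R) (A : nat -> set 'rV[R]_d) :
  (forall n, 0 <= b n) -> (forall n, measurable (A n)) ->
  \int[mu]_x ereal_sup (range (fun n => b n * (\1_(A n) x)%:E)) =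
  \int[@lebesgue_measure R]_c
    mu (\bigcup_(n in [set n | (0 < c)%R /\ c%:E < b n]) A n).
Proof.
move=> b0 mA.
pose lam := @lebesgue_measure R.
pose J n : set (measurableTypeR R) := [set c | (0 < c)%R /\ c%:E < b n].
have JE n : J n = if b n is s%:E then `]0%R, s[%classic else `]0%R, +oo[%classic.
  apply/seteqP; have := b0 n; rewrite /J; case: (b n) => [s| |] // s0; split => c /=;
    rewrite in_itv/= ?lte_fin ?andbT; first by move=> [-> ->].
  - by move=> /andP[].
  - by case.
  - by move=> ?; split => //; exact: ltry.
have mJ n : measurable (J n) by rewrite JE; case: (b n).
pose H := \bigcup_n (A n `*` J n).
have mH : measurable H by apply: bigcupT_measurable => n; exact: measurableX.
transitivity ((mu \x lam)%E H).
  apply: eq_integral => x _.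
  set s := ereal_sup _.
  have s0 : 0 <= s.
    apply: le_trans (ereal_sup_ubound (ex_intro2 _ _ 0%N I erefl)).
    by rewrite mule_ge0// lee_fin.
  have xsE : xsection H x = [set c | (0 < c)%R /\ c%:E < s].
    apply/seteqP; split => c; rewrite /xsection/= ?inE.
      move=> [n _ [/= xn [c0 cb]]]; split => //; apply: (lt_le_trans cb).
      apply: ereal_sup_ubound; exists n => //.
      by rewrite indicE mem_set// mule1.
    move=> [c0 /ereal_sup_gt[_ [n _ <-] cb]]; exists n => //=.
    move: cb; rewrite indicE; case: (boolP (x \in A n)) => [/set_mem xn|_] /=.
      by rewrite mule1.
    by rewrite mule0 lte_fin ltNge (ltW c0).
  rewrite /= xsE; case: s s0 {xsE} => [s| |] // s0.
    rewrite (_ : [set c | _] = `]0%R, s[%classic).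
      rewrite /lam lebesgue_measure_itv/= lte_fin; move: s0; rewrite lee_fin le_eqVlt.
      by move=> /predU1P[<-|->]; rewrite ?ltxx// sube0.
    by apply/seteqP; split => c /=; rewrite in_itv/= lte_fin;
      [move=> [-> ->]|move=> /andP[]].
  rewrite (_ : [set c | _] = `]0%R, +oo[%classic); first by rewrite /lam lebesgue_measure_itv/= ltry.
  by apply/seteqP; split => c /=; rewrite in_itv/= andbT;
    [case|move=> ?; split => //; exact: ltry].
rewrite (@product_measure_unique _ _ _ _ R mu lam (product_measure2 mu lam))//; last first.
  by move=> B C mB mC; exact: product_measure2E.
apply: eq_integral => c _ /=; congr (mu _).
apply/seteqP; split => x; rewrite /ysection/= ?inE.
  by move=> [n _ [/= xn cJ]]; exists n.
by move=> [n cJ xn]; exists n.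
Qed.

Definition cube_sup (b : nat -> \bar R) (y : nat -> 'rV[R]_d) (r : nat -> R)
    (l : R) (x : 'rV[R]_d) : \bar R :=
  ereal_sup (range (fun n => b n * (\1_(cube (y n) (l * r n)) x)%:E)).

Lemma cube_sup_dilation (b : nat -> \bar R) (y : nat -> 'rV[R]_d) (r : nat -> R)
    (l : R) : (forall n, 0 <= b n) -> (forall n, 0 < r n)%R -> (1 <= l)%R ->
  \int[mu]_x cube_sup b y r l x <= ((3 * l) ^+ d)%:E * \int[mu]_x cube_sup b y r 1 x.
Proof.
move=> b0 r0 l1; rewrite !integral_sup_indic//; try by move=> n; exact: measurable_cube.
rewrite -lower_integralZl ?exprn_gt0//; last lra.
apply: le_integralT => c //.
exact: cube_cover_countable.
Qed.

End hypograph.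
End vitali.

(** * Operator norms and the three families of norms *)

Section operators.
Local Open Scope ereal_scope.
Context (R : realType) (d : nat).
Notation axb_fun := (@axb_fun R d).
Implicit Types (F : axb_fun) (N : axb_fun -> \bar R).

Definition cscale (k : R) F : axb_fun := fun u =>
  complex.Complex (k * complex.Re (F u))%R (k * complex.Im (F u))%R.

Lemma abs_fun_ge0 F x t : 0 <= abs_fun F x t.
Proof.
by rewrite lee_fin /complex.ComplexField.Normc.normc; case: (F _) => *; exact: sqrtr_ge0.
Qed.

Lemma abs_fun_cscale (k : R) F x t : (0 < k)%R ->
  abs_fun (cscale k F) x t = k%:E * abs_fun F x t.
Proof.
move=> k0; rewrite /abs_fun /cscale /=; case: (F _) => u v /=.
rewrite -EFinM; congr EFin; rewrite !exprMn -mulrDr sqrtrM ?sqr_ge0//.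
by rewrite sqrtr_sqr gtr0_norm.
Qed.

Lemma measurable_axb_group : measurable (@axb_group R d).
Proof.
have -> : @axb_group R d = setT `&` snd @^-1` `]0%R, +oo[%classic.
  by rewrite setTI; apply/seteqP; split => u /=; rewrite /axb_group/= in_itv/= andbT.
by apply: measurable_snd.
Qed.

Lemma axb_measurable_cscale (k : R) F : axb_measurable F -> axb_measurable (cscale k F).
Proof.
move=> [m1 m2]; split; first exact: (@measurable_funM _ _ R _ (cst k)).
exact: (@measurable_funM _ _ R _ (cst k)).
Qed.

Lemma axb_measurable_comp (phi : 'rV[R]_d * measurableTypeR R -> 'rV[R]_d * measurableTypeR R) F :
  measurable_fun [set: _] phi -> (forall u, axb_group u -> axb_group (phi u)) ->
  axb_measurable F -> axb_measurable (fun u => F (phi u)).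
Proof.
move=> mphi gphi [m1 m2].
have sub : phi @` @axb_group R d `<=` @axb_group R d.
  by move=> _ [u Gu <-]; exact: gphi.
have mphi' : measurable_fun (@axb_group R d) phi.
  by apply: measurable_funTS.
split.
  exact: (measurable_comp measurable_axb_group sub m1 mphi').
exact: (measurable_comp measurable_axb_group sub m2 mphi').
Qed.

Lemma axb_measurable_left z r F : (0 < r)%R ->
  axb_measurable F -> axb_measurable (left_translation z r F).
Proof.
move=> r0; apply: axb_measurable_comp; last first.
  by move=> u; rewrite /axb_group/= => u0; exact: divr_gt0.
apply: measurable_fun_pair.
  apply: (measurableT_comp (f := fun x : 'rV[R]_d => r^-1 *: (x - z))%R) => //.
  rewrite (_ : (fun x => _) = aff (- (r^-1 *: z))%R r^-1); first exact: measurable_aff.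
  by apply/funext => x; rewrite /aff scalerBr addrC.
by apply: (@measurable_funM _ _ R) => //; exact: measurable_snd.
Qed.

Lemma axb_measurable_right z r F : (0 < r)%R ->
  axb_measurable F -> axb_measurable (right_translation z r F).
Proof.
move=> r0; apply: axb_measurable_comp; last first.
  by move=> u; rewrite /axb_group/= => u0; exact: mulr_gt0.
apply: measurable_fun_pair.
  apply: measurable_fun_rVP => i.
  apply: (eq_measurable_fun (fun u : 'rV[R]_d * measurableTypeR R => u.1 0%R i + u.2 * z 0%R i)%R).
    by move=> u _; rewrite !mxE.
  apply: (@measurable_funD _ _ R).
    exact: (measurableT_comp (measurable_rV_coord i) measurable_fst).
  by apply: (@measurable_funM _ _ R) => //; exact: measurable_snd.
by apply: (@measurable_funM _ _ R) => //; exact: measurable_snd.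
Qed.

Definition homogeneous N := forall (k : R) F, (0 < k)%R -> N (cscale k F) = k%:E * N F.

Lemma preserves_le N A (c : R) :
  (forall F, axb_measurable F -> axb_measurable (A F)) ->
  (forall F, N F < +oo -> axb_measurable F -> N (A F) <= c%:E * N F) ->
  (forall F, 0 <= N F) -> preserves N A.
Proof.
move=> mA NA N0 F [mF NF]; split; first exact: mA.
apply: (le_lt_trans (NA _ NF mF)).
have [e ->] : exists e : R, N F = e%:E.
  by exists (fine (N F)); rewrite fineK// ge0_fin_numE.
by rewrite -EFinM ltry.
Qed.

Lemma opnorm_le N A (c : R) : (0 <= c)%R ->
  (forall F, N F < +oo -> axb_measurable F -> N (A F) <= c%:E * N F) ->
  opnorm N A <= c%:E.
Proof.
move=> c0 NA; apply: ge_ereal_sup => _ [F [[mF NF] NF1] <-].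
apply: (le_trans (NA _ NF mF)); rewrite -[leRHS]mule1.
by apply: lee_wpmul2l; rewrite ?lee_fin.
Qed.

(** The bound c is attained at F divided by its norm. *)
Lemma opnorm_eq N A (c : R) : (0 <= c)%R -> homogeneous N ->
  (forall F, N (A F) = c%:E * N F) ->
  (exists F, axb_measurable F /\ 0 < N F < +oo) ->
  opnorm N A = c%:E.
Proof.
move=> c0 hN NA [F [mF /andP[F0 Foo]]].
apply/eqP; rewrite eq_le opnorm_le//=; last by move=> G *; rewrite NA.
have [e eE] : exists e : R, N F = e%:E.
  by exists (fine (N F)); rewrite fineK// ge0_fin_numE// ltW.
have e0 : (0 < e)%R by move: F0; rewrite eE lte_fin.
have N1 : N (cscale e^-1 F) = 1.
  by rewrite hN ?invr_gt0// eE -EFinM mulVf// gt_eqF.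
apply: ereal_sup_ubound; exists (cscale e^-1 F); last by rewrite NA N1 mule1.
split; last by rewrite N1.
by split; [exact: axb_measurable_cscale|rewrite N1 ltry].
Qed.

End operators.

Section region_norm.
Local Open Scope ereal_scope.
Context (R : realType) (d : nat).
Notation mu := (lebesgue_rV R d).
Implicit Types (D : set 'rV[R]_d) (f g : 'rV[R]_d -> \bar R).

Definition set_norm D (q : \bar R) f : \bar R :=
  match q with
  | r%:E => (\int[mu]_(z in D) f z `^ r) `^ r^-1
  | _ => ess_sup mu (f \_ D)
  end.

Lemma set_norm_ge0 D q f : (forall x, 0 <= f x) -> 0 <= set_norm D q f.
Proof.
move=> f0; have H : 0 <= ess_sup mu (f \_ D).
  apply: ess_sup_gee; first exact: lebesgue_rV_gt0.
  by apply: nearW => x; apply: erestrict_ge0.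
case: q => [r||]//=; exact: poweR_ge0.
Qed.

Lemma le_set_norm D E q f g : 0 < q -> (forall x, 0 <= f x) -> (forall x, 0 <= g x) ->
  (forall x, D x -> E x /\ f x <= g x) -> set_norm D q f <= set_norm E q g.
Proof.
case: q => [r||]//= r0 f0 g0 fg; last first.
  apply: le_ess_sup; apply: nearW => x; rewrite !patchE.
  case: ifPn => [/set_mem/fg[Ex ?]|_]; first by rewrite mem_set.
  by case: ifPn.
rewrite lte_fin in r0.
apply: le_poweR; first by rewrite invr_ge0 ltW.
  by apply: integral_ge0 => x _; exact: poweR_ge0.
apply: le_integral_sub => [x /fg[]//|x _|x /fg[_ ?]|x _]; try exact: poweR_ge0.
by apply: le_poweR => //; exact: ltW.
Qed.

Lemma set_normZl D q (k : R) f : 0 < q -> (0 < k)%R -> (forall x, 0 <= f x) ->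
  set_norm D q (fun x => k%:E * f x) = k%:E * set_norm D q f.
Proof.
case: q => [r||]//= r0 k0 f0; last by rewrite erestrict_scale -ess_sup_pZl.
rewrite lte_fin in r0.
under eq_integral do rewrite poweRM ?lee_fin ?(ltW k0)// poweR_EFin.
rewrite lower_integralZl ?powR_gt0//; last by move=> *; exact: poweR_ge0.
rewrite poweRM ?lee_fin ?powR_ge0//.
  by rewrite poweR_EFin -powRrM divff ?gt_eqF// powRr1 ?ltW.
by apply: integral_ge0 => x _; exact: poweR_ge0.
Qed.

Lemma set_norm_aff D q (c : 'rV[R]_d) (r : R) f : 0 < q -> (0 < r)%R ->
  (forall x, 0 <= f x) ->
  set_norm (aff c r @^-1` D) q (fun x => f (c + r *: x)%R) =
  (r `^ (- (d%:R * rcp q)))%:E * set_norm D q f.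
Proof.
move=> q0 r0 f0; case: q q0 => [p||]//= p0; last first.
  rewrite mulr0 oppr0 powRr0 mul1e -(lebesgue_rV_ess_sup_aff c (f \_ D) r0).
  by [].
rewrite lte_fin in p0.
rewrite (integral_mkcond D) (integral_mkcond (aff c r @^-1` D)).
pose g := (fun x => f x `^ p) \_ D.
have g0 x : 0 <= g x by apply: erestrict_ge0 => u _; exact: poweR_ge0.
transitivity ((\int[mu]_x g (c + r *: x)%R) `^ p^-1) => //.
rewrite (lebesgue_rV_integral_aff c r0 g0).
rewrite poweRM ?lee_fin ?exprn_ge0 ?invr_ge0 ?(ltW r0)//; last exact: integral_ge0.
congr (_ * _); rewrite poweR_EFin; congr EFin.
by rewrite exprVn -powR_invn ?ltW// -powRrM mulNr.
Qed.

End region_norm.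

Section norms.
Local Open Scope ereal_scope.
Context (R : realType) (d : nat) (p q : \bar R) (s : R).
Hypotheses (p0 : 0 < p) (q0 : 0 < q).
Notation axb_fun := (@axb_fun R d).
Implicit Types (F : axb_fun).

Lemma normLE F : normL s p q F = tnorm d s q (fun t => Lp_norm p (abs_fun F ^~ t)).
Proof. by case: q. Qed.

Lemma normPE a F : normP s a p q F = Lp_norm p (fun x => tnorm d s q (peetre_max a F x)).
Proof. by case: q. Qed.

Definition ball_norm F (x : 'rV[R]_d) (t : R) : \bar R :=
  set_norm (euclid_ball t) q (fun z => abs_fun F (x + z)%R t).

(** The definition of normT integrates |F|^q over the ball without taking the
    root; that integral is the q-th power of the norm over the ball. *)
Lemma normTE F : normT s p q F = Lp_norm p (fun x => tnorm d s q (ball_norm F x)).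
Proof.
rewrite /normT /ball_norm; case: q q0 => [r||]//= r0; rewrite lte_fin in r0.
apply: (@f_equal _ _ (Lp_norm p)); apply/funext => x.
apply: (@f_equal _ _ (fun z : \bar R => z `^ r^-1)); apply: eq_haar_int => t t0.
rewrite poweRVK ?gt_eqF//; apply: integral_ge0 => z _; by rewrite lee_fin powR_ge0.
Qed.

Lemma peetre_max_ge a F x t y :
  abs_fun F (x + y)%R t * (((1 + euclid y / t) `^ a)^-1)%:E <= peetre_max a F x t.
Proof. by apply: ereal_sup_ubound; exists y. Qed.

Lemma peetre_max_ge0 a F x t : 0 <= peetre_max a F x t.
Proof.
apply: le_trans (peetre_max_ge a F x t 0%R).
by rewrite mule_ge0 ?abs_fun_ge0// lee_fin invr_ge0 powR_ge0.
Qed.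

Lemma ball_norm_ge0 F x t : 0 <= ball_norm F x t.
Proof. by apply: set_norm_ge0 => y; exact: abs_fun_ge0. Qed.

Lemma normL_ge0 F : 0 <= normL s p q F.
Proof. by rewrite normLE tnorm_ge0// => t _; exact: Lp_norm_ge0. Qed.

Lemma normT_ge0 F : 0 <= normT s p q F.
Proof. exact: Lp_norm_ge0. Qed.

Lemma normP_ge0 a F : 0 <= normP s a p q F.
Proof. exact: Lp_norm_ge0. Qed.

Lemma normL_homogeneous : homogeneous (@normL R d s p q).
Proof.
move=> k F k0; rewrite !normLE -tnormZl//; last by move=> *; exact: Lp_norm_ge0.
apply: eq_tnorm => t t0; rewrite -Lp_normZl//; apply: (@f_equal _ _ (Lp_norm p)).
by apply/funext => x; rewrite abs_fun_cscale.
Qed.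

Lemma normP_homogeneous a : homogeneous (@normP R d s a p q).
Proof.
move=> k F k0; rewrite !normPE -Lp_normZl//; apply: (@f_equal _ _ (Lp_norm p)).
apply/funext => x; rewrite -tnormZl//; last by move=> *; exact: peetre_max_ge0.
apply: eq_tnorm => t t0; rewrite /peetre_max -ereal_sup_pZl//; congr ereal_sup.
apply/seteqP; split => y [].
  move=> w _ <-; eexists; first by exists w.
  by rewrite abs_fun_cscale// muleA.
by move=> _ [w _ <-] <-; exists w => //; rewrite abs_fun_cscale// muleA.
Qed.

Lemma normT_homogeneous : homogeneous (@normT R d s p q).
Proof.
move=> k F k0; rewrite !normTE -Lp_normZl//; apply: (@f_equal _ _ (Lp_norm p)).
apply/funext => x; rewrite -tnormZl//; last by move=> *; exact: ball_norm_ge0.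
apply: eq_tnorm => t t0; rewrite -set_normZl//; last by move=> *; exact: abs_fun_ge0.
by apply: (@f_equal _ _ (set_norm _ _)); apply/funext => z; rewrite abs_fun_cscale.
Qed.

End norms.

(** * Left translations, and right translations on L and P *)

Section translations.
Local Open Scope ereal_scope.
Context (R : realType) (d : nat) (p q : \bar R) (s : R).
Hypotheses (p0 : 0 < p) (q0 : 0 < q).
Notation axb_fun := (@axb_fun R d).
Implicit Types (F : axb_fun).

Lemma powR_invl (r x : R) : (0 < r -> r^-1 `^ x = r `^ (- x))%R.
Proof. by move=> r0; rewrite -powR_inv1 ?(ltW r0)// -powRrM mulN1r. Qed.

Lemma abs_left z r F x t : abs_fun (left_translation z r F) x t =
  abs_fun F (- (r^-1 *: z) + r^-1 *: x)%R (r^-1 * t)%R.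
Proof.
rewrite /abs_fun /left_translation /= (mulrC t) scalerBr.
by rewrite [(- _ + _)%R]addrC.
Qed.

Lemma abs_right z r F x t : abs_fun (right_translation z r F) x t =
  abs_fun F (x + t *: z)%R (r * t)%R.
Proof. by []. Qed.

(** The affine change of x gives the factor r^(d/p) and the dilation of t gives
    r^(-s-d/q). *)
Lemma Lp_tnorm_left (z : 'rV[R]_d) (r : R) (Phi : 'rV[R]_d -> R -> \bar R) : (0 < r)%R ->
  (forall x t, 0 <= Phi x t) ->
  Lp_norm p (fun x => tnorm d s q
    (fun t => Phi (- (r^-1 *: z) + r^-1 *: x)%R (r^-1 * t)%R)) =
  (r `^ (d%:R * (rcp p - rcp q) - s))%:E * Lp_norm p (fun x => tnorm d s q (Phi x)).
Proof.
move=> r0 P0; have rV : (0 < r^-1)%R by rewrite invr_gt0.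
rewrite (Lp_norm_aff (- (r^-1 *: z))%R
  (fun x => tnorm d s q (fun t => Phi x (r^-1 * t)%R)) p0 rV).
transitivity ((r^-1 `^ (- (d%:R * rcp p)))%:E *
    Lp_norm p (fun x => (r^-1 `^ (s + d%:R * rcp q))%:E * tnorm d s q (Phi x))).
  congr (_ * _); apply: (@f_equal _ _ (Lp_norm p)); apply/funext => x.
  by rewrite (tnorm_dil d s q0 rV (fun t _ => P0 x t)).
rewrite (Lp_normZl (fun x => tnorm d s q (Phi x)) p0 (powR_gt0 _ rV)).
rewrite muleA -EFinM !powR_invl// -powRD; last by rewrite (gt_eqF r0) implybT.
by congr (_%:E * _); congr (_ `^ _)%R; lra.
Qed.

Lemma normL_left z r F : (0 < r)%R -> normL s p q (left_translation z r F) =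
  (r `^ (d%:R * (rcp p - rcp q) - s))%:E * normL s p q F.
Proof.
move=> r0; have rV : (0 < r^-1)%R by rewrite invr_gt0.
rewrite !normLE.
transitivity (tnorm d s q (fun t => (r^-1 `^ (- (d%:R * rcp p)))%:E *
    Lp_norm p (abs_fun F ^~ (r^-1 * t)%R))).
  apply: eq_tnorm => t t0.
  rewrite -(Lp_norm_aff (- (r^-1 *: z))%R (abs_fun F ^~ (r^-1 * t)%R) p0 rV).
  by apply: (@f_equal _ _ (Lp_norm p)); apply/funext => x; rewrite abs_left.
rewrite tnormZl ?powR_gt0//; last by move=> *; exact: Lp_norm_ge0.
rewrite (tnorm_dil d s q0 rV (g := fun t => Lp_norm p (abs_fun F ^~ t))) ; last first.
  by move=> *; exact: Lp_norm_ge0.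
rewrite muleA -EFinM !powR_invl// -powRD; last by rewrite (gt_eqF r0) implybT.
by congr (_%:E * _); congr (_ `^ _)%R; lra.
Qed.

Lemma normL_right z r F : (0 < r)%R -> normL s p q (right_translation z r F) =
  (r `^ (s + d%:R * rcp q))%:E * normL s p q F.
Proof.
move=> r0; rewrite !normLE.
rewrite -(tnorm_dil d s q0 r0 (g := fun t => Lp_norm p (abs_fun F ^~ t))); last first.
  by move=> *; exact: Lp_norm_ge0.
apply: eq_tnorm => t t0.
have := Lp_norm_aff (t *: z) (abs_fun F ^~ (r * t)%R) p0 ltr01.
rewrite powR1 mul1e => <-; apply: (@f_equal _ _ (Lp_norm p)); apply/funext => x.
by rewrite abs_right scale1r addrC.
Qed.

(** The substitution in the ball gives an additional factor r^(d/q), which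
    cancels the one from the dilation of t. *)
Lemma normT_left z r F : (0 < r)%R -> normT s p q (left_translation z r F) =
  (r `^ (d%:R * rcp p - s))%:E * normT s p q F.
Proof.
move=> r0; have rV : (0 < r^-1)%R by rewrite invr_gt0.
have B x t : ball_norm q (left_translation z r F) x t =
    (r `^ (d%:R * rcp q))%:E * ball_norm q F (- (r^-1 *: z) + r^-1 *: x)%R (r^-1 * t)%R.
  have := @set_norm_aff R d (euclid_ball (r^-1 * t)%R) q 0%R r^-1
    (fun w => abs_fun F (- (r^-1 *: z) + r^-1 *: x + w)%R (r^-1 * t)%R) q0 rV
    (fun w => abs_fun_ge0 _ _ _).
  rewrite powR_invl// opprK => <-.
  rewrite (_ : _ @^-1` _ = euclid_ball t); last first.
    apply/seteqP; split => w; rewrite /euclid_ball /= /aff add0r euclidZ ?(ltW rV)//;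
      by rewrite ltr_pM2l.
  apply: (@f_equal _ _ (set_norm _ _)); apply/funext => w.
  by rewrite abs_left add0r scalerDr addrA.
rewrite !normTE//.
pose S x := tnorm d s q (fun t =>
  ball_norm q F (- (r^-1 *: z) + r^-1 *: x)%R (r^-1 * t)%R).
transitivity (Lp_norm p (fun x => (r `^ (d%:R * rcp q))%:E * S x)).
  apply: (@f_equal _ _ (Lp_norm p)); apply/funext => x.
  rewrite -(@tnormZl _ d s q _ (fun t =>
    ball_norm q F (- (r^-1 *: z) + r^-1 *: x)%R (r^-1 * t)%R)) ?powR_gt0//; last first.
    by move=> *; exact: ball_norm_ge0.
  by apply: eq_tnorm => t _; rewrite B.
rewrite (Lp_normZl S p0 (powR_gt0 _ r0)).
have -> : Lp_norm p S = _ := @Lp_tnorm_left z r (ball_norm q F) r0 (ball_norm_ge0 q F).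
rewrite -(normTE _ _ q0) muleA -EFinM -powRD; last by rewrite (gt_eqF r0) implybT.
by congr (_%:E * _); congr (_ `^ _)%R; lra.
Qed.

Lemma normP_left a z r F : (0 < r)%R -> normP s a p q (left_translation z r F) =
  (r `^ (d%:R * (rcp p - rcp q) - s))%:E * normP s a p q F.
Proof.
move=> r0; have rV : (0 < r^-1)%R by rewrite invr_gt0.
rewrite !normPE -(Lp_tnorm_left z r0 (fun x t => peetre_max_ge0 a F x t)).
apply: (@f_equal _ _ (Lp_norm p)); apply/funext => x.
apply: eq_tnorm => t t0; congr ereal_sup; apply/seteqP; split => _ [y _ <-].
  exists (r^-1 *: y) => //; rewrite abs_left scalerDr addrA euclidZ ?(ltW rV)//.
  by rewrite -mulf_div divff ?invr_eq0 ?gt_eqF// mul1r.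
exists (r *: y) => //; rewrite abs_left scalerDr addrA scalerA mulVf ?gt_eqF// scale1r.
by rewrite euclidZ ?(ltW r0)// invfM invrK mulrCA mulrA.
Qed.

(** Pointwise comparison of the maximal functions, from
    1 + |y + t z| / (r t) <= max(1, 1 / r) (1 + |z|) (1 + |y| / t). *)
Lemma normP_right a z r F : (0 < a)%R -> (0 < r)%R ->
  normP s a p q (right_translation z r F) <=
  (r `^ (s + d%:R * rcp q) * Num.max 1 (r `^ (- a)) * (1 + euclid z) `^ a)%:E *
  normP s a p q F.
Proof.
move=> a0 r0; have rV : (0 < r^-1)%R by rewrite invr_gt0.
set k := (Num.max 1 (r `^ (- a)) * (1 + euclid z) `^ a)%R.
have z1 : (0 < 1 + euclid z)%R by rewrite ltr_pwDl// euclid_ge0.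
have k0 : (0 < k)%R by rewrite mulr_gt0 ?powR_gt0// lt_max ltr01.
have step x t : (0 < t)%R ->
    peetre_max a (right_translation z r F) x t <= k%:E * peetre_max a F x (r * t)%R.
  move=> t0; apply: ge_ereal_sup => _ [y _ <-]; rewrite abs_right.
  have tV : (0 < t^-1)%R by rewrite invr_gt0.
  apply: (@le_trans _ _ (k%:E * (abs_fun F (x + (y + t *: z))%R (r * t) *
      (((1 + euclid (y + t *: z) / (r * t)) `^ a)^-1)%:E)%E)); last first.
    by rewrite lee_pmul2l//; exact: peetre_max_ge.
  rewrite muleCA addrA lee_wpmul2l ?abs_fun_ge0// -EFinM lee_fin.
  set Y := euclid y; set W := euclid (y + t *: z)%R.
  have Y0 : (0 <= Y)%R by exact: euclid_ge0.
  have W0 : (0 <= W)%R by exact: euclid_ge0.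
  have WY : (W <= Y + t * euclid z)%R.
    by rewrite -euclidZ ?(ltW t0)//; exact: ler_euclidD.
  have Yt0 : (0 < 1 + Y / t)%R by rewrite ltr_pwDl// divr_ge0// ltW.
  have Wt0 : (0 < 1 + W / (r * t))%R by rewrite ltr_pwDl// divr_ge0 ?mulr_ge0 ?(ltW r0) ?(ltW t0).
  rewrite ler_pdivlMr ?powR_gt0// mulrC ler_pdivrMr ?powR_gt0//.
  have m0 : (0 < Num.max 1 r^-1)%R by rewrite lt_max ltr01.
  have -> : k = ((Num.max 1 r^-1 * (1 + euclid z)) `^ a)%R.
    rewrite powRM ?(ltW m0) ?(ltW z1)//; congr (_ * _)%R.
    rewrite -powR_invl//; have [r1|r1] := leP 1%R (r^-1)%R.
      rewrite max_r//; apply: le_trans (ler_powR r1 (ltW a0)).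
      by rewrite powRr0.
    rewrite powR1 max_l//; apply: (@le_trans _ _ (1 `^ a)%R); last by rewrite powR1.
    by apply: ge0_ler_powR; rewrite ?nnegrE; [exact: ltW|exact: ltW|exact: ler01|exact: ltW].
  rewrite -powRM ?(mulr_ge0 (ltW m0) (ltW z1)) ?(ltW Yt0)//.
  apply: ge0_ler_powR; rewrite ?nnegrE ?(ltW a0) ?(ltW Wt0)//.
    by rewrite !mulr_ge0// ltW.
  have rm : (r^-1 <= Num.max 1 r^-1)%R by rewrite le_max lexx orbT.
  have m1 : (1 <= Num.max 1 r^-1)%R by rewrite le_max lexx.
  move: (Num.max 1 r^-1)%R m0 rm m1 => M M0 rM M1.
  have Wb : (W / (r * t) <= M * (Y / t + euclid z))%R.
    rewrite invfM mulrCA; apply: ler_pM => //; first by rewrite invr_ge0 ltW.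
      by rewrite divr_ge0// ltW.
    by rewrite ler_pdivrMr// mulrDl divfK ?gt_eqF// [(euclid z * t)%R]mulrC.
  have : (0 <= M * (Y / t * euclid z))%R.
    by rewrite !mulr_ge0 ?divr_ge0 ?euclid_ge0// ltW.
  rewrite mulrDr in Wb.
  have -> : (M * (1 + euclid z) * (1 + Y / t) =
    M + M * euclid z + M * (Y / t) + M * (Y / t * euclid z))%R by ring.
  by move=> ?; lra.
have P0 x t : 0 <= peetre_max a F x t by exact: peetre_max_ge0.
rewrite !normPE -mulrA mulrC -/k EFinM -muleA.
rewrite -(Lp_normZl (fun x => tnorm d s q (peetre_max a F x)) p0 (powR_gt0 _ r0)).
rewrite -(Lp_normZl (fun x => _ * tnorm d s q (peetre_max a F x)) p0 k0).
apply: le_Lp_norm => // x.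
  by apply: tnorm_ge0 => t _; exact: peetre_max_ge0.
rewrite -(tnorm_dil d s q0 r0 (fun t _ => P0 x t)).
rewrite -(tnormZl d s q0 k0 (fun t _ => P0 x (r * t)%R)).
apply: le_tnorm => // t t0; first exact: peetre_max_ge0.
exact: step.
Qed.

End translations.

(** * A test function *)

Lemma ess_sup_ge_on d (T : measurableType d) (R : realType)
    (mu : {measure set T -> \bar R}) (A : set T) (f : T -> \bar R) (c : \bar R) :
  measurable A -> (0 < mu A)%E -> (forall x, A x -> (c <= f x)%E) ->
  (c <= ess_sup mu f)%E.
Proof.
move=> mA A0 cf; rewrite leNgt; apply/negP => fc.
have [N [mN N0 subN]] := ess_sup_ge mu f.
have AN : A `<=` N.
  move=> x Ax; apply: subN => /= fx.
  by have := lt_le_trans fc (le_trans (cf _ Ax) fx); rewrite ltxx.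
have : (mu A <= mu N)%E by apply: le_measure; rewrite ?inE.
by rewrite N0 leNgt A0.
Qed.

Section test_function.
Local Open Scope ereal_scope.
Context (R : realType) (d : nat) (p q : \bar R) (s : R).
Hypotheses (p0 : 0 < p) (q0 : 0 < q).
Notation mu := (lebesgue_rV R d).
Notation lam := (@lebesgue_measure R).
Notation I12 := (`[1%R, 2%R]%classic : set R).

Let lamI12 : lam I12 = 1.
Proof. by rewrite lebesgue_measure_itv/= lte_fin ltr1n EFinN -EFinB; congr EFin; lra. Qed.

Let lamI12_gt0 : 0 < lam I12. Proof. by rewrite lamI12. Qed.

Let pow_bounds (sg t : R) : I12 t -> (2 `^ (- `|sg|) <= t `^ sg <= 2 `^ `|sg|)%R.
Proof.
rewrite /= in_itv/= => /andP[t1 t2].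
have t0 : (0 < t)%R by lra.
apply/andP; split.
  apply: (@le_trans _ _ (t `^ (- `|sg|))%R).
    rewrite !powRN lef_pV2 ?posrE ?powR_gt0//.
    by rewrite ge0_ler_powR ?nnegrE// ltW.
  by apply: ler_powR => //; rewrite lerNl -normrN ler_norm.
apply: (@le_trans _ _ (t `^ `|sg|)%R); first by apply: ler_powR => //; exact: ler_norm.
by rewrite ge0_ler_powR ?nnegrE// ltW.
Qed.

Let tau := tnorm d s q (fun t => (\1_I12 t)%:E).

Let tau_bounds : 0 < tau < +oo.
Proof.
rewrite /tau; case: q q0 => [r||]//= r0; last first.
  rewrite /ess_sup_pos; apply/andP; split.
    apply: (@lt_le_trans _ _ ((2 `^ (- `|- s|))%:E)); first by rewrite lte_fin powR_gt0.
    apply: (@ess_sup_ge_on _ _ _ lam (I12 : set (measurableTypeR R))); first exact: measurable_itv.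
      exact: lamI12_gt0.
    move=> t It; have /andP[lb _] := pow_bounds (- s) It.
    rewrite patchE mem_set; last first.
      by move: It; rewrite /= !in_itv/= andbT => /andP[? _]; lra.
    by rewrite indicE mem_set// mule1 lee_fin.
  apply: (@le_lt_trans _ _ ((2 `^ `|- s|)%:E)); last exact: ltry.
  apply/ess_supP; apply: nearW => t; rewrite patchE; case: ifPn => [_|_]; last first.
    by rewrite lee_fin powR_ge0.
  rewrite indicE; case: (boolP (t \in I12)) => [/set_mem It|_].
    by rewrite mule1 lee_fin; have /andP[] := pow_bounds (- s) It.
  by rewrite mule0 lee_fin powR_ge0.
rewrite lte_fin in r0.
pose g t := (t `^ (- (s * r)))%:E * (\1_I12 t)%:E `^ r.
have g0 t : (0 < t)%R -> 0 <= g t.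
  by move=> t0; rewrite mule_ge0 ?lee_fin ?powR_ge0 ?poweR_ge0.
have mI : measurable (I12 : set (measurableTypeR R)) by exact: measurable_itv.
suff /andP[h0 hoo] : 0 < haar_int d g < +oo.
  by rewrite poweR_gt0//= poweR_lty.
set c := (2 `^ `|- (s * r)|)%R.
apply/andP; split.
  apply: (@lt_le_trans _ _ (\int[lam]_(t in I12) (2 `^ (- `|- (s * r)|) * 2 ^- d.+1)%:E)).
    rewrite integral_cst//= [X in _ * X](_ : _ = lam I12)// lamI12 mule1 lte_fin.
    by rewrite mulr_gt0 ?powR_gt0// invr_gt0 exprn_gt0.
  apply: le_integral_sub.
  - by move=> t /=; rewrite !in_itv/= andbT => /andP[? _]; lra.
  - by move=> t _; rewrite lee_fin mulr_ge0 ?powR_ge0// invr_ge0 exprn_ge0.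
  - move=> t It; rewrite /g indicE mem_set//= powR1 mule1 -EFinM lee_fin.
    have /andP[lb _] := pow_bounds (- (s * r)) It.
    move: It; rewrite /= in_itv/= => /andP[t1 t2].
    have t0 : (0 < t)%R by lra.
    apply: ler_pM; [exact: powR_ge0|by rewrite invr_ge0 exprn_ge0|exact: lb|].
    by rewrite lef_pV2 ?posrE ?exprn_gt0// lerXn2r ?nnegrE// ltW.
  - move=> t /=; rewrite in_itv/= andbT => t0.
    by rewrite mule_ge0 ?g0// lee_fin invr_ge0 exprn_ge0// ltW.
apply: (@le_lt_trans _ _ (\int[lam]_(t in I12) c%:E)); last first.
  by rewrite integral_cst//= [X in _ * X](_ : _ = lam I12)// lamI12 mule1 ltry.
rewrite /haar_int [leLHS]integral_mkcond [leRHS]integral_mkcond.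
apply: le_integralT => t.
  apply: erestrict_ge0 => u /=; rewrite in_itv/= andbT => u0.
  by rewrite mule_ge0 ?g0// lee_fin invr_ge0 exprn_ge0// ltW.
rewrite !patchE; case: (boolP (t \in I12)) => [/set_mem It|nI].
  rewrite mem_set; last by move: It; rewrite /= !in_itv/= andbT => /andP[? _]; lra.
  rewrite /g indicE mem_set//= powR1 mule1 -EFinM lee_fin.
  have /andP[_ ub] := pow_bounds (- (s * r)) It.
  move: It; rewrite /= in_itv/= => /andP[t1 t2].
  have t0 : (0 < t)%R by lra.
  rewrite -[leRHS]mulr1; apply: ler_pM; [exact: powR_ge0| |exact: ub|].
    by rewrite invr_ge0 exprn_ge0// ltW.
  by rewrite invf_le1 ?exprn_gt0// exprn_ege1.
case: ifPn => // _; rewrite /g indicE (negbTE nI) /= powR0 ?gt_eqF//.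
by rewrite mule0 mul0e.
Qed.

Let tauE : exists2 e : R, (0 < e)%R & tau = e%:E.
Proof.
have /andP[t0 too] := tau_bounds; exists (fine tau).
  by rewrite fine_gt0// t0.
by rewrite fineK// ge0_fin_numE// ltW.
Qed.

Let Lp_indic (r : R) : (0 < r)%R ->
  0 < Lp_norm p (fun x => (\1_(cube (0%R : 'rV[R]_d) r) x)%:E) < +oo.
Proof.
move=> r0; have mC := measurable_cube (0%R : 'rV[R]_d) r.
have muC : mu (cube 0%R r) = ((r *+ 2) ^+ d)%:E by rewrite lebesgue_rV_cube// ltW.
have muC0 : 0 < mu (cube 0%R r) by rewrite muC lte_fin exprn_gt0// mulrn_wgt0.
rewrite /Lp_norm unlock; case: p p0 => [e||]//= e0; last first.
  rewrite lebesgue_rV_gt0; apply/andP; split.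
    apply: (@lt_le_trans _ _ 1) => //.
    apply: (@ess_sup_ge_on _ _ _ _ _ _ _ mC muC0) => x xC.
    by rewrite /= indicE mem_set// normr1.
  apply: (@le_lt_trans _ _ 1); last exact: ltry.
  apply/ess_supP; apply: nearW => x /=; rewrite lee_fin indicE.
  by case: (x \in _); rewrite ?normr1// normr0.
rewrite lte_fin in e0.
rewrite (_ : \int[mu]_x _ = mu (cube 0%R r)).
  by rewrite poweR_gt0//= poweR_lty// muC ltry.
have e1 x : `|(\1_(cube (0%R : 'rV[R]_d) r) x)%:E| `^ e = (\1_(cube 0%R r) x)%:E.
  rewrite indicE; case: (x \in _) => /=; first by rewrite normr1 powR1.
  by rewrite normr0 powR0// gt_eqF.
transitivity (\int[mu]_x (\1_(cube (0%R : 'rV[R]_d) r) x)%:E).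
  by apply: eq_integral => x _; exact: e1.
by rewrite integral_indic// setIT.
Qed.

Let Lp_indicE (r : R) : (0 < r)%R -> exists2 e : R, (0 < e)%R &
  Lp_norm p (fun x => (\1_(cube (0%R : 'rV[R]_d) r) x)%:E) = e%:E.
Proof.
move=> r0; have /andP[t0 too] := Lp_indic r0; eexists; last first.
  by rewrite -[LHS]fineK// ge0_fin_numE// ltW.
by rewrite fine_gt0// t0.
Qed.

(** The cube is large enough that, at each height t in [1, 2], bump is 1 on the
    whole ball B(x, t) for x in the cube of radius 1. *)
Definition bump : axb_fun R d := fun u =>
  complex.Complex (\1_(cube (0%R : 'rV[R]_d) 4) u.1 * \1_I12 u.2)%R 0%R.

Lemma abs_bump x t : abs_fun bump x t = (\1_(cube 0%R 4) x * \1_I12 t)%:E.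
Proof.
by rewrite /abs_fun /bump /=; congr EFin; rewrite expr0n/= addr0 sqrtr_sqr ger0_norm//.
Qed.

Lemma axb_measurable_bump : axb_measurable bump.
Proof.
have mI : measurable (I12 : set (measurableTypeR R)) by exact: measurable_itv.
split => /=; last exact: measurable_cst.
apply: measurable_funTS; apply: (@measurable_funM _ _ R).
  apply: (measurableT_comp (f := \1_(cube (0%R : 'rV[R]_d) 4) : _ -> R)) => //.
  by apply: measurable_indic; exact: measurable_cube.
by apply: (measurableT_comp (f := \1_I12 : measurableTypeR R -> R)) => //.
Qed.

Lemma normL_bump : 0 < normL s p q bump < +oo.
Proof.
have [k k0 kE] := @Lp_indicE 4 ltac:(by []).
have [e e0 eE] := tauE.
suff -> : normL s p q bump = (k * e)%:E by rewrite lte_fin mulr_gt0//= ltry.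
rewrite normLE EFinM -eE /tau -tnormZl//.
apply: eq_tnorm => t t0; rewrite indicE; case: (boolP (t \in I12)) => tI.
  rewrite mule1 -kE; apply: (@f_equal _ _ (Lp_norm p)); apply/funext => x.
  by rewrite abs_bump (indicE _ I12) tI mulr1.
rewrite mule0 -[RHS](@Lnorm0 _ _ _ mu p); last by rewrite gt_eqF.
apply: (@f_equal _ _ (Lp_norm p)); apply/funext => x.
by rewrite abs_bump (indicE _ I12) (negbTE tI) mulr0.
Qed.

Let tnorm0_le : tnorm d s q (fun=> 0) <= 0.
Proof.
case: q q0 => [r||]//= r0; last first.
  apply/ess_supP; apply: nearW => t; rewrite patchE; case: ifPn => // _.
  by rewrite mule0.
rewrite lte_fin in r0.
rewrite (@eq_haar_int _ d _ (cst 0)) => [|t t0]; last first.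
  by rewrite powR0 ?gt_eqF// mule0.
rewrite /haar_int; under eq_integral do rewrite mul0e.
by rewrite integral0 poweR0r// invr_neq0 ?gt_eqF.
Qed.

Let set_norm0_le (D : set 'rV[R]_d) : set_norm D q (fun=> 0) <= 0.
Proof.
case: q q0 => [r||]//= r0; last first.
  by apply/ess_supP; apply: nearW => w; rewrite patchE; case: ifPn.
rewrite lte_fin in r0; under eq_integral do rewrite powR0 ?gt_eqF//.
by rewrite integral0 poweR0r// invr_neq0 ?gt_eqF.
Qed.

(** Being bounded below on a cube times [1, 2] is enough to be nonzero, whatever
    the exponents are. *)
Lemma bump_lower (Phi : 'rV[R]_d -> R -> \bar R) (m : R) : (0 < m)%R ->
  (forall x t, 0 <= Phi x t) ->
  (forall x t, cube 0%R 1 x -> I12 t -> m%:E <= Phi x t) ->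
  0 < Lp_norm p (fun x => tnorm d s q (Phi x)).
Proof.
move=> m0 P0 Pm; have [k k0 kE] := @Lp_indicE 1 ltac:(by []).
have [e e0 eE] := tauE.
apply: (@lt_le_trans _ _ ((m * e)%:E * k%:E)); first by rewrite -EFinM lte_fin !mulr_gt0.
rewrite -kE -Lp_normZl ?mulr_gt0//; apply: le_Lp_norm => // x.
  by rewrite mule_ge0 ?lee_fin// ltW// mulr_gt0.
rewrite indicE; case: (boolP (x \in _)) => [/set_mem xC|_]; last first.
  by rewrite mule0 tnorm_ge0.
rewrite mule1 EFinM -eE /tau -tnormZl//.
apply: le_tnorm => // t _; first by rewrite mule_ge0 ?lee_fin// ltW.
rewrite indicE; case: (boolP (t \in _)) => [/set_mem tI|_].
  by rewrite mule1 Pm.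
by rewrite mule0.
Qed.

(** Phi x vanishes outside [1, 2], so that no weight in t can make the
    norm infinite. *)
Lemma bump_upper (Phi : 'rV[R]_d -> R -> \bar R) (w : 'rV[R]_d -> R) :
  (forall x t, 0 <= Phi x t) -> (forall x, 0 <= w x)%R ->
  (forall x t, (0 < t)%R -> Phi x t <= (w x * \1_I12 t)%:E) ->
  Lp_norm p (EFin \o w) < +oo ->
  Lp_norm p (fun x => tnorm d s q (Phi x)) < +oo.
Proof.
move=> P0 w0 Pw woo; have [e e0 eE] := tauE.
apply: (@le_lt_trans _ _ (e%:E * Lp_norm p (EFin \o w))); last first.
  move: woo (Lp_norm_ge0 p (EFin \o w)); case: (Lp_norm _ _) => // u _ _.
  by rewrite -EFinM ltry.
rewrite -Lp_normZl//; apply: le_Lp_norm => // x; first exact: tnorm_ge0.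
have [wx0|wx0] := eqVneq (w x) 0%R.
  rewrite /= wx0 mule0; apply: le_trans tnorm0_le.
  by apply: le_tnorm => // t t0; have := Pw x t t0; rewrite wx0 mul0r.
rewrite muleC /= -eE /tau -tnormZl//; last by rewrite lt0r wx0 w0.
by apply: le_tnorm => // t t0; exact: Pw.
Qed.

(** The balls with radius in [1, 2] contain a fixed cube and lie in another, so
    the norms over them are bounded above and below. *)
Lemma normT_bump : (0 < d)%N -> 0 < normT s p q bump < +oo.
Proof.
move=> d0; rewrite normTE//.
have mB : exists2 m : R, (0 < m)%R & m%:E <= set_norm (euclid_ball 1) q (fun _ : 'rV[R]_d => 1).
  pose e : R := (d%:R^-1)%R.
  have e0 : (0 < e)%R by rewrite invr_gt0 ltr0n.
  have sub : cube (0%R : 'rV[R]_d) e `<=` euclid_ball 1.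
    move=> x /(ltr_euclid_cube d0); rewrite subr0 /euclid_ball/= => /lt_le_trans; apply.
    by rewrite /e divff// pnatr_eq0 -lt0n.
  have mC := measurable_cube (0%R : 'rV[R]_d) e.
  have muC : mu (cube 0%R e) = ((e *+ 2) ^+ d)%:E by rewrite lebesgue_rV_cube// ltW.
  have muC0 : 0 < mu (cube 0%R e) by rewrite muC lte_fin exprn_gt0// mulrn_wgt0.
  case: q q0 => [r||]//= r0; last first.
    exists 1%R => //; apply: (@ess_sup_ge_on _ _ _ _ _ _ _ mC muC0) => x xC.
    by rewrite patchE mem_set//; exact: sub.
  rewrite lte_fin in r0.
  exists (((e *+ 2) ^+ d) `^ r^-1)%R; first by rewrite powR_gt0// exprn_gt0// mulrn_wgt0.
  rewrite -poweR_EFin; apply: le_poweR; first by rewrite invr_ge0 ltW.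
    by rewrite lee_fin exprn_ge0// mulrn_wge0// ltW.
  rewrite -muC -[leLHS]mul1e -(integral_cst mu mC).
  by apply: le_integral_sub => // x _ /=; rewrite powR1.
have MB : exists2 M : R, (0 < M)%R & set_norm (euclid_ball 2) q (fun _ : 'rV[R]_d => 1) <= M%:E.
  have sub : euclid_ball 2 `<=` cube (0%R : 'rV[R]_d) 2.
    move=> x; rewrite /euclid_ball/= => x2 i; rewrite mxE subr0.
    exact: le_lt_trans (ler_coord_euclid _ _) x2.
  have mC := measurable_cube (0%R : 'rV[R]_d) 2.
  have muC : mu (cube 0%R 2) = ((2 *+ 2) ^+ d)%:E by rewrite lebesgue_rV_cube.
  case: q q0 => [r||]//= r0; last first.
    exists 1%R => //; apply/ess_supP; apply: nearW => x; rewrite patchE.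
    by case: ifPn.
  rewrite lte_fin in r0.
  exists (((2 *+ 2) ^+ d) `^ r^-1)%R; first by rewrite powR_gt0// exprn_gt0.
  rewrite -[leRHS]poweR_EFin; apply: le_poweR; first by rewrite invr_ge0 ltW.
    by apply: integral_ge0 => x _; rewrite lee_fin powR_ge0.
  rewrite -muC -[leRHS]mul1e -(integral_cst mu mC).
  by apply: le_integral_sub => // x _ /=; rewrite powR1.
have [m m0 mP] := mB; have [M M0 MP] := MB.
have B0 x t : 0 <= ball_norm q bump x t by exact: ball_norm_ge0.
apply/andP; split.
  apply: (bump_lower m0) => // x t xC tI.
  apply: (le_trans mP); apply: le_set_norm => //; first by move=> w; exact: abs_fun_ge0.
  move=> w wB; have [t1 t2] : (1 <= t /\ t <= 2)%R.
    by move: tI; rewrite /= in_itv/= => /andP[].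
  split; first by apply: lt_le_trans t1.
  rewrite abs_bump indicE mem_set ?indicE ?mem_set ?mulr1// => i.
  rewrite !mxE subr0; apply: le_lt_trans (ler_normD _ _) _.
  have := xC i; rewrite mxE subr0 => ?.
  have := ler_coord_euclid w i; move: wB; rewrite /euclid_ball/= => ? ?; lra.
apply: (bump_upper (w := fun x => M * \1_(cube 0%R 6) x)%R) => //.
- by move=> x; rewrite mulr_ge0// ltW.
- move=> x t t0; rewrite (indicE _ I12); case: (boolP (t \in I12)) => [/set_mem tI|tI]; last first.
    rewrite mulr0; apply: le_trans (set_norm0_le (euclid_ball t)).
    apply: le_set_norm => // [w|w wB]; first exact: abs_fun_ge0.
    by split => //; rewrite abs_bump (indicE _ I12) (negbTE tI) mulr0.
  have [t1 t2] : (1 <= t /\ t <= 2)%R by move: tI; rewrite /= in_itv/= => /andP[].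
  rewrite mulr1 indicE; case: (boolP (x \in cube 0%R 6)) => [_|nx].
    rewrite mulr1; apply: le_trans MP; apply: le_set_norm => // [w|w wB].
      exact: abs_fun_ge0.
    split; first by apply: lt_le_trans t2.
    rewrite abs_bump lee_fin mulr_ile1// ?indicE ?lern1 ?leq_b1//.
  rewrite mulr0; apply: le_trans (set_norm0_le (euclid_ball t)).
  apply: le_set_norm => // [w|w wB]; first exact: abs_fun_ge0.
  split => //; rewrite abs_bump (indicE _ (cube 0%R 4)) memNset ?mul0r// => xw.
    move/negP : nx; apply; rewrite inE => i; rewrite mxE subr0.
    have := xw i; rewrite !mxE subr0 => h.
    have := ler_coord_euclid w i; move: wB; rewrite /euclid_ball/= => ? ?.
    have := ler_normB (x 0%R i + w 0%R i)%R (w 0%R i); rewrite addrK => ?; lra.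
- have [k k0 kE] := @Lp_indicE 6 ltac:(by []).
  rewrite (_ : _ \o _ = fun x => M%:E * (\1_(cube 0%R 6) x)%:E); last first.
    by apply/funext => x; rewrite /= EFinM.
  by rewrite Lp_normZl// kE -EFinM ltry.
Qed.

End test_function.

Section decay.
Local Open Scope ereal_scope.
Context (R : realType) (d : nat).
Notation mu := (lebesgue_rV R d).

Lemma dyadic_bracket (u : R) : (1 <= u)%R -> exists k : nat, (2 ^+ k <= u < 2 ^+ k.+1)%R.
Proof.
move=> u1; have ex : exists n, (u < 2 ^+ n)%R.
  exists (Num.bound u); apply: (lt_trans (archi_boundP _)); first lra.
  by rewrite -natrX ltr_nat; exact: ltn_expl.
case: (ex_minnP ex) => -[|k] ku kmin; first by move: ku; rewrite expr0; lra.
exists k; rewrite ku andbT leNgt; apply/negP => /kmin.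
by rewrite ltnn.
Qed.

(** On the shell 2^k <= 1 + |x| < 2^(k+1) the integrand is at most 2^(-b k), and
    the volume is at most a multiple of 2^(d k); the resulting geometric series
    has ratio 2^(d-b). *)
Lemma integral_decay (b : R) : (d%:R < b)%R ->
  \int[mu]_x ((1 + euclid x) `^ (- b))%:E < +oo.
Proof.
move=> db; have b0 : (0 <= b)%R by apply: le_trans (ltW db).
pose c k : R := ((2 ^+ k) `^ (- b))%R.
have c0 k : (0 <= c k)%R by exact: powR_ge0.
pose f k (x : 'rV[R]_d) := (c k * \1_(cube 0%R (2 ^+ k.+1)) x)%:E.
have f0 k x : 0 <= f k x by rewrite lee_fin mulr_ge0.
apply: (@le_lt_trans _ _ (\int[mu]_x \sum_(k <oo) f k x)).
  apply: le_integralT => x; first by rewrite lee_fin powR_ge0.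
  have e0 := euclid_ge0 x.
  have [|k /andP[k1 k2]] := @dyadic_bracket (1 + euclid x)%R; first by rewrite lerDl.
  apply: (@le_trans _ _ (f k x)); last first.
    apply: (@le_trans _ _ (\sum_(0 <= i < k.+1) f i x)).
      by rewrite big_nat_recr//= leeDr// sume_ge0.
    exact: nneseries_lim_ge.
  rewrite /f indicE mem_set ?mulr1 ?lee_fin; last first.
    move=> i; rewrite mxE subr0; apply: le_lt_trans (ler_coord_euclid x i) _.
    by apply: le_lt_trans k2; rewrite lerDr.
  rewrite /c !powRN lef_pV2 ?posrE ?powR_gt0 ?exprn_gt0//; last by rewrite ltr_pwDl.
  by rewrite ge0_ler_powR ?nnegrE ?exprn_ge0// addr_ge0.
rewrite integral_nneseries//; last first.
  move=> k; apply/measurable_EFinP; apply: measurable_funM => //.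
  by apply: measurable_indic; exact: measurable_cube.
pose zz : R := (2 `^ (d%:R - b))%R.
have zz0 : (0 < zz)%R by exact: powR_gt0.
have zz1 : (zz < 1)%R.
  rewrite lt_neqAle; apply/andP; split.
    by rewrite powR_eq1 !negb_or pnatr_eq1/= subr_eq0 lt_eqF// andbT -leNgt.
  by rewrite -[leRHS](powRr0 2); apply: ler_powR; [rewrite ler1n|rewrite subr_le0 ltW].
have fE k : \int[mu]_x f k x = (geometric (4 ^+ d) zz k)%:E.
  rewrite /f; under eq_integral do rewrite EFinM.
  rewrite ge0_integralZl_EFin//; last first.
    by apply/measurable_EFinP; apply: measurable_indic; exact: measurable_cube.
  rewrite integral_indic//; last exact: measurable_cube.
  rewrite setIT; transitivity ((c k)%:E * ((2 ^+ k.+1 *+ 2) ^+ d)%:E).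
    by congr (_ * _); exact: lebesgue_rV_cube.
  have zzk : (zz ^+ k = c k * (2 ^+ k) ^+ d)%R.
    rewrite -(powR_mulrn k (ltW zz0)) /zz powRAC powR_mulrn//.
    rewrite -(powR_mulrn d) ?exprn_ge0// mulrC -powRD//.
    by rewrite (gt_eqF (exprn_gt0 k _)) ?implybT.
  rewrite -EFinM; congr EFin; rewrite /geometric/= zzk.
  have -> : (2 ^+ k.+1 *+ 2 = 4 * 2 ^+ k :> R)%R by rewrite exprS; ring.
  by rewrite exprMn mulrCA.
apply: (@le_lt_trans _ _ (4 ^+ d * (1 - zz)^-1)%:E); last exact: ltry.
apply: lime_le.
  apply: is_cvg_nneseries => n _ _; apply: integral_ge0 => x _; exact: f0.
apply: nearW => n; rewrite (eq_bigr (fun k => (geometric (4 ^+ d) zz k)%:E)) => [|k _]; last first.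
  exact: fE.
rewrite sumEFin lee_fin; apply: geometric_le_lim => //.
by rewrite ger0_norm// ltW.
Qed.

End decay.

Section bump_peetre.
Local Open Scope ereal_scope.
Context (R : realType) (d : nat) (p q : \bar R) (s a : R).
Hypotheses (d0 : (0 < d)%N) (p0 : 0 < p) (q0 : 0 < q).

(** For t in [1, 2] the Peetre maximal function of bump at x is at most a
    multiple of (1 + |x|)^-a, which is in L_p as d / p < a. *)
Lemma normP_bump : (d%:R * rcp p < a)%R -> 0 < normP s a p q (@bump R d) < +oo.
Proof.
move=> da; rewrite normPE.
have rp0 : (0 <= rcp p)%R.
  by case: p p0 => [r||]//= r0; rewrite invr_ge0 ltW.
have a0 : (0 < a)%R by apply: le_lt_trans da; rewrite mulr_ge0.
have P0 x t : 0 <= peetre_max a (@bump R d) x t by exact: peetre_max_ge0.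
apply/andP; split.
  apply: (@bump_lower R d p q s p0 q0 _ 1%R ltr01) => // x t xC tI.
  apply: le_trans (peetre_max_ge a (@bump R d) x t 0%R).
  rewrite addr0 abs_bump /euclid (eq_bigr (fun=> 0%R)) => [|i _]; last first.
    by rewrite mxE expr0n.
  rewrite sumr_const mul0rn sqrtr0 mul0r addr0 powR1 invr1 mule1 lee_fin.
  rewrite indicE mem_set ?indicE ?mem_set ?mulr1// => i.
  by apply: lt_le_trans (xC i) _; rewrite ler1n.
pose K : R := (2 * (1 + d%:R * 4))%R.
have d4 : (0 <= d%:R * 4 :> R)%R by rewrite mulr_ge0.
have K0 : (0 < K)%R by rewrite /K; lra.
have K1 : (1 <= K)%R by rewrite /K; lra.
have e1 x : (0 < 1 + euclid x :> R)%R by rewrite ltr_pwDl// euclid_ge0.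
apply: (@bump_upper R d p q s p0 q0 _ (fun x => K `^ a * (1 + euclid x) `^ (- a))%R) => //.
- by move=> x; rewrite mulr_ge0 ?powR_ge0.
- move=> x t t0; apply: ge_ereal_sup => _ [y _ <-].
  rewrite abs_bump -EFinM lee_fin mulrAC (indicE _ (`[1%R, 2%R]%classic : set R)).
  case: (boolP (t \in _)) => [/set_mem tI|_]; last by rewrite !mulr0.
  rewrite !mulr1 indicE; case: (boolP (_ \in _)) => [/set_mem xy|_]; last first.
    by rewrite mul0r mulr_ge0 ?powR_ge0.
  have [t1 t2] : (1 <= t /\ t <= 2)%R by move: tI; rewrite /= in_itv/= => /andP[].
  have y0 : (0 <= euclid y)%R by exact: euclid_ge0.
  have yt0 : (0 <= euclid y / t)%R by rewrite divr_ge0// ltW.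
  have yt1 : (0 < 1 + euclid y / t)%R by rewrite ltr_pwDl.
  rewrite mul1r powRN ler_pdivlMr ?powR_gt0// mulrC ler_pdivrMr ?powR_gt0//.
  rewrite -powRM ?(ltW K0) ?(ltW yt1)//.
  apply: ge0_ler_powR; rewrite ?nnegrE; [exact: ltW|exact/ltW/e1| |].
    by apply: mulr_ge0; exact: ltW.
  have xy4 : (euclid (x + y) < d%:R * 4)%R.
    by have := ltr_euclid_cube d0 xy; rewrite subr0.
  have xle : (euclid x <= euclid (x + y) + euclid y)%R.
    by have := ler_euclidD (x + y) (- y); rewrite addrK euclidN.
  have y2 : (euclid y <= 2 * (euclid y / t))%R.
    by rewrite mulrA ler_pdivlMr// mulrC ler_wpM2r.
  have h := mulr_ge0 d4 yt0; rewrite /K; lra.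
rewrite (_ : _ \o _ = fun x => (K `^ a)%:E * ((1 + euclid x) `^ (- a))%:E); last first.
  by apply/funext => x; rewrite /= EFinM.
rewrite (Lp_normZl (fun x : 'rV[R]_d => ((1 + euclid x) `^ (- a))%:E) p0 (powR_gt0 a K0)).
suff : Lp_norm p (fun x : 'rV[R]_d => ((1 + euclid x) `^ (- a))%:E) < +oo.
  move: (Lp_norm_ge0 p (fun x : 'rV[R]_d => ((1 + euclid x) `^ (- a))%:E)).
  by case: (Lp_norm _ _) => // u _ _; rewrite -EFinM ltry.
rewrite /Lp_norm unlock; case: p p0 da => [e||]//= ep da'; last first.
  rewrite lebesgue_rV_gt0; apply: (@le_lt_trans _ _ 1); last exact: ltry.
  apply/ess_supP; apply: nearW => x /=; rewrite lee_fin ger0_norm ?powR_ge0//.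
  rewrite powRN invf_le1 ?powR_gt0// -[leLHS](powRr0 (1 + euclid x)).
  by apply: ler_powR; [rewrite lerDl euclid_ge0|exact: ltW].
rewrite lte_fin in ep.
apply: poweR_lty; have := @integral_decay R d (a * e).
rewrite -ltr_pdivrMr// => /(_ da'); apply: le_lt_trans.
apply: le_integralT => x; first by rewrite lee_fin powR_ge0.
by rewrite /= ger0_norm ?powR_ge0// -powRrM mulNr.
Qed.

End bump_peetre.

(** * Boxes of diameter comparable to their height *)

Section boxes.
Context (R : realType) (d : nat).
Notation HS := ('rV[R]_d * measurableTypeR R)%type.

Let J := (int * {ffun 'I_d -> int})%type.

(** Side of the boxes at heights between 2^k and 2^(k+1).  The factor d + 1
    makes the diameter of a box smaller than its height. *)
Definition box_side (k : int) : R := 2 `^ k%:~R / d.+1%:R.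

Lemma box_side_gt0 k : 0 < box_side k.
Proof. by rewrite divr_gt0 ?powR_gt0. Qed.

Definition box_index (u : HS) : J :=
  let k := Num.floor (ln u.2 / ln 2) in
  (k, [ffun i => Num.floor (u.1 0 i / box_side k)]).

Definition box (n : nat) : set HS := [set u | 0 < u.2 /\ pickle (box_index u) = n].

(** Half of the side.  A number that is not the code of an index belongs to an
    empty box; the value 1 keeps the radius positive in that case too. *)
Definition box_radius (n : nat) : R :=
  if (unpickle n : option J) is Some (k, m) then box_side k / 2 else 1.

Definition box_center (n : nat) : 'rV[R]_d :=
  if (unpickle n : option J) is Some (k, m) then
    \row_i (((m i)%:~R + 2^-1) * box_side k) else 0.

Lemma box_radius_gt0 n : 0 < box_radius n.
Proof.
rewrite /box_radius; case: (unpickle n) => [[k m]|//].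
by rewrite divr_gt0 ?box_side_gt0.
Qed.

Lemma box_time (n : nat) (u : HS) : box n u ->
  2 * d.+1%:R * box_radius n <= u.2 < 4 * d.+1%:R * box_radius n.
Proof.
move=> [u0 <-]; rewrite /box_radius pickleK /box_index/=.
set k := Num.floor _.
have D0 : d.+1%:R != 0 :> R by rewrite pnatr_eq0.
have l2 : 0 < ln 2 :> R by apply: ln_gt0; rewrite ltr1n.
have uE : u.2 = 2 `^ (ln u.2 / ln 2).
  by rewrite /powR gt_eqF// divfK ?gt_eqF// lnK// posrE.
have /andP[k1 k2] := floor_itv (ln u.2 / ln 2).
have -> : 2 * d.+1%:R * (box_side k / 2) = 2 `^ k%:~R.
  rewrite /box_side; move: (d.+1%:R) D0 => D D0; by field.
have -> : 4 * d.+1%:R * (box_side k / 2) = 2 * 2 `^ k%:~R.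
  rewrite /box_side; move: (d.+1%:R) D0 => D D0; by field.
rewrite {1 2}uE; apply/andP; split; first by apply: ler_powR => //; rewrite ler1n.
have -> : 2 * 2 `^ k%:~R = 2 `^ (1 + k%:~R) :> R.
  by rewrite powRD ?powRr1// pnatr_eq0 implybT.
rewrite -(ltr_pM2l l2) in k2.
rewrite /powR pnatr_eq0/= ltr_expR ltr_pM2r//.
by move: k2; rewrite ltr_pM2l// intrD addrC.
Qed.

Lemma box_space (n : nat) (u : HS) i : box n u ->
  `|u.1 0 i - box_center n 0 i| <= box_radius n.
Proof.
move=> [u0 <-]; rewrite /box_radius /box_center pickleK /box_index/=.
set k := Num.floor _; rewrite !mxE ffunE.
have l0 := box_side_gt0 k.
have /andP[m1 m2] := floor_itv (u.1 0 i / box_side k).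
move: m1 m2; rewrite ler_pdivlMr// ltr_pdivrMr// intrD.
set M := (Num.floor _)%:~R; rewrite mulrDl mul1r mulrDl => ? ?.
by rewrite ler_norml; apply/andP; split; lra.
Qed.

(** Lower half of the squeeze.  A box and its cube have the same centre, so two
    of their points differ by less than two radii in each coordinate, and d
    times this is below the height. *)
Lemma box_sub_ball (n : nat) (u : HS) (x : 'rV[R]_d) : (0 < d)%N -> box n u ->
  cube (box_center n) (1 * box_radius n) x -> euclid (u.1 - x) < u.2.
Proof.
move=> d0 un xn.
have r0 := box_radius_gt0 n.
have : cube x (2 * box_radius n) u.1.
  move=> i; have := box_space i un; have := xn i; rewrite mul1r.
  rewrite ltr_norml ler_norml ltr_norml => /andP[? ?] /andP[? ?].
  by apply/andP; split; lra.
move=> /(ltr_euclid_cube d0) /lt_le_trans; apply.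
have /andP[+ _] := box_time un; apply: le_trans.
rewrite mulrCA mulrA ler_pM2r// ler_pM2l// ler_nat.
by [].
Qed.

(** Of the factor 5, a factor 4 comes from the height of a box in terms of its
    radius, and the rest covers the width of the box itself. *)
Definition box_aperture (l : R) : R := 5 * d.+1%:R * l.

(** Upper half of the squeeze, by the triangle inequality: x is at distance less
    than l t from a point that is within one radius of the centre in each
    coordinate. *)
Lemma box_near_ball (n : nat) (u : HS) (x : 'rV[R]_d) (l : R) : 1 <= l -> box n u ->
  euclid (u.1 - x) < l * u.2 -> cube (box_center n) (box_aperture l * box_radius n) x.
Proof.
move=> l1 un ux i.
have r0 := box_radius_gt0 n.
have := box_space i un; have /andP[_ u4] := box_time un.
have : `|u.1 0 i - x 0 i| < l * u.2.
  by apply: le_lt_trans ux; have := ler_coord_euclid (u.1 - x) i; rewrite !mxE.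
have : l * u.2 < l * (4 * d.+1%:R * box_radius n) by rewrite ltr_pM2l//; lra.
have D1 : 1 <= d.+1%:R :> R by rewrite ler1n.
have : box_radius n <= l * (d.+1%:R * box_radius n).
  by rewrite mulrA ler_peMl ?(ltW r0)// mulr_ege1.
rewrite /box_aperture (_ : 5 * d.+1%:R * l * _ =
  l * (4 * d.+1%:R * box_radius n) + l * (d.+1%:R * box_radius n)); last by ring.
rewrite !ltr_norml ler_norml => ? ? /andP[? ?] /andP[? ?].
by apply/andP; split; lra.
Qed.

Let measurable_floor d' (T : measurableType d') (f : T -> measurableTypeR R) (k : int) :
  measurable_fun setT f -> measurable [set v | Num.floor (f v) = k].
Proof.
move=> mf; rewrite (_ : [set v | _] = setT `&` f @^-1` `[k%:~R, (k + 1)%:~R[%classic).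
  by apply: mf => //; exact: measurable_itv.
rewrite setTI; apply/seteqP; split => v /=; rewrite in_itv/=.
  by move=> <-; exact: floor_itv.
by move=> h; exact: floor_def.
Qed.

Lemma measurable_box n : measurable (box n).
Proof.
have [[j [Ej nE]]|H] := pselect (exists j : J, True /\ pickle j = n); last first.
  rewrite (_ : box n = set0)//; apply/seteqP; split => // u [_ un].
  by apply: H; exists (box_index u).
case: j nE Ej => k m nE _.
rewrite (_ : box n = @axb_group R d `&` ([set u | Num.floor (ln u.2 / ln 2) = k] `&`
   \bigcap_(i in [set: 'I_d]) [set u : HS | Num.floor (u.1 0 i / box_side k) = m i])).
  apply: measurableI; first exact: measurable_axb_group.
  apply: measurableI.
    apply: measurable_floor; apply: (@measurable_funM _ _ R) => //.
    exact: (measurableT_comp (@measurable_ln R) measurable_snd).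
  apply: fin_bigcap_measurable => // i _; apply: measurable_floor.
  apply: (@measurable_funM _ _ R) => //.
  exact: (measurableT_comp (measurable_rV_coord i) measurable_fst).
apply/seteqP; split => u.
  move=> [u0]; rewrite -nE => /(pcan_inj pickleK) uE.
  have E1 := congr1 fst uE; have E2 := congr1 snd uE; rewrite /= in E1 E2.
  by split => //; split => // i _ /=; rewrite -E2 ffunE E1.
move=> [u0 [/= uk um]]; split => //; rewrite -nE; congr pickle.
rewrite /box_index /= uk; congr pair; apply/ffunP => i; rewrite ffunE.
by have := um i I.
Qed.

End boxes.

(** * Change of aperture *)

Lemma nneseries_single (R : realType) (f : nat -> \bar R) (n : nat) :
  (0 <= f n)%E -> (forall k, k != n -> f k = 0%E) -> (\sum_(k <oo) f k = f n)%E.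
Proof.
move=> fn0 fk; have f0 k : (0 <= f k)%E by have [->//|/fk ->] := eqVneq k n.
rewrite (@nneseriesD1 _ _ n)//= eseries0 ?adde0// => i _ /=; exact: fk.
Qed.

Section discretization.
Local Open Scope ereal_scope.
Context (R : realType) (d : nat) (s : R).
Hypothesis d0 : (0 < d)%N.
Notation mu := (lebesgue_rV R d).
Notation lam := (@lebesgue_measure R).
Notation HS := ('rV[R]_d * measurableTypeR R)%type.
Variable (F : axb_fun R d).
Hypothesis mF : axb_measurable F.

(** The norm at height t over the cone with vertex x and aperture l. *)
Definition wide_norm (q : \bar R) (l : R) (x : 'rV[R]_d) (t : R) : \bar R :=
  set_norm (euclid_ball (l * t)%R) q (fun z => abs_fun F (x + z)%R t).

Lemma wide_norm_ge0 q l x t : 0 <= wide_norm q l x t.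
Proof. by apply: set_norm_ge0 => y; exact: abs_fun_ge0. Qed.

(** |F| is measurable only on the half-space; extended by 0 it is measurable on
    the whole product, as Tonelli's theorem requires. *)
Let g : HS -> R := (fun u => complex.ComplexField.Normc.normc (F u)) \_ (@axb_group R d).

Let g_abs y t : (0 < t)%R -> abs_fun F y t = (g (y, t))%:E.
Proof. by move=> t0; rewrite /g patchE mem_set. Qed.

Let g_ge0 u : (0 <= g u)%R.
Proof.
rewrite /g patchE; case: ifPn => // _.
by rewrite /complex.ComplexField.Normc.normc; case: (F u) => *; exact: sqrtr_ge0.
Qed.

Let measurable_g : measurable_fun [set: HS] g.
Proof.
apply/(measurable_restrictT _ (@measurable_axb_group R d)).
have [mRe mIm] := mF.
apply: (eq_measurable_fun (fun u =>
  (complex.Re (F u) ^+ 2 + complex.Im (F u) ^+ 2) `^ 2^-1)%R).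
  move=> u _; rewrite powR12_sqrt ?addr_ge0 ?sqr_ge0//.
  by rewrite /complex.ComplexField.Normc.normc; case: (F u).
apply: (measurableT_comp (measurable_powR 2^-1)).
by apply: (@measurable_funD _ _ R); exact: (@measurable_funX _ _ R).
Qed.

Let in_box n (u : HS) : R := \1_(box n) u.

Let b (l : R) n (x : 'rV[R]_d) : R :=
  \1_(cube (@box_center R d n) (box_aperture d l * box_radius R d n)) x.

Let b1 n (x : 'rV[R]_d) : R :=
  \1_(cube (@box_center R d n) (1 * box_radius R d n)) x.

Section finite_exponent.
Variable r : R.
Hypothesis r0 : (0 < r)%R.

Let hterm n (u : HS) : \bar R := (in_box n u * g u `^ r)%:E.

Let hterm_ge0 n u : 0 <= hterm n u.
Proof. by rewrite lee_fin mulr_ge0 ?powR_ge0. Qed.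

Let measurable_hterm n : measurable_fun [set: HS] (hterm n).
Proof.
apply/measurable_EFinP; apply: measurable_funM.
  by apply: measurable_indic; exact: measurable_box.
exact: (measurableT_comp (measurable_powR r) measurable_g).
Qed.

Let measurable_hsect n (t : R) :
  measurable_fun [set: 'rV[R]_d] (fun y => hterm n (y, t)).
Proof. exact: (measurable_fun_pair1 (t : measurableTypeR R) (measurable_hterm n)). Qed.

Let h n (t : R) : \bar R := \int[mu]_y hterm n (y, t).

Let h_ge0 n t : 0 <= h n t. Proof. exact: integral_ge0. Qed.

Let measurable_h n : measurable_fun [set: measurableTypeR R] (h n).
Proof. exact: (measurable_fun_fubini_tonelli_G (m1 := mu)). Qed.

(** Every point of the ball lies in some box, and the cube of that box, dilated,
    contains x. *)
Let wide_le (l t : R) x : (1 <= l)%R -> (0 < t)%R ->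
  \int[mu]_(z in euclid_ball (l * t)%R) abs_fun F (x + z)%R t `^ r <=
  \sum_(n <oo) (b l n x)%:E * h n t.
Proof.
move=> l1 t0.
pose K (y : 'rV[R]_d) : \bar R :=
  if (euclid (y - x) < l * t)%R then (g (y, t) `^ r)%:E else 0.
have K0 y : 0 <= K y by rewrite /K; case: ifPn => // _; rewrite lee_fin powR_ge0.
have -> : \int[mu]_(z in euclid_ball (l * t)%R) abs_fun F (x + z)%R t `^ r =
    \int[mu]_z K (x + 1 *: z)%R.
  rewrite integral_mkcond; apply: eq_integral => z _.
  rewrite patchE /K scale1r [(x + z)%R]addrC addrK.
  have [zb|zb] := boolP (euclid z < l * t)%R; first by rewrite mem_set// g_abs.
  by rewrite memNset//; exact/negP.
rewrite (lebesgue_rV_integral_aff x ltr01 K0) invr1 expr1n mul1e.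
have -> : \sum_(n <oo) (b l n x)%:E * h n t =
    \int[mu]_y \sum_(n <oo) ((b l n x)%:E * hterm n (y, t)).
  rewrite integral_nneseries//; last 2 first.
  - move=> n; apply: measurable_funeM.
    exact: measurable_hsect.
  - by move=> n y _; rewrite mule_ge0// lee_fin.
  apply: eq_eseriesr => n _; apply/esym.
  exact: (@ge0_integralZl_EFin _ _ _ mu _ measurableT _
    (fun y _ => hterm_ge0 n (y, t)) (measurable_hsect n t)).
apply: le_integralT => // y; rewrite /K; case: ifPn => yx; last first.
  by apply: nneseries_ge0 => n _ _; rewrite mule_ge0// lee_fin.
pose n := pickle (box_index ((y, t) : HS)).
have yn : box n ((y, t) : HS) by split.
apply: (@le_trans _ _ ((b l n x)%:E * hterm n (y, t))).
  rewrite /hterm /in_box /b !indicE !mem_set ?mul1e ?mul1r//.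
  exact: box_near_ball l1 yn yx.
apply: (@le_trans _ _ (\sum_(0 <= i < n.+1) (b l i x)%:E * hterm i (y, t))).
  rewrite big_nat_recr//= leeDr// sume_ge0// => i _.
  by rewrite mule_ge0// lee_fin.
by apply: nneseries_lim_ge => i _; rewrite mule_ge0// lee_fin.
Qed.

(** The boxes whose cubes contain x have disjoint sections at height t, all of
    them inside the ball. *)
Let wide_ge (t : R) x : (0 < t)%R ->
  \sum_(n <oo) (b1 n x)%:E * h n t <=
  \int[mu]_(z in euclid_ball (1 * t)%R) abs_fun F (x + z)%R t `^ r.
Proof.
move=> t0.
pose K (y : 'rV[R]_d) : \bar R :=
  if (euclid (y - x) < t)%R then (g (y, t) `^ r)%:E else 0.
have K0 y : 0 <= K y by rewrite /K; case: ifPn => // _; rewrite lee_fin powR_ge0.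
have -> : \int[mu]_(z in euclid_ball (1 * t)%R) abs_fun F (x + z)%R t `^ r =
    \int[mu]_z K (x + 1 *: z)%R.
  rewrite integral_mkcond; apply: eq_integral => z _.
  rewrite patchE /K scale1r mul1r [(x + z)%R]addrC addrK.
  have [zb|zb] := boolP (euclid z < t)%R; first by rewrite mem_set// g_abs.
  by rewrite memNset//; exact/negP.
rewrite (lebesgue_rV_integral_aff x ltr01 K0) invr1 expr1n mul1e.
have -> : \sum_(n <oo) (b1 n x)%:E * h n t =
    \int[mu]_y \sum_(n <oo) ((b1 n x)%:E * hterm n (y, t)).
  rewrite integral_nneseries//; last 2 first.
  - move=> n; apply: measurable_funeM.
    exact: measurable_hsect.
  - by move=> n y _; rewrite mule_ge0// lee_fin.
  apply: eq_eseriesr => n _; apply/esym.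
  exact: (@ge0_integralZl_EFin _ _ _ mu _ measurableT _
    (fun y _ => hterm_ge0 n (y, t)) (measurable_hsect n t)).
apply: le_integralT => y.
  by apply: nneseries_ge0 => n _ _; rewrite mule_ge0// lee_fin.
pose n := pickle (box_index ((y, t) : HS)).
have yn : box n ((y, t) : HS) by split.
rewrite (nneseries_single (n := n)); last 2 first.
- by rewrite mule_ge0// lee_fin.
- move=> k /eqP kn; rewrite /hterm /in_box indicE memNset ?mul0r ?mule0// => -[_ kE].
  by apply: kn; rewrite /n kE.
rewrite /hterm /in_box [in X in _ * X]indicE mem_set// mul1r /b1 indicE.
case: (boolP (x \in _)) => [/set_mem xn|_]; last by rewrite mul0e.
rewrite mul1e /K ifT//.
exact: box_sub_ball d0 yn xn.
Qed.

Let v (t : R) : R := (t `^ (- (s * r)) * t `^ (- d.+1%:R))%R.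

(** The mass that the box contributes to the norm of T. *)
Definition box_int n := haar_int d (fun t => (t `^ (- (s * r)))%:E * h n t).

Lemma box_int_ge0 n : 0 <= box_int n.
Proof. by apply: haar_int_ge0 => t t0; rewrite mule_ge0 ?lee_fin ?powR_ge0. Qed.

(** The boxes are measurable, so that sum and integral can be exchanged here,
    unlike for the cone functionals that they are compared with. *)
Let haar_series (c : nat -> R) : (forall n, 0 <= c n)%R ->
  haar_int d (fun t => (t `^ (- (s * r)))%:E * \sum_(n <oo) (c n)%:E * h n t) =
  \sum_(n <oo) box_int n * (c n)%:E.
Proof.
move=> c0.
have v0 t : (0 <= v t)%R by rewrite mulr_ge0 ?powR_ge0.
have haarE k : haar_int d (fun t => (t `^ (- (s * r)))%:E * k t) =
    \int[lam]_(t in `]0%R, +oo[) ((v t)%:E * k t).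
  apply: eq_integral => t; rewrite inE/= in_itv/= andbT => t0.
  by rewrite muleAC -EFinM /v powR_invn ?ltW.
have mv : measurable_fun [set: measurableTypeR R] v.
  by apply: (@measurable_funM _ _ R); exact: measurable_powR.
rewrite haarE.
transitivity (\int[lam]_(t in `]0%R, +oo[) \sum_(n <oo) ((c n)%:E * ((v t)%:E * h n t))).
  apply: eq_integral => t _; rewrite -nneseriesZl => [|n _]; last first.
    by rewrite mule_ge0// lee_fin.
  by apply: eq_eseriesr => n _; rewrite muleCA.
have mvh n : measurable_fun (`]0%R, +oo[%classic : set (measurableTypeR R))
    (fun t : measurableTypeR R => (v t)%:E * h n t).
  apply: measurable_funTS; apply: emeasurable_funM; last exact: measurable_h.
  exact/measurable_EFinP.
have mI : measurable (`]0%R, +oo[%classic : set (measurableTypeR R)) by exact: measurable_itv.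
have vh0 n t : 0 <= (v t)%:E * h n t by rewrite mule_ge0 ?lee_fin.
rewrite (integral_nneseries lam mI (fun n => measurable_funeM _ (mvh n))); last first.
  by move=> n t _; rewrite mule_ge0 ?lee_fin.
apply: eq_eseriesr => n _.
rewrite (ge0_integralZl_EFin lam mI (fun t _ => vh0 n t) (mvh n) (c0 n)).
by rewrite muleC /box_int haarE.
Qed.

Lemma tnorm_wide_le (l : R) x : (1 <= l)%R ->
  tnorm d s r%:E (wide_norm r%:E l x) <=
  cube_series box_int (@box_center R d) (@box_radius R d) (box_aperture d l) x `^ r^-1.
Proof.
move=> l1; rewrite /tnorm /=; apply: le_poweR; first by rewrite invr_ge0 ltW.
  by apply: haar_int_ge0 => t t0; rewrite mule_ge0 ?lee_fin ?powR_ge0 ?poweR_ge0.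
rewrite (_ : cube_series _ _ _ _ x = haar_int d (fun t =>
    (t `^ (- (s * r)))%:E * \sum_(n <oo) (b l n x)%:E * h n t)); last first.
  by rewrite haar_series.
apply: le_haar_int => t t0; first by rewrite mule_ge0 ?lee_fin ?powR_ge0 ?poweR_ge0.
rewrite lee_pmul2l ?lte_fin ?powR_gt0// poweRVK ?gt_eqF//; last first.
  by apply: integral_ge0 => z _; rewrite ?lee_fin ?powR_ge0 ?poweR_ge0.
exact: wide_le.
Qed.

Lemma tnorm_wide_ge x :
  cube_series box_int (@box_center R d) (@box_radius R d) 1 x `^ r^-1 <=
  tnorm d s r%:E (wide_norm r%:E 1 x).
Proof.
rewrite /tnorm /=; apply: le_poweR; first by rewrite invr_ge0 ltW.
  by apply: cube_series_ge0 => n; exact: box_int_ge0.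
rewrite (_ : cube_series _ _ _ _ x = haar_int d (fun t =>
    (t `^ (- (s * r)))%:E * \sum_(n <oo) (b1 n x)%:E * h n t)); last first.
  by rewrite haar_series.
have hs t : 0 <= \sum_(n <oo) (b1 n x)%:E * h n t.
  by apply: nneseries_ge0 => n _ _; rewrite mule_ge0// lee_fin.
apply: le_haar_int => t t0; first by rewrite mule_ge0 ?lee_fin ?powR_ge0.
rewrite lee_pmul2l ?lte_fin ?powR_gt0// poweRVK ?gt_eqF//; last first.
  by apply: integral_ge0 => z _; rewrite ?lee_fin ?powR_ge0 ?poweR_ge0.
exact: wide_ge.
Qed.

End finite_exponent.

Section infinite_exponent.

Let hoo n (t : R) : \bar R := ess_sup mu (fun y => (in_box n (y, t) * g (y, t))%:E).

Let hoo_ge0 n t : 0 <= hoo n t.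
Proof.
apply: ess_sup_gee; first exact: lebesgue_rV_gt0.
by apply: nearW => y; rewrite lee_fin mulr_ge0.
Qed.

Let hooE n t x : hoo n t =
  ess_sup mu (fun z => (in_box n ((x + 1 *: z)%R, t) * g ((x + 1 *: z)%R, t))%:E).
Proof.
exact: (esym (lebesgue_rV_ess_sup_aff x
  (fun y => (in_box n (y, t) * g (y, t))%:E) ltr01)).
Qed.

(** The analogue of [box_int] for q = +oo. *)
Definition box_sup n := ess_sup_pos (fun t => (t `^ (- s))%:E * hoo n t).

Lemma box_sup_ge0 n : 0 <= box_sup n.
Proof. by apply: ess_sup_pos_ge0 => t t0; rewrite mule_ge0 ?lee_fin ?powR_ge0. Qed.

Let cube_sup_ge (l : R) n x : (0 <= l)%R ->
  cube (@box_center R d n) (l * box_radius R d n) x ->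
  box_sup n <= cube_sup box_sup (@box_center R d) (@box_radius R d) l x.
Proof.
move=> l0 xn; apply: ereal_sup_ubound; exists n => //.
by rewrite indicE mem_set// mule1.
Qed.

(** There are countably many boxes, so almost every t satisfies the bounds for
    all of them at once, and likewise almost every z. *)
Lemma tnorm_wide_le_oo (l : R) x : (1 <= l)%R ->
  tnorm d s +oo (wide_norm +oo l x) <=
  cube_sup box_sup (@box_center R d) (@box_radius R d) (box_aperture d l) x.
Proof.
move=> l1; set S := cube_sup _ _ _ _ _.
have S0 : 0 <= S.
  apply: le_trans (ereal_sup_ubound (ex_intro2 _ _ 0%N I erefl)).
  by rewrite mule_ge0 ?box_sup_ge0// lee_fin.
rewrite /tnorm /ess_sup_pos; apply/ess_supP.
have : \forall t \ae lam, forall n,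
    ((fun t => (t `^ (- s))%:E * hoo n t) \_ `]0%R, +oo[) t <= box_sup n.
  by apply/ae_foralln => n; exact: ess_sup_ge.
apply: filterS; first exact: (ae_filter_ringOfSetsType lam).
move=> t Ht; rewrite patchE; case: ifPn => // t0'.
have t0 : (0 < t)%R by move: t0'; rewrite inE /= in_itv/= andbT.
have ts : (0 < t `^ s)%R by exact: powR_gt0.
have {}Ht n : hoo n t <= (t `^ s)%:E * box_sup n.
  by have := Ht n; rewrite patchE t0' powRN lee_pdivrMl.
rewrite powRN lee_pdivrMl// /wide_norm /set_norm; apply/ess_supP.
have : \forall z \ae mu, forall n,
    (in_box n ((x + 1 *: z)%R, t) * g ((x + 1 *: z)%R, t))%:E <= hoo n t.
  by apply/ae_foralln => n; rewrite (hooE n t x); exact: ess_sup_ge.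
apply: filterS.
move=> z Hz; rewrite patchE; case: ifPn => [/set_mem zb|_]; last first.
  by rewrite mule_ge0// lee_fin ltW.
pose n := pickle (box_index (((x + z)%R, t) : HS)).
have zn : box n (((x + z)%R, t) : HS) by split.
apply: (@le_trans _ _ (hoo n t)).
  apply: le_trans (Hz n); rewrite scale1r /in_box indicE mem_set// mul1r.
  by rewrite g_abs.
apply: (le_trans (Ht n)); rewrite lee_pmul2l//.
apply: cube_sup_ge; first by rewrite !mulr_ge0//; lra.
apply: (box_near_ball l1 zn) => /=.
by rewrite addrC addKr.
Qed.

Lemma tnorm_wide_ge_oo x :
  cube_sup box_sup (@box_center R d) (@box_radius R d) 1 x <=
  tnorm d s +oo (wide_norm +oo 1 x).
Proof.
apply: ge_ereal_sup => _ [n _ <-].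
have T0 : 0 <= tnorm d s +oo (wide_norm +oo 1 x).
  by apply: tnorm_ge0 => t _; exact: wide_norm_ge0.
rewrite indicE; case: (boolP (x \in _)) => [/set_mem xn|_]; last by rewrite mule0.
rewrite mule1; apply: le_ess_sup_pos => t t0; rewrite lee_pmul2l ?lte_fin ?powR_gt0//.
rewrite (hooE n t x); apply: le_ess_sup; apply: nearW => z; rewrite scale1r patchE.
rewrite /in_box indicE.
case: (boolP (((x + z)%R, t) \in _)) => [/set_mem zn|_]; last first.
  by rewrite mul0r; case: ifPn => // _; exact: abs_fun_ge0.
rewrite (mul1r (g _)) mem_set ?g_abs// /euclid_ball /= mul1r.
by have := box_sub_ball d0 zn xn; rewrite /= [(x + z)%R]addrC addrK.
Qed.

End infinite_exponent.
End discretization.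

Section aperture.
Local Open Scope ereal_scope.
Context (R : realType) (d : nat).
Hypothesis d0 : (0 < d)%N.
Notation mu := (lebesgue_rV R d).

Lemma Lp_norm_le_of_integral (e K : R) (f g : 'rV[R]_d -> \bar R) :
  (0 < e)%R -> (0 < K)%R -> (forall x, 0 <= f x) -> (forall x, 0 <= g x) ->
  \int[mu]_x (f x `^ e) <= K%:E * \int[mu]_x (g x `^ e) ->
  Lp_norm e%:E f <= (K `^ e^-1)%:E * Lp_norm e%:E g.
Proof.
move=> e0 K0 f0 g0 H; rewrite /Lp_norm unlock.
under eq_integral do rewrite gee0_abs//.
under [X in _ <= _ * X `^ _]eq_integral do rewrite gee0_abs//.
have I0 (h : 'rV[R]_d -> \bar R) : 0 <= \int[mu]_x (h x `^ e).
  by apply: integral_ge0 => x _; exact: poweR_ge0.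
rewrite -poweR_EFin -poweRM ?lee_fin ?(ltW K0)//.
by apply: le_poweR => //; rewrite invr_ge0 ltW.
Qed.

(** If p and q are finite, [cube_series_dilation] with exponent p / q applies to
    the masses of the boxes.  If q is infinite and p finite, [cube_sup_dilation] applies to the
    p-th powers of the suprema over boxes.  If both are infinite there is no
    loss, since every cube has positive measure and the supremum over a box is
    at most the essential supremum over its cube of the norm at aperture 1. *)
Theorem change_of_aperture (p q : \bar R) : 0 < p -> 0 < q -> (p = +oo -> q = +oo) ->
  exists2 b : R, (0 < b)%R & exists2 C : R, (0 < C)%R &
  forall (s : R) (F : axb_fun R d) (l : R), axb_measurable F -> (1 <= l)%R ->
  Lp_norm p (fun x => tnorm d s q (wide_norm F q l x)) <=
  (C * l `^ b)%:E * Lp_norm p (fun x => tnorm d s q (wide_norm F q 1 x)).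
Proof.
move=> p0 q0 pq.
have T0 (s : R) (F : axb_fun R d) q' l x : 0 <= tnorm d s q' (wide_norm F q' l x).
  by apply: tnorm_ge0 => t _; exact: wide_norm_ge0.
have D0 : (0 < 5 * d.+1%:R :> R)%R by rewrite mulr_gt0.
have lam1 (l : R) : (1 <= l)%R -> (1 <= box_aperture d l)%R.
  by move=> l1; rewrite /box_aperture mulr_ege1// mulr_ege1 ?ler1n.
case: p p0 pq => [e e0 _|_ pq|//].
  rewrite lte_fin in e0.
  case: q q0 => [r r0|_|//].
    rewrite lte_fin in r0; pose th := (e / r)%R.
    have th0 : (0 < th)%R by rewrite divr_gt0.
    have [C C0 HC] := @cube_series_dilation R d th th0.
    pose be := dil_exp d th.
    have be0 : (0 < be)%R.
      by rewrite /be /dil_exp mulr_gt0 ?ltr0n// lt_max ltr01.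
    exists (be / e)%R; first by rewrite divr_gt0.
    exists ((C * (5 * d.+1%:R) `^ be) `^ e^-1)%R.
      by rewrite powR_gt0// mulr_gt0// powR_gt0.
    move=> s F l mF l1; have l0 : (0 < l)%R by lra.
    have -> : ((C * (5 * d.+1%:R) `^ be) `^ e^-1 * l `^ (be / e) =
        (C * (box_aperture d l) `^ be) `^ e^-1)%R.
      rewrite /box_aperture (powRM be (ltW D0) (ltW l0)) mulrA.
      by rewrite [RHS]powRM ?mulr_ge0 ?powR_ge0 ?(ltW C0)// powRrM.
    apply: Lp_norm_le_of_integral => //.
      by rewrite mulr_gt0// powR_gt0// (lt_le_trans ltr01)// lam1.
    pose a := box_int s F r.
    have a0 n : 0 <= a n by exact: box_int_ge0.
    have rad0 n : (0 < box_radius R d n)%R by exact: box_radius_gt0.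
    pose S l' x := cube_series a (@box_center R d) (@box_radius R d) l' x.
    have S0 l' x : 0 <= S l' x by exact: cube_series_ge0.
    have ST x : S 1%R x `^ th <= tnorm d s r%:E (wide_norm F r%:E 1 x) `^ e.
      rewrite /th mulrC poweRrM; apply: le_poweR; rewrite ?(ltW e0) ?poweR_ge0//.
      exact: tnorm_wide_ge.
    have TS x : tnorm d s r%:E (wide_norm F r%:E l x) `^ e <= S (box_aperture d l) x `^ th.
      rewrite /th mulrC poweRrM; apply: le_poweR; rewrite ?(ltW e0)//.
      exact: tnorm_wide_le.
    apply: (@le_trans _ _ (\int[mu]_x (S (box_aperture d l) x `^ th))).
      by apply: le_integralT => x; [exact: poweR_ge0|exact: TS].
    apply: (le_trans (HC a (@box_center R d) (@box_radius R d) a0 rad0 _ (lam1 _ l1))).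
    apply: lee_wpmul2l; first by rewrite lee_fin mulr_ge0 ?powR_ge0// ltW.
    by apply: le_integralT => x; [exact: poweR_ge0|exact: ST].
  exists (d%:R / e)%R; first by rewrite divr_gt0// ltr0n.
  exists ((15 * d.+1%:R) `^ (d%:R / e))%R; first by rewrite powR_gt0// mulr_gt0.
  move=> s F l mF l1; have l0 : (0 < l)%R by lra.
  have L1 := lam1 _ l1; have L0 : (0 < 3 * box_aperture d l)%R by lra.
  have -> : ((15 * d.+1%:R) `^ (d%:R / e) * l `^ (d%:R / e) =
      ((3 * box_aperture d l) ^+ d) `^ e^-1)%R.
    rewrite -powRM ?mulr_ge0 ?(ltW l0)// -powR_mulrn ?(ltW L0)// -powRrM.
    by congr (_ `^ _)%R; rewrite /box_aperture !mulrA; congr (_ * _ * _)%R; ring.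
  apply: Lp_norm_le_of_integral => //; first by rewrite exprn_gt0.
  (* the p-th power of a supremum of nonnegative numbers is the supremum of the
     p-th powers *)
  pose a n := box_sup s F n `^ e.
  have a0 n : 0 <= a n by exact: poweR_ge0.
  have rad0 n : (0 < box_radius R d n)%R by exact: box_radius_gt0.
  pose S l' x := cube_sup a (@box_center R d) (@box_radius R d) l' x.
  have S0 l' x : 0 <= S l' x.
    apply: le_trans (ereal_sup_ubound (ex_intro2 _ _ 0%N I erefl)).
    by rewrite mule_ge0// lee_fin.
  have ST x : S 1%R x <= tnorm d s +oo (wide_norm F +oo 1 x) `^ e.
    apply: ge_ereal_sup => _ [n _ <-]; rewrite indicE.
    case: (boolP (x \in _)) => [xn|_]; last by rewrite mule0 poweR_ge0.
    rewrite mule1; apply: le_poweR; rewrite ?(ltW e0) ?box_sup_ge0//.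
    apply: le_trans (tnorm_wide_ge_oo s d0 F x); apply: ereal_sup_ubound; exists n => //.
    by rewrite indicE xn mule1.
  have TS x : tnorm d s +oo (wide_norm F +oo l x) `^ e <= S (box_aperture d l) x.
    rewrite -[leRHS](@poweRVK _ _ e) ?gt_eqF//; apply: le_poweR; rewrite ?(ltW e0)//.
    apply: (le_trans (tnorm_wide_le_oo s F x l1)); apply: ge_ereal_sup => _ [n _ <-].
    rewrite indicE; case: (boolP (x \in _)) => [xn|_]; last by rewrite mule0 poweR_ge0.
    rewrite mule1 -[leLHS](@poweRK _ _ e) ?gt_eqF ?box_sup_ge0//.
    apply: le_poweR; rewrite ?invr_ge0 ?(ltW e0) ?poweR_ge0//.
    by apply: ereal_sup_ubound; exists n => //; rewrite indicE xn mule1.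
  apply: (@le_trans _ _ (\int[mu]_x (S (box_aperture d l) x))).
    by apply: le_integralT => x; [exact: poweR_ge0|exact: TS].
  apply: (le_trans (cube_sup_dilation (@box_center R d) a0 rad0 L1)).
  apply: lee_wpmul2l; first by rewrite lee_fin exprn_ge0// ltW.
  by apply: le_integralT => x; [exact: S0|exact: ST].
exists 1%R => //; exists 1%R => //; move=> s F l mF l1.
rewrite (pq erefl) in q0 *.
pose T := Lp_norm +oo (fun x => tnorm d s +oo (wide_norm F +oo 1 x)).
have TT0 : 0 <= T by exact: Lp_norm_ge0.
have HT n : box_sup s F n <= T.
  rewrite /T /Lp_norm unlock lebesgue_rV_gt0.
  have rad0 : (0 < 1 * box_radius R d n)%R by rewrite mul1r box_radius_gt0.
  apply: (@ess_sup_ge_on _ _ _ _ (cube (@box_center R d n) (1 * box_radius R d n))).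
  - exact: measurable_cube.
  - have := lebesgue_rV_cube (@box_center R d n) (ltW rad0); set c := cube _ _ => cE.
    by apply: (@lt_le_trans _ _ (lebesgue_rV R d c)) => //; rewrite cE lte_fin exprn_gt0 ?mulrn_wgt0.
  move=> x xn; apply: le_trans (lee_abs _); apply: le_trans (tnorm_wide_ge_oo s d0 F x).
  by apply: ereal_sup_ubound; exists n => //; rewrite indicE mem_set// mule1.
apply: (@le_trans _ _ T); last first.
  rewrite -[leLHS]mul1e; apply: lee_wpmul2r => //.
  by rewrite lee_fin mul1r powRr1; lra.
rewrite {1}/Lp_norm unlock lebesgue_rV_gt0; apply/ess_supP; apply: aeW => x /=.
rewrite gee0_abs; last exact: (T0 s F +oo l x).
 apply: (le_trans (tnorm_wide_le_oo s F x l1)).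
apply: ge_ereal_sup => _ [n _ <-].
rewrite indicE; case: (boolP (x \in _)) => [xn|_]; last by rewrite mule0.
by rewrite mule1.
Qed.

End aperture.

(** * Right translations on T and the operator norms *)

(** The ball B(t z, t) is contained in the ball of radius l r t around 0 with
    l = max(1, (1 + |z|) / r), so that the translated function is controlled by
    F over cones of aperture l. *)
Lemma normT_right_of_aperture (R : realType) (d : nat) (p q : \bar R) (b C s : R)
    (z : 'rV[R]_d) (r : R) (F : axb_fun R d) :
  (0 < p)%E -> (0 < q)%E -> 0 < b -> 0 < C -> 0 < r ->
  (forall l : R, 1 <= l ->
   (Lp_norm p (fun x => tnorm d s q (wide_norm F q l x)) <=
    (C * l `^ b)%:E * Lp_norm p (fun x => tnorm d s q (wide_norm F q 1 x)))%E) ->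
  (normT s p q (right_translation z r F) <=
   (C * r `^ (d%:R * rcp q + s) * Num.max 1 (r `^ (- b) * (1 + euclid z) `^ b))%:E *
   normT s p q F)%E.
Proof.
move=> p0 q0 b0 C0 r0 aperture.
pose l := Num.max 1 ((1 + euclid z) / r).
have l1 : 1 <= l by rewrite le_max lexx.
have z0 := euclid_ge0 z; have z1 : 0 < 1 + euclid z by lra.
have -> : Num.max 1 (r `^ (- b) * (1 + euclid z) `^ b) = l `^ b.
  rewrite -(powR_invl _ r0) -powRM ?invr_ge0 ?(ltW r0) ?(ltW z1)// [_^-1 * _]mulrC.
  rewrite /l; set w := _ / r; have w0 : 0 < w by rewrite divr_gt0.
  have [w1|w1] := leP 1 w.
    by rewrite max_r//; apply: le_trans (ler_powR w1 (ltW b0)); rewrite powRr0.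
  rewrite powR1 max_l//; apply: (@le_trans _ _ (1 `^ b)); last by rewrite powR1.
  by apply: ge0_ler_powR; rewrite ?nnegrE ?(ltW b0) ?(ltW w0) ?(ltW w1)// ler01.
have step x t : 0 < t ->
    (ball_norm q (right_translation z r F) x t <= wide_norm F q l x (r * t))%E.
  move=> t0; pose f v := abs_fun F (x + v) (r * t).
  have f0 v : (0 <= f v)%E by exact: abs_fun_ge0.
  have := set_norm_aff (euclid_ball (l * (r * t))) (t *: z) q0 ltr01 f0.
  rewrite powR1 mul1e -/(wide_norm F q l x (r * t)) => <-.
  apply: le_set_norm => // [w|w wt]; [exact: abs_fun_ge0|split].
    rewrite /aff /euclid_ball /= scale1r.
    apply: (le_lt_trans (ler_euclidD _ _)); rewrite euclidZ ?(ltW t0)//.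
    apply: (@lt_le_trans _ _ ((1 + euclid z) * t)).
      by rewrite mulrDl mul1r mulrC addrC ltrD2r.
    rewrite mulrA ler_pM2r// -ler_pdivrMr// /l le_max.
    by rewrite lexx orbT.
  by rewrite abs_right /f scale1r [t *: z + w]addrC addrA.
rewrite !(normTE _ _ q0).
have W0 l' x t : (0 <= wide_norm F q l' x t)%E by exact: wide_norm_ge0.
apply: (@le_trans _ _ ((r `^ (s + d%:R * rcp q))%:E *
    Lp_norm p (fun x => tnorm d s q (wide_norm F q l x)))%E).
  rewrite -Lp_normZl ?powR_gt0//; apply: le_Lp_norm => // x.
    by apply: tnorm_ge0 => t _; exact: ball_norm_ge0.
  rewrite -(tnorm_dil d s q0 r0 (fun t _ => W0 l x t)); apply: le_tnorm => // t t0.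
    exact: ball_norm_ge0.
  exact: step.
rewrite -mulrA mulrCA EFinM -muleA [s + _]addrC.
rewrite lee_pmul2l ?lte_fin ?powR_gt0//; apply: (le_trans (aperture _ l1)).
rewrite le_eqVlt; apply/orP; left; apply/eqP.
do 2 (apply: f_equal); apply/funext => x; apply: eq_tnorm => t t0.
by rewrite /wide_norm mul1r.
Qed.

Theorem proposition4p2 (R : realType) (d : nat) (p q : \bar R) :
  (0 < d)%N -> (0 < p)%E -> (0 < q)%E ->
  [/\
    forall (s : R) (z : 'rV[R]_d) (r : R), 0 < r ->
      [/\ preserves (normL s p q) (left_translation z r),
          preserves (normL s p q) (right_translation z r),
          opnorm (normL s p q) (left_translation z r) =
            (r `^ (d%:R * (rcp p - rcp q) - s))%:E
        & opnorm (normL s p q) (right_translation z r) =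
            (r `^ (s + d%:R * rcp q))%:E],
    forall (s : R) (z : 'rV[R]_d) (r : R), 0 < r ->
      preserves (normT s p q) (left_translation z r) /\
      opnorm (normT s p q) (left_translation z r) =
        (r `^ (d%:R * rcp p - s))%:E,
    (p = +oo%E -> q = +oo%E) ->
      exists b : R, 0 < b /\
      forall s : R, exists C : R, 0 < C /\
      forall (z : 'rV[R]_d) (r : R), 0 < r ->
        preserves (normT s p q) (right_translation z r) /\
        (opnorm (normT s p q) (right_translation z r) <=
         (C * r `^ (d%:R * rcp q + s) *
          Num.max 1 (r `^ (- b) * (1 + euclid z) `^ b))%:E)%E
  &
    forall (s a : R) (z : 'rV[R]_d) (r : R), 0 < a -> 0 < r ->
      [/\ preserves (normP s a p q) (left_translation z r),
          preserves (normP s a p q) (right_translation z r),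
          (opnorm (normP s a p q) (left_translation z r) <=
            (r `^ (d%:R * (rcp p - rcp q) - s))%:E)%E,
          d%:R * rcp p < a ->
            opnorm (normP s a p q) (left_translation z r) =
              (r `^ (d%:R * (rcp p - rcp q) - s))%:E
        & (opnorm (normP s a p q) (right_translation z r) <=
            (r `^ (s + d%:R * rcp q) * Num.max 1 (r `^ (- a)) *
             (1 + euclid z) `^ a)%:E)%E]].

Proof.
move=> d0 p0 q0.
have pow0 (r x : R) : 0 <= r `^ x by exact: powR_ge0.
have bumpE N : (0%R < N (@bump R d) < +oo)%E ->
    exists F, axb_measurable F /\ (0%R < N F < +oo)%E.
  by move=> ?; exists (@bump R d); split => //; exact: axb_measurable_bump.
split.
- move=> s z r r0; split.
  + apply: (@preserves_le _ _ _ _ (r `^ (d%:R * (rcp p - rcp q) - s))).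
    * by move=> F; exact: axb_measurable_left.
    * by move=> F _ _; rewrite normL_left.
    * by move=> F; exact: normL_ge0.
  + apply: (@preserves_le _ _ _ _ (r `^ (s + d%:R * rcp q))).
    * by move=> F; exact: axb_measurable_right.
    * by move=> F _ _; rewrite normL_right.
    * by move=> F; exact: normL_ge0.
  + apply: opnorm_eq => //; first exact: normL_homogeneous.
      by move=> F; exact: normL_left.
    by apply: bumpE; exact: normL_bump.
  + apply: opnorm_eq => //; first exact: normL_homogeneous.
      by move=> F; exact: normL_right.
    by apply: bumpE; exact: normL_bump.
- move=> s z r r0; split.
    apply: (@preserves_le _ _ _ _ (r `^ (d%:R * rcp p - s))).
    * by move=> F; exact: axb_measurable_left.
    * by move=> F _ _; rewrite normT_left.
    * by move=> F; exact: normT_ge0.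
  apply: opnorm_eq => //; first exact: normT_homogeneous.
    by move=> F; exact: normT_left.
  by apply: bumpE; exact: normT_bump.
- move=> pq; have [b b0 [C C0 H]] := @change_of_aperture R d d0 p q p0 q0 pq.
  exists b; split => // s; exists C; split => // z r r0.
  have bound F : (normT s p q F < +oo)%E -> axb_measurable F ->
      (normT s p q (right_translation z r F) <=
       (C * r `^ (d%:R * rcp q + s) *
        Num.max 1 (r `^ (- b) * (1 + euclid z) `^ b))%:E * normT s p q F)%E.
    by move=> _ mF; apply: normT_right_of_aperture => // l l1; exact: H.
  split.
    apply: preserves_le bound _; last by move=> F; exact: normT_ge0.
    by move=> F; exact: axb_measurable_right.
  by apply: opnorm_le bound; rewrite !mulr_ge0 ?(ltW C0)// le_max ler01.
- move=> s a z r a0 r0.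
  have left F : normP s a p q (left_translation z r F) =
      ((r `^ (d%:R * (rcp p - rcp q) - s))%:E * normP s a p q F)%E.
    exact: normP_left.
  have right F : (normP s a p q F < +oo)%E -> axb_measurable F ->
      (normP s a p q (right_translation z r F) <=
       (r `^ (s + d%:R * rcp q) * Num.max 1 (r `^ (- a)) *
        (1 + euclid z) `^ a)%:E * normP s a p q F)%E.
    by move=> _ _; exact: normP_right.
  split.
  + apply: (@preserves_le _ _ _ _ (r `^ (d%:R * (rcp p - rcp q) - s))).
    * by move=> F; exact: axb_measurable_left.
    * by move=> F _ _; rewrite left.
    * by move=> F; exact: normP_ge0.
  + apply: preserves_le right _; last by move=> F; exact: normP_ge0.
    by move=> F; exact: axb_measurable_right.
  + by apply: opnorm_le => // F _ _; rewrite left.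
  + move=> da; apply: opnorm_eq => //; first exact: normP_homogeneous.
    by apply: bumpE; exact: normP_bump.
  + by apply: opnorm_le right; rewrite !mulr_ge0// le_max ler01.
Qed.
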